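(* Let $(M,\pi)$ be an integrable Poisson manifold with $\alpha$-connected and $\alpha$-simply-connected symplectic groupoid $(G,\Omega,\alpha,\beta)$. Let $B$ be a closed $2$-form on $M$ such that $\pi_B=\tau_B(\pi)$ is Poisson. Then the Poisson manifolds $(M,\pi)$ and $(M,\pi_B)$ are Morita equivalent, with Morita equivalence bimodule $(G,\widehat\Omega,\alpha,\beta)$, where $\widehat\Omega=\Omega-\beta^*B$.
   Context: A symplectic groupoid is a Lie groupoid $G$ with a symplectic form $\Omega$ such that the graph of the multiplication is lagrangian in $G\times G\times\overline G$, where $\overline G$ is $G$ with symplectic form $-\Omega$. The source map is $\alpha$, the target map is $\beta$. There is a unique Poisson structure on the identity section $G_0$ making $\alpha$ Poisson and $\beta$ anti-Poisson; $G$ is a symplectic groupoid of $(M,\pi)$ if $G_0=M$ and this structure is $\pi$. $(M,\pi)$ is integrable if it admits a symplectic groupoid. $\alpha$-connected and $\alpha$-simply-connected means that the fibers of $\alpha$ are connected and simply connected. Conventions: a bivector $\pi$ is identified with $\tilde\pi:T^*M\to TM$, $\eta(\tilde\pi(\nu))=\pi(\eta,\nu)$; a symplectic form $\Omega$ is viewed as the Poisson structure with $\tilde\pi$ inverse to $v\mapsto\Omega(v,\cdot)$. The gauge transformation of $\pi$ by a closed $2$-form $B$ is the Dirac structure $\tau_B(\pi)=\{(\tilde\pi(\eta),\eta+B(\tilde\pi(\eta),\cdot)):\eta\in T^*M\}\subset TM\oplus T^*M$; it ''is Poisson'' if it is the graph $\{(\tilde\pi_B(\eta),\eta)\}$ of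 a Poisson bivector, denoted $\pi_B$. Morita equivalence: Poisson manifolds $(M_1,\pi_1)$ and $(M_2,\pi_2)$ are Morita equivalent if there are a symplectic manifold $(S,\Omega_S)$ and Poisson maps $J_1:S\to(M_1,\pi_1)$, $J_2:S\to(M_2,-\pi_2)$ which are surjective submersions with connected and simply connected fibers, are complete (whenever a function $f$ on the target has complete hamiltonian vector field, so does $J_i^*f$), and satisfy $\ker T_xJ_1=(\ker T_xJ_2)^{\Omega_S}$ for all $x\in S$. Then $(S,\Omega_S,J_1,J_2)$ is called a Morita equivalence bimodule. *)

(* Defs.v *)
From HB Require Import structures.
From mathcomp Require Import all_boot all_order all_algebra.
From mathcomp Require Import all_classical all_reals all_analysis.
Set Implicit Arguments.
Unset Strict Implicit.
Unset Printing Implicit Defensive.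
Import Order.TTheory GRing.Theory Num.Theory.
Import numFieldNormedType.Exports.
Local Open Scope classical_set_scope.
Local Open Scope ring_scope.

Section Euclidean.
Context {R : realType} {n : nat}.

Definition basis_vector (i : 'I_n) : 'rV[R]_n := delta_mx 0 i.

Fixpoint Ck (k : nat) (U : set 'rV[R]_n) (f : 'rV[R]_n -> R) : Prop :=
  (forall x, U x -> {for x, continuous f}) /\
  if k is k'.+1 then
    forall i : 'I_n,
      (forall x, U x -> derivable f x (basis_vector i)) /\
      Ck k' U (fun x => 'D_(basis_vector i) f x)
  else True.

(* Only meaningful for open [U]. *)
Definition Cinfty (U : set 'rV[R]_n) (f : 'rV[R]_n -> R) : Prop :=
  forall k, Ck k U f.

End Euclidean.

(* [cmap] and [cinv] are total; only their restrictions to [cdom] and to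
   [cmap @` cdom] matter. *)
Record chart (R : realType) (T : topologicalType) (n : nat) := Chart {
  cdom : set T;
  cmap : T -> 'rV[R]_n;
  cinv : 'rV[R]_n -> T }.

(* The raw data of a manifold; the axioms are in [smooth_manifold]. *)
Record atlas_space (R : realType) := AtlasSpace {
  carrier :> topologicalType;
  dim : nat;
  atlas : set (chart R carrier dim) }.
Arguments dim {R} a.
Arguments atlas {R} a.

Section Manifolds.
Context {R : realType}.

Definition is_chart (T : topologicalType) n (c : chart R T n) : Prop :=
  [/\ open (cdom c), open (cmap c @` cdom c),
      (forall x, cdom c x -> cinv c (cmap c x) = x),
      (forall x, cdom c x -> {for x, continuous (cmap c)}) &
      (forall y, (cmap c @` cdom c) y -> {for y, continuous (cinv c)})].

Definition compatible (T : topologicalType) n (c d : chart R T n) : Prop :=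
  forall j : 'I_n, Cinfty (cmap c @` (cdom c `&` cdom d))
                          (fun y => cmap d (cinv c y) 0 j).

Definition smooth_manifold (M : atlas_space R) : Prop :=
  [/\ hausdorff_space M, @second_countable M,
      (forall c, atlas M c -> is_chart c),
      (forall x : M, exists2 c, atlas M c & cdom c x) &
      (forall c d, atlas M c -> atlas M d -> compatible c d)].

Definition smooth_fun (M : atlas_space R) (f : M -> R) : Prop :=
  forall c, atlas M c -> Cinfty (cmap c @` cdom c) (fun y => f (cinv c y)).

(* Only meaningful for open [U]. *)
Definition smooth_map_on (M N : atlas_space R) (U : set M) (J : M -> N) : Prop :=
  (forall x, U x -> {for x, continuous J}) /\
  forall c d, atlas M c -> atlas N d -> forall j : 'I_(dim N),
    Cinfty (cmap c @` (cdom c `&` U `&` J @^-1` cdom d))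
           (fun y => cmap d (J (cinv c y)) 0 j).

Definition smooth_map (M N : atlas_space R) (J : M -> N) : Prop :=
  smooth_map_on setT J.

(* Smoothness on an arbitrary subset: local extendability. On an embedded
   submanifold this is smoothness for the induced structure. *)
Definition smooth_map_rel (M N : atlas_space R) (A : set M) (J : M -> N) : Prop :=
  forall x, A x -> exists U : set M, exists F : M -> N,
    [/\ open U, U x, smooth_map_on U F & forall y, A y -> U y -> J y = F y].

Definition prod_chart (T T' : topologicalType) n n'
    (c : chart R T n) (c' : chart R T' n') : chart R (T * T')%type (n + n') :=
  {| cdom := cdom c `*` cdom c';
     cmap := fun p => row_mx (cmap c p.1) (cmap c' p.2);
     cinv := fun y => (cinv c (lsubmx y), cinv c' (rsubmx y)) |}.

Definition prod_manifold (M N : atlas_space R) : atlas_space R :=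
  {| carrier := (M * N)%type;
     dim := (dim M + dim N)%N;
     atlas := [set e | exists c d, [/\ atlas M c, atlas N d &
                                       e = prod_chart c d]] |}.

End Manifolds.

Section Tangent.
Context {R : realType}.

(* Tangent vectors at [x] are the derivations at [x] of the algebra of smooth
   functions, extended by 0 to non-smooth functions so that equality of tangent
   vectors is equality of functions. *)
Definition derivation_at (M : atlas_space R) (x : M)
    (v : (M -> R) -> R^o) : Prop :=
  [/\ (forall f, ~ smooth_fun f -> v f = 0),
      (forall (a : R) f g, smooth_fun f -> smooth_fun g ->
         v (fun y => a * f y + g y) = a * v f + v g) &
      (forall f g, smooth_fun f -> smooth_fun g ->
         v (fun y => f y * g y) = f x * v g + g x * v f)].

Definition derivation_pred (M : atlas_space R) (x : M) :
  pred ((M -> R) -> R^o) := fun v => `[< derivation_at x v >].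

Lemma derivation_submod (M : atlas_space R) (x : M) :
  submod_closed (derivation_pred x).
Proof.
split.
  apply/asboolP; split=> // *; rewrite /GRing.zero /= ?mulr0 ?addr0 //.
move=> a u v /asboolP[u0 uD uM] /asboolP[v0 vD vM]; apply/asboolP.
have E f : (a *: u + v) f = a * u f + v f by [].
split=> [f Nf|b f g sf sg|f g sf sg]; rewrite !E.
- by rewrite u0 // v0 // mulr0 addr0.
- by rewrite uD // vD // !mulrDr addrACA mulrCA.
- by rewrite uM // vM // !mulrDr addrACA !(mulrCA a).
Qed.

Record tangent (M : atlas_space R) (x : M) := Tangent {
  tval : (M -> R) -> R^o;
  _ : derivation_pred x tval }.

End Tangent.

HB.instance Definition _ (R : realType) (M : atlas_space R) (x : M) :=
  [isSub for @tval R M x].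
HB.instance Definition _ (R : realType) (M : atlas_space R) (x : M) :=
  [Choice of tangent x by <:].
HB.instance Definition _ (R : realType) (M : atlas_space R) (x : M) :=
  GRing.SubChoice_isSubLmodule.Build R ((M -> R) -> R^o) (derivation_pred x)
    (tangent x) (derivation_submod x).

Notation cotangent x := {linear tangent x -> _^o}.

Section Calculus.
Context {R : realType}.
Implicit Types M N P : atlas_space R.

Definition dfun M (f : M -> R) (x : M) (v : tangent x) : R^o := tval v f.

Lemma dfun_linear M (f : M -> R) (x : M) : linear (@dfun M f x).
Proof. by []. Qed.

HB.instance Definition _ M (f : M -> R) (x : M) :=
  GRing.isLinear.Build R (tangent x) R^o *:%R (@dfun M f x) (@dfun_linear M f x).

Definition differential M (f : M -> R) (x : M) : cotangent x := @dfun M f x.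

(* The tangent map of [J], characterized by (TJ v) g = v (g \o J); the default
   value 0 only occurs when [J] is not smooth. *)
Definition tmap M N (J : M -> N) (x : M) (v : tangent x) : tangent (J x) :=
  xget 0 [set w : tangent (J x) |
           forall g, smooth_fun g -> tval w g = tval v (g \o J)].

Definition ker_tmap M N (J : M -> N) (x : M) : set (tangent x) :=
  [set v | tmap J v = 0].
Arguments ker_tmap {M N} J x.

(* [c] passes through [x] at time [t], is differentiable there, and has
   velocity [v]. *)
Definition velocity M (c : R -> M) (t : R) (x : M) (v : tangent x) : Prop :=
  c t = x /\
  forall f : M -> R, smooth_fun f -> is_derive t (1 : R) (f \o c) (tval v f).

Definition surjective_submersion M N (J : M -> N) : Prop :=
  [/\ smooth_map J, (forall y, exists x, J x = y) &
      (forall (x : M) (w : tangent (J x)), exists v : tangent x, tmap J v = w)].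

Definition vfield M := forall x : M, tangent x.

Definition vapply M (X : vfield M) (f : M -> R) : M -> R :=
  fun x => tval (X x) f.

Definition smooth_vfield M (X : vfield M) : Prop :=
  forall f, smooth_fun f -> smooth_fun (vapply X f).

Definition lie_bracket M (X Y : vfield M) : vfield M := fun x =>
  xget 0 [set w : tangent x | forall f, smooth_fun f ->
    tval w f = vapply X (vapply Y f) x - vapply Y (vapply X f) x].

Definition complete_vfield M (X : vfield M) : Prop :=
  forall x : M, exists c : R -> M, c 0 = x /\ forall t, velocity c t (X (c t)).

Definition form2 M := forall x : M, tangent x -> tangent x -> R.

Definition feval M (B : form2 M) (X Y : vfield M) : M -> R :=
  fun x => B x (X x) (Y x).

Definition is_form2 M (B : form2 M) : Prop :=
  [/\ (forall x a (u v w : tangent x),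
         B x (a *: u + v) w = a * B x u w + B x v w),
      (forall x a (u v w : tangent x),
         B x w (a *: u + v) = a * B x w u + B x w v),
      (forall x (v : tangent x), B x v v = 0) &
      (forall X Y : vfield M, smooth_vfield X -> smooth_vfield Y ->
         smooth_fun (feval B X Y))].

(* The invariant formula for dB(X, Y, Z). *)
Definition ext_derivative M (B : form2 M) (X Y Z : vfield M) : M -> R := fun x =>
    vapply X (feval B Y Z) x - vapply Y (feval B X Z) x
  + vapply Z (feval B X Y) x
  - feval B (lie_bracket X Y) Z x + feval B (lie_bracket X Z) Y x
  - feval B (lie_bracket Y Z) X x.

Definition closed_form2 M (B : form2 M) : Prop :=
  is_form2 B /\
  forall X Y Z : vfield M, smooth_vfield X -> smooth_vfield Y ->
    smooth_vfield Z -> forall x, ext_derivative B X Y Z x = 0.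

Definition pullback M N (J : M -> N) (B : form2 N) : form2 M :=
  fun x u v => B (J x) (tmap J u) (tmap J v).

Definition form_add M (A B : form2 M) : form2 M :=
  fun x u v => A x u v + B x u v.

Definition form_sub M (A B : form2 M) : form2 M :=
  fun x u v => A x u v - B x u v.

Definition symplectic M (Om : form2 M) : Prop :=
  closed_form2 Om /\
  forall (x : M) (v : tangent x), (forall w, Om x v w = 0) -> v = 0.

Definition symp_orth M (Om : form2 M) (x : M) (W : set (tangent x)) :
    set (tangent x) :=
  [set v | forall w, W w -> Om x v w = 0].

(* Embedded submanifolds, as sets locally cut out by independent equations. *)
Definition submanifold P (L : set P) : Prop :=
  forall x, L x -> exists k (U : set P) (f : 'I_k -> P -> R),
    [/\ open U, U x, (forall i, smooth_fun (f i)),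
        (forall y, U y -> (L y <-> forall i, f i y = 0)) &
        (forall a : 'I_k -> R,
           (forall v : tangent x, \sum_(i < k) a i * tval v (f i) = 0) ->
           forall i, a i = 0)].

(* On an embedded submanifold, curves differentiable at 0 give the same
   velocities as smooth curves. *)
Definition tangent_to P (L : set P) (x : P) : set (tangent x) :=
  [set v | exists c : R -> P, (forall t, L (c t)) /\ velocity c 0 v].
Arguments tangent_to {P} L x.

Definition lagrangian P (Om : form2 P) (L : set P) : Prop :=
  submanifold L /\
  forall x, L x -> tangent_to L x = symp_orth Om (tangent_to L x).

(* A bivector pi is given by the bundle map T*M -> TM, written [pi x],
   with eta (pi x nu) the value of the bivector on (eta, nu). *)
Definition bivector M := forall x : M, cotangent x -> tangent x.

Definition ham_vfield M (pi : bivector M) (f : M -> R) : vfield M :=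
  fun x => pi x (differential f x).

Definition pbracket M (pi : bivector M) (f g : M -> R) : M -> R :=
  fun x => differential f x (pi x (differential g x)).

Definition is_bivector M (pi : bivector M) : Prop :=
  [/\ (forall x (a : R) (xi eta nu : cotangent x),
         (forall v, xi v = a * eta v + nu v) ->
         pi x xi = a *: pi x eta + pi x nu),
      (forall x (eta : cotangent x), eta (pi x eta) = 0) &
      (forall f g, smooth_fun f -> smooth_fun g -> smooth_fun (pbracket pi f g))].

Definition poisson M (pi : bivector M) : Prop :=
  is_bivector pi /\
  forall f g h, smooth_fun f -> smooth_fun g -> smooth_fun h -> forall x,
    pbracket pi f (pbracket pi g h) x + pbracket pi g (pbracket pi h f) x
    + pbracket pi h (pbracket pi f g) x = 0.

Definition opp_bivector M (pi : bivector M) : bivector M :=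
  fun x eta => - pi x eta.

(* The Poisson structure of a symplectic form: inverse of v |-> Om(v, .). *)
Definition form_bivector M (Om : form2 M) : bivector M := fun x eta =>
  xget 0 [set v : tangent x | forall w, Om x v w = eta w].

Definition poisson_map M N (piM : bivector M) (piN : bivector N)
    (J : M -> N) : Prop :=
  smooth_map J /\
  forall f g, smooth_fun f -> smooth_fun g -> forall x,
    pbracket piM (f \o J) (g \o J) x = pbracket piN f g (J x).

Definition complete_map M N (piM : bivector M) (piN : bivector N)
    (J : M -> N) : Prop :=
  forall f, smooth_fun f -> complete_vfield (ham_vfield piN f) ->
    complete_vfield (ham_vfield piM (f \o J)).

(* Fiber at [x] of the Dirac structure tau_B(pi). *)
Definition gauge M (B : form2 M) (pi : bivector M) (x : M) :
    set (tangent x * cotangent x)%type :=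
  [set p : tangent x * cotangent x | exists eta : cotangent x,
     p.1 = pi x eta /\ forall w, p.2 w = eta w + B x (pi x eta) w].
Arguments gauge {M} B pi x.

Definition bivector_graph M (pi : bivector M) (x : M) :
    set (tangent x * cotangent x)%type :=
  [set p : tangent x * cotangent x | p.1 = pi x p.2].
Arguments bivector_graph {M} pi x.

Record groupoid_ops (G M : atlas_space R) := GroupoidOps {
  gsrc : G -> M;
  gtgt : G -> M;
  gid : M -> G;
  ginv : G -> G;
  gmul : G -> G -> G }.

(* The product [gmul g h] is meaningful when the source of g is the target
   of h. *)
Definition composable (G M : atlas_space R) (s : groupoid_ops G M) :
    set (prod_manifold G G) :=
  [set p | gsrc s p.1 = gtgt s p.2].

Definition is_groupoid (G M : atlas_space R) (s : groupoid_ops G M) : Prop :=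
  let: GroupoidOps a b e i m := s in
  [/\ (forall x, a (e x) = x /\ b (e x) = x),
      (forall g h, a g = b h -> a (m g h) = a h /\ b (m g h) = b g),
      (forall g h k, a g = b h -> a h = b k -> m (m g h) k = m g (m h k)),
      (forall g, m g (e (a g)) = g /\ m (e (b g)) g = g) &
      (forall g, [/\ a (i g) = b g, b (i g) = a g,
                     m g (i g) = e (b g) & m (i g) g = e (a g)])].

Definition lie_groupoid (G M : atlas_space R) (s : groupoid_ops G M) : Prop :=
  [/\ smooth_manifold G /\ smooth_manifold M, is_groupoid s,
      surjective_submersion (gsrc s) /\ surjective_submersion (gtgt s),
      smooth_map (gid s) /\ smooth_map (ginv s) &
      @smooth_map_rel _ (prod_manifold G G) G (composable s)
        (fun p => gmul s p.1 p.2)].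

Definition triple_manifold M := prod_manifold M (prod_manifold M M).

Definition mul_graph (G M : atlas_space R) (s : groupoid_ops G M) :
    set (triple_manifold G) :=
  [set p | gsrc s p.1 = gtgt s p.2.1 /\ p.2.2 = gmul s p.1 p.2.1].

(* The symplectic form of G x G x Gbar. *)
Definition triple_form M (Om : form2 M) : form2 (triple_manifold M) :=
  form_sub
    (form_add (@pullback (triple_manifold M) M (fun p => p.1) Om)
              (@pullback (triple_manifold M) M (fun p => p.2.1) Om))
    (@pullback (triple_manifold M) M (fun p => p.2.2) Om).

(* The identity section is identified with [M] through [gid]; the last clause
   characterizes the Poisson structure induced on it. *)
Definition symplectic_groupoid (G M : atlas_space R) (s : groupoid_ops G M)
    (Om : form2 G) (pi : bivector M) : Prop :=
  [/\ lie_groupoid s, symplectic Om, lagrangian (triple_form Om) (mul_graph s),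
      poisson pi &
      poisson_map (form_bivector Om) pi (gsrc s) /\
      poisson_map (form_bivector Om) (opp_bivector pi) (gtgt s)].

Definition simply_connected (T : topologicalType) (A : set T) : Prop :=
  let I : set R := `[0, 1]%classic in
  connected A /\
  forall c : R -> T,
    {within I, continuous c} -> c @` I `<=` A -> c 0 = c 1 ->
  exists H : R * R -> T,
    [/\ {within I `*` I, continuous H},
        H @` (I `*` I) `<=` A,
        (forall t, I t -> H (t, 0) = c t /\ H (t, 1) = c 0) &
        (forall s, I s -> H (0, s) = c 0 /\ H (1, s) = c 0)].

Definition simply_connected_fibers M N (J : M -> N) : Prop :=
  forall y : N, simply_connected (J @^-1` [set y]).

Definition morita_bimodule (M1 M2 S : atlas_space R)
    (pi1 : bivector M1) (pi2 : bivector M2)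
    (Om : form2 S) (J1 : S -> M1) (J2 : S -> M2) : Prop :=
  let piS := form_bivector Om in
  [/\ smooth_manifold S /\ symplectic Om,
      [/\ poisson_map piS pi1 J1, surjective_submersion J1,
          simply_connected_fibers J1 & complete_map piS pi1 J1],
      [/\ poisson_map piS (opp_bivector pi2) J2, surjective_submersion J2,
          simply_connected_fibers J2 & complete_map piS (opp_bivector pi2) J2] &
      forall x : S, ker_tmap J1 x = symp_orth Om (ker_tmap J2 x)].

Definition morita_equivalent (M1 M2 : atlas_space R)
    (pi1 : bivector M1) (pi2 : bivector M2) : Prop :=
  exists (S : atlas_space R) (Om : form2 S) (J1 : S -> M1) (J2 : S -> M2),
    morita_bimodule pi1 pi2 Om J1 J2.

End Calculus.

Arguments ker_tmap {R M N} J x.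
Arguments tangent_to {R P} L x.
Arguments gauge {R M} B pi x.
Arguments bivector_graph {R M} pi x.

(* Main.v *)
(* Write [a], [b] for the source and the target, [Om'] for [Om - b^*B].  The graph
   of the multiplication contains the curves (g, e(a g), g) and (e(b g), g, g);
   as it is lagrangian, ker Ta and ker Tb are Om-orthogonal along the units, so
   that 2 (dim G - dim M) <= dim G.  Its maximality gives
   (ker Tb)^Om <= ker Ta and (ker Ta)^Om <= ker Tb at every point, and the count
   of dimensions makes these inclusions equalities.  Hence Om' and Om have the
   same orthogonals of ker Tb, and a hamiltonian field of [f o a] is the same
   for both.

   If Om'(v, .) = theta o Tb, then Om(v, .) = eta o Tb for
   eta = theta + B(Tb v, .), so Tb v = - pi eta as [b] is anti-Poisson, and
   gauging by [B] gives Tb v = - piB theta.  For theta = 0 this is the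
   nondegeneracy of Om'; for theta = df it says that [b] is anti-Poisson for
   Om' and piB.

   The completeness of [a] and [b] is proved for all the fields X with
   Om(X, .) the pull back by [a] (or [b]) of a covector field on M.  By
   maximality of the graph, (0, X_h, X_gh) is tangent to it, so X is invariant
   by translations.  Its integral curves through the units over a compact piece
   of an integral curve of the projected field exist for a uniform time, and
   translating them shows the same over every point of G. *)
From HB Require Import structures.
From mathcomp Require Import all_boot all_order all_algebra.
From mathcomp Require Import ring lra.
From mathcomp Require Import all_classical all_reals all_analysis.
Require Import Defs.
Set Implicit Arguments.
Unset Strict Implicit.
Unset Printing Implicit Defensive.
Import Order.TTheory GRing.Theory Num.Theory.
Import numFieldNormedType.Exports.
Local Open Scope classical_set_scope.
Local Open Scope ring_scope.

(** Tangent vectors are derivations of the global smooth functions, so nothing can be computed in a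
    chart before such derivations are known to be local. This is the origin of the bump functions,
    of Hadamard's lemma and of the frames made of global fields that are coordinate fields only near
    a point. Moreover, tangent spaces at points that are merely proved equal are different types:
    vectors are then compared by their values on functions, and points by the smooth functions that
    separate them.

    The two completeness statements are not symmetric. For f o a the form Om(X, .) is exact. For f o
    b it is the pull back of df + B(Y, .), with Y the projected field, and this covector field is in
    general not closed, so that X need not be hamiltonian for Om. Lifting is therefore proved for
    covector fields given point by point: invariance under translations only uses that Om(X, .)
    comes from M at each point.

    The two curves in the graph meet only over units, so isotropy of the kernels is read off there;
    what travels to the other points is the inequality between dimensions. *)

Notation "''ev_' i" := (basis_vector i) (at level 8, i at level 2, format "''ev_' i").

(** * Calculus in R^n *)

Section Calculus.
Context {R : realType}.

Lemma cvg_sum_ord (T : Type) (F : set_system T) {FF : Filter F} n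
    (f : 'I_n -> T -> R) (a : 'I_n -> R) :
  (forall i, f i x @[x --> F] --> a i) ->
  \sum_i f i x @[x --> F] --> \sum_i a i.
Proof. by move=> H; apply: cvg_big => //; exact: add_continuous. Qed.

Lemma derive1P (V W : normedModType R) (f : V -> W) x v :
  'D_v f x = 'D_1 (fun h : R => f (h *: v + x)) 0.
Proof.
rewrite /derive; set g1 := fun h => h^-1 *: _; set g2 := fun h => h^-1 *: _.
suff -> : g1 = g2 by [].
by rewrite funeqE /g1 /g2 => h /=; rewrite addr0 scale0r add0r [_%:A]mulr1.
Qed.

Lemma row_sum_basis m (w : 'rV[R]_m) : w = \sum_j w 0 j *: 'ev_j.
Proof. by rewrite [LHS]row_sum_delta. Qed.

(** The inner map is only derivable in the direction [v]. Along the line [h *: v + x] it becomes a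
    curve, for which derivability is differentiability, and the chain rule for differentials
    applies. *)
Lemma is_derive_chain (V : normedModType R) m (g : V -> 'rV[R]_m)
    (f : 'rV[R]_m -> R) x v :
  (forall j, derivable (fun x => g x 0 j) x v) -> differentiable f (g x) ->
  is_derive x v (f \o g)
    (\sum_j 'D_('ev_j) f (g x) * 'D_v (fun x => g x 0 j) x).
Proof.
move=> dg df.
have dgm : derivable g x v by apply/derivable_mxP => i j; rewrite (ord1 i).
have /derivable1P/derivable1_diffP dc := dgm.
set c := (fun h : R => _) in dc.
have c0 : c 0 = g x by rewrite /c scale0r add0r.
have df' : differentiable f (c 0) by rewrite c0.
have dfc : differentiable (f \o c) 0 by exact: differentiable_comp.
split; first by apply/derivable1P/derivable1_diffP.
rewrite derive1P -/(f \o c) deriveE // diff_comp //= c0.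
have -> : 'd c 0 1 = 'D_v g x by rewrite -deriveE // [RHS]derive1P.
rewrite (row_sum_basis ('D_v g x)) linear_sum /=; apply: eq_bigr => j _.
rewrite linearZ /= -deriveE // derive_mx // mxE.
by rewrite [RHS]mulrC.
Qed.

Lemma MVT_dir n (f : 'rV[R]_n -> R) p i a :
  (forall s, Num.min 0 a <= s <= Num.max 0 a -> derivable f (p + s *: 'ev_i) 'ev_i) ->
  exists2 s, Num.min 0 a <= s <= Num.max 0 a &
    f (p + a *: 'ev_i) - f p = a * 'D_('ev_i) f (p + s *: 'ev_i).
Proof.
move=> df; pose g s := f (p + s *: 'ev_i).
have dg s : Num.min 0 a <= s <= Num.max 0 a ->
    is_derive s 1 g ('D_('ev_i) f (p + s *: 'ev_i)).
  move=> /df fs.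
  have E : (fun h : R => f (h *: 'ev_i + (p + s *: 'ev_i))) =
           (fun h => g (h *: 1 + s)).
    apply/funext => h; rewrite /g; congr f.
    by rewrite scalerDl addrCA [h *: 1]mulr1.
  split; first by apply/derivable1P; rewrite -E; exact: ((derivable1P _ _ _).1 fs).
  by rewrite derive1P -E -derive1P.
have cg s : Num.min 0 a <= s <= Num.max 0 a -> {for s, continuous g}.
  move=> /dg[ds _]; apply: differentiable_continuous.
  exact/derivable1_diffP.
have [a0|a0] := leP 0 a.
  have [||s] := @MVT_segment _ g (fun s => 'D_('ev_i) f (p + s *: 'ev_i)) 0 a a0.
  - move=> s; rewrite in_itv /= => /andP[s0 sa]; apply: dg.
    by rewrite min_l // max_r // !ltW.
  - apply: continuous_in_subspaceT => s; rewrite inE /= in_itv /= => H.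
    by apply: cg; rewrite min_l // max_r.
  rewrite in_itv /= => H E; exists s; first by rewrite ?min_l ?max_r.
  by move: E; rewrite /g scale0r addr0 subr0 mulrC.
have [||s] := @MVT_segment _ g (fun s => 'D_('ev_i) f (p + s *: 'ev_i)) a 0 (ltW a0).
- move=> s; rewrite in_itv /= => /andP[s0 sa]; apply: dg.
  by rewrite (min_r (ltW a0)) (max_l (ltW a0)) (ltW s0) (ltW sa).
- apply: continuous_in_subspaceT => s; rewrite inE /= in_itv /= => H.
  by apply: cg; rewrite (min_r (ltW a0)) (max_l (ltW a0)).
rewrite in_itv /= => H E; exists s; first by [].
move: E; rewrite /g scale0r addr0 sub0r mulrN mulrC => E.
by apply: oppr_inj; rewrite opprB.
Qed.

(** The box with opposite corners [y] and [z], whatever the order of their coordinates. *)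
Definition between n (y z x : 'rV[R]_n) :=
  forall j, Num.min (y 0 j) (z 0 j) <= x 0 j <= Num.max (y 0 j) (z 0 j).

Lemma mean_value n (f : 'rV[R]_n -> R) (y z : 'rV[R]_n) :
  (forall x, between y z x -> forall i, derivable f x 'ev_i) ->
  exists2 xi : 'I_n -> 'rV[R]_n, forall i, between y z (xi i) &
    f y - f z = \sum_i (y 0 i - z 0 i) * 'D_('ev_i) f (xi i).
Proof.
(* [w k] has the first [k] coordinates of [y] and the others of [z]: a path from [z] to [y] along
   the axes. [MVT_dir] is applied to each edge, and the increments telescope. *)
move=> df; pose w k : 'rV[R]_n := \row_i (if (i < k)%N then y 0 i else z 0 i).
have w0 : w 0%N = z by apply/rowP => i; rewrite mxE.
have wn : w n = y by apply/rowP => i; rewrite mxE ltn_ord.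
have wS (i : 'I_n) : w i.+1 = w i + (y 0 i - z 0 i) *: 'ev_i.
  apply/rowP => j; rewrite !mxE eqxx /= ltnS leq_eqVlt.
  have [->|ji] := eqVneq j i; first by rewrite eqxx ltnn /= mulr1 subrKC.
  by rewrite mulr0 addr0 -(inj_eq val_inj) in ji *; rewrite (negPf ji).
have bt (i : 'I_n) s : Num.min 0 (y 0 i - z 0 i) <= s <= Num.max 0 (y 0 i - z 0 i) ->
    between y z (w i + s *: 'ev_i).
  move=> sb j; rewrite !mxE eqxx /=.
  have [->|ji] := eqVneq j i.
    rewrite ltnn /= mulr1; move: sb; rewrite /Num.min /Num.max.
    by do 4?case: ltP => ?; move=> /andP[? ?]; apply/andP; split; lra.
  rewrite mulr0 addr0; case: ifP => _; rewrite ?ge_min ?le_max ?lexx ?orbT //.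
have /choice[xi xiP] : forall i : 'I_n, exists x, between y z x /\
    f (w i.+1) - f (w i) = (y 0 i - z 0 i) * 'D_('ev_i) f x.
  move=> i; have [s sb E] := @MVT_dir _ f (w i) i (y 0 i - z 0 i)
    (fun s sb => df _ (bt i s sb) i).
  by exists (w i + s *: 'ev_i); split; [exact: bt|rewrite wS].
exists xi; first by move=> i; have [] := xiP i.
under eq_bigr do rewrite -(xiP _).2.
rewrite -{1}wn -{1}w0 -(big_mkord xpredT (fun i => f (w i.+1) - f (w i))).
by rewrite telescope_sumr.
Qed.

Lemma rV_norm_coord n (x : 'rV[R]_n) j : `|x 0 j| <= `|x|.
Proof.
by rewrite [leRHS]/Num.Def.normr/= mx_normrE; exact: (le_bigmax _ _ (ord0, j)).
Qed.

Lemma rV_norm_le n (x : 'rV[R]_n) e : 0 <= e ->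
  (forall j, `|x 0 j| <= e) -> `|x| <= e.
Proof.
move=> e0 H; rewrite [leLHS]/Num.Def.normr/= mx_normrE bigmax_le // => -[i j] _.
by rewrite (ord1 i) /=.
Qed.

Lemma between_norm n (y z x : 'rV[R]_n) : between y z x -> `|x - z| <= `|y - z|.
Proof.
move=> b; apply: rV_norm_le => // j; apply: le_trans (rV_norm_coord _ j).
rewrite !mxE; have := b j; rewrite /Num.min /Num.max.
by case: ltP => h /andP[h1 h2]; rewrite ler_norml; case: (ger0P (y 0 j - z 0 j)) => ?;
  apply/andP; split; lra.
Qed.

(** By [mean_value], the error of the linear approximation is a sum of coordinate increments times
    variations of the partial derivatives, which are small by continuity. *)
Lemma C1_differentiable n (f : 'rV[R]_n -> R) x :
  (forall i, \forall y \near x, derivable f y 'ev_i) ->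
  (forall i, {for x, continuous (fun y => 'D_('ev_i) f y)}) ->
  differentiable f x.
Proof.
move=> df cf.
pose d (w : 'rV[R]_n) := \sum_i w 0 i * 'D_('ev_i) f x.
have lin_d : linear d.
  move=> a u v; rewrite /d scaler_sumr -big_split /=; apply: eq_bigr => i _.
  by rewrite !mxE mulrDl -mulrA.
pose dM := GRing.isLinear.Build _ _ _ _ _ lin_d.
pose dL : {linear _ -> _} := HB.pack d dM.
have dc : continuous dL.
  move=> y; rewrite /= /d.
  apply: (@cvg_sum_ord _ (nbhs y)) => i.
  by apply: cvgMr_tmp; apply: coord_continuous.
have E : f \o shift x = cst (f x) + dL +o_ 0 id.
  apply/eqaddoP => _/posnumP[e].
  (* The error has [n] terms, each at most [e' * |h|]; dividing by [n + 1] also covers [n = 0]. *)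
  pose e' := e%:num / n.+1%:R.
  have e'0 : 0 < e' by rewrite divr_gt0.
  have H : \forall y \near x, forall i, derivable f y 'ev_i /\
      `|'D_('ev_i) f y - 'D_('ev_i) f x| <= e'.
    apply: (@filter_forall _ _ (fun i y => derivable f y 'ev_i /\
      `|'D_('ev_i) f y - 'D_('ev_i) f x| <= e') (nbhs x)) => i; near=> y; split; near: y.
      exact: df.
    have /cvgrPdist_le/(_ _ e'0) := cf i.
    by apply: filterS => y; rewrite distrC.
  have [r /= r0 rH] := (nbhs_ballP _ _).1 H.
  apply/nbhs_ballP; exists r => // h; rewrite -ball_normE /= sub0r normrN => hr.
  have inb y : between (h + x) x y -> forall i, derivable f y 'ev_i /\
      `|'D_('ev_i) f y - 'D_('ev_i) f x| <= e'.
    move=> /between_norm b; apply: rH; rewrite -ball_normE /= distrC.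
    by apply: le_lt_trans b _; rewrite addrK.
  have [|xi xib Ef] := @mean_value _ f (h + x) x.
    by move=> y /inb + i => /(_ i)[].
  rewrite -[X in `|X|]/(f (h + x) - (f x + d h)) opprD addrA Ef /d -sumrB.
  apply: le_trans (ler_norm_sum _ _ _) _.
  apply: (@le_trans _ _ (\sum_(i < n) e' * `|h|)); last first.
    rewrite sumr_const card_ord -[leLHS]mulr_natl mulrA ler_wpM2r //.
    rewrite /e' mulrC -mulrA ger_pMr // mulrC ler_pdivrMr ?mul1r ?ler_nat //.
  apply: ler_sum => i _; rewrite !mxE addrK -mulrBr normrM mulrC.
  by apply: ler_pM => //; [have [] := inb _ (xib i) i|exact: rV_norm_coord].
have Ed := diff_unique dc E.
apply/diff_locallyP; split; first by rewrite Ed.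
by rewrite Ed.
Unshelve. all: by end_near. Qed.

End Calculus.

(** * Functions of class C^k on open sets *)

Section Ck.
Context {R : realType}.

Lemma open_near (T : topologicalType) (U : set T) x :
  open U -> U x -> \forall y \near x, U y.
Proof. by move=> oU Ux; apply: open_nbhs_nbhs. Qed.

Section onU.
Context {n : nat}.
Implicit Types (U V : set 'rV[R]_n) (f g : 'rV[R]_n -> R).

Lemma Ck_continuous k U f x : Ck k U f -> U x -> {for x, continuous f}.
Proof. by case: k => [|k] [cf _]; apply: cf. Qed.

Lemma Ck_sub k U V f : V `<=` U -> Ck k U f -> Ck k V f.
Proof.
move=> VU; elim: k f => [|k IH] f [cf df]; split => //.
- by move=> x /VU; apply: cf.
- by move=> x /VU; apply: cf.
- by move=> i; have [d c] := df i; split; [move=> x /VU; apply: d|apply: IH].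
Qed.

Lemma CkW k U f : Ck k.+1 U f -> Ck k U f.
Proof.
elim: k f => [|k IH] f [cf df]; split => // i.
by have [d c] := df i; split => //; apply: IH.
Qed.

(** As [U] is open, equality on [U] is equality near each of its points and passes to the
    derivatives. *)
Lemma Ck_eq k U f g : open U -> (forall x, U x -> f x = g x) ->
  Ck k U f -> Ck k U g.
Proof.
move=> oU; elim: k f g => [|k IH] f g fg [cf df].
all: have nfg x : U x -> \forall y \near x, f y = g y
  by move=> Ux; apply: filterS fg (open_near oU Ux).
all: have cg x : U x -> {for x, continuous g} by
  move=> Ux; rewrite /prop_for /continuous_at -fg //;
  apply: cvg_trans (cf x Ux); apply: near_eq_cvg (nfg x Ux).
  by split.
split => // i; have [d c] := df i; split.
  by move=> x Ux; apply: near_eq_derivable (nfg x Ux) (d x Ux).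
by apply: IH c => x Ux; apply: near_eq_derive; apply: nfg.
Qed.

Lemma Ck_local k U f :
  (forall x, U x -> exists V, [/\ open V, V x & Ck k V f]) -> Ck k U f.
Proof.
elim: k f => [|k IH] f H.
  split => // x /H[V [oV Vx fV]]; exact: Ck_continuous fV Vx.
split; first by move=> x /H[V [oV Vx fV]]; exact: Ck_continuous fV Vx.
move=> i; split.
  by move=> x /H[V [oV Vx [_ /(_ i)[d _]]]]; apply: d.
by apply: IH => x /H[V [oV Vx [_ /(_ i)[_ c]]]]; exists V.
Qed.

Lemma Ck_cst k U (a : R) : Ck k U (fun=> a).
Proof.
elim: k a => [|k IH] a; split => //=.
- by move=> x _; exact: (@cst_continuous _ _ a x).
- by move=> x _; exact: (@cst_continuous _ _ a x).
- move=> i; split => [x _|]; first exact: derivable_cst.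
  have -> : (fun x : 'rV[R]_n => 'D_('ev_i) (fun _ : 'rV[R]_n => a) x) = (fun=> 0).
    by apply/funext => x; exact: derive_cst.
  exact: IH.
Qed.

Lemma is_derive_coord (m : nat) (x v : 'rV[R]_m) j :
  is_derive x v (fun y : 'rV[R]_m => y 0 j) (v 0 j).
Proof.
have /= d : differentiable (fun y : 'rV[R]_m => y 0 j) x.
  exact: differentiable_coord.
split; first exact: diff_derivable.
have := @derive_mx R _ 1 m id x v (@derivable_id _ _ x v).
by rewrite derive_id => /rowP/(_ j); rewrite !mxE.
Qed.

Lemma Ck_coord k U j : Ck k U (fun y => y 0 j).
Proof.
have c x : {for x, continuous (fun y : 'rV[R]_n => y 0 j)}.
  exact: coord_continuous.
case: k => [|k]; split => // i; split => [x _|].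
  by have [] := is_derive_coord x 'ev_i j.
have -> : (fun x : 'rV[R]_n => 'D_('ev_i) (fun y : 'rV[R]_n => y 0 j) x) = (fun=> 'ev_i 0 j).
  by apply/funext => x; have [_ ->] := is_derive_coord x 'ev_i j.
exact: Ck_cst.
Qed.

Lemma CkD k U f g : open U -> Ck k U f -> Ck k U g ->
  Ck k U (fun x => f x + g x).
Proof.
move=> oU; elim: k f g => [|k IH] f g [cf df] [cg dg].
  split => // x Ux; exact: (continuousD (cf x Ux) (cg x Ux)).
split; first by move=> x Ux; exact: (continuousD (cf x Ux) (cg x Ux)).
move=> i; have [df1 df2] := df i; have [dg1 dg2] := dg i; split.
  by move=> x Ux; apply: derivableD; auto.
apply: Ck_eq oU _ (IH _ _ df2 dg2) => x Ux.
by rewrite -deriveD; auto.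
Qed.

Lemma CkM k U f g : open U -> Ck k U f -> Ck k U g ->
  Ck k U (fun x => f x * g x).
Proof.
move=> oU; elim: k f g => [|k IH] f g cf cg.
  split => // x Ux; exact: (continuousM (Ck_continuous cf Ux) (Ck_continuous cg Ux)).
split; first by move=> x Ux; exact: (continuousM (Ck_continuous cf Ux) (Ck_continuous cg Ux)).
have [_ df] := cf; have [_ dg] := cg.
move=> i; have [df1 df2] := df i; have [dg1 dg2] := dg i; split.
  by move=> x Ux; apply: derivableM; auto.
apply: Ck_eq oU _ (CkD oU (IH _ _ (CkW cf) dg2) (IH _ _ (CkW cg) df2)) => x Ux.
by rewrite -[in RHS]/(f * g) deriveM; auto.
Qed.

Lemma Ck_sum k U (I : Type) (r : seq I) (F : I -> 'rV[R]_n -> R) : open U ->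
  (forall i, Ck k U (F i)) -> Ck k U (fun x => \sum_(i <- r) F i x).
Proof.
move=> oU H; elim: r => [|i r IH].
  by rewrite (_ : (fun x => _) = fun=> 0); [exact: Ck_cst|];
    apply/funext => x; rewrite big_nil.
by apply: Ck_eq oU _ (CkD oU (H i) IH) => x _; rewrite big_cons.
Qed.

Lemma Ck_prod k U (I : Type) (r : seq I) (F : I -> 'rV[R]_n -> R) : open U ->
  (forall i, Ck k U (F i)) -> Ck k U (fun x => \prod_(i <- r) F i x).
Proof.
move=> oU H; elim: r => [|i r IH].
  by rewrite (_ : (fun x => _) = fun=> 1); [exact: Ck_cst|];
    apply/funext => x; rewrite big_nil.
by apply: Ck_eq oU _ (CkM oU (H i) IH) => x _; rewrite big_cons.
Qed.

Lemma CkV k U f : open U -> (forall x, U x -> f x != 0) -> Ck k U f ->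
  Ck k U (fun x => (f x)^-1).
Proof.
move=> oU f0; elim: k => [|k IH] cf.
  split => // x Ux; exact: (continuousV (f0 _ Ux) (Ck_continuous cf Ux)).
split; first by move=> x Ux; exact: (continuousV (f0 _ Ux) (Ck_continuous cf Ux)).
have [_ df] := cf; have cV := IH (CkW cf).
move=> i; have [df1 df2] := df i; split.
  by move=> x Ux; apply: derivableV; auto.
apply: Ck_eq oU _ (CkM oU (CkM oU (Ck_cst k U (-1)) (CkM oU cV cV)) df2) => x Ux.
rewrite deriveV; auto.
by rewrite mulN1r -expr2 exprVn.
Qed.

End onU.

Lemma Ck_derivable n k (U : set 'rV[R]_n) f x i : Ck k.+1 U f -> U x ->
  derivable f x 'ev_i.
Proof. by move=> [_ /(_ i)[d _]]; apply: d. Qed.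

Lemma Ck_differentiable n k (U : set 'rV[R]_n) f x : open U -> Ck k.+1 U f ->
  U x -> differentiable f x.
Proof.
move=> oU cf Ux; apply: C1_differentiable => i; have [_ /(_ i)[d c]] := cf.
  by apply: filterS d (open_near oU Ux).
exact: Ck_continuous c Ux.
Qed.

Lemma rV_continuous (T : topologicalType) m (g : T -> 'rV[R]_m) x :
  (forall j, {for x, continuous (fun y => g y 0 j)}) -> {for x, continuous g}.
Proof.
move=> H; apply/cvgrPdist_le => e e0.
have : \forall y \near x, forall j, `|g x 0 j - g y 0 j| <= e.
  apply: (@filter_forall _ _ (fun j y => `|g x 0 j - g y 0 j| <= e) (nbhs x)) => j.
  by have /cvgrPdist_le := H j; apply.
apply: filterS => y h; apply: rV_norm_le; first exact: ltW.
by move=> j; rewrite !mxE.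
Qed.

Lemma Ck_comp n m k (U : set 'rV[R]_n) (V : set 'rV[R]_m)
    (g : 'rV[R]_n -> 'rV[R]_m) (f : 'rV[R]_m -> R) : open U -> open V ->
  (forall j, Ck k U (fun x => g x 0 j)) -> (forall x, U x -> V (g x)) ->
  Ck k V f -> Ck k U (f \o g).
Proof.
move=> oU oV; elim: k f => [|k IH] f cg gUV cf.
all: have c x : U x -> {for x, continuous (f \o g)} by
  move=> Ux; apply: continuous_comp (Ck_continuous cf (gUV _ Ux));
  apply: rV_continuous => j; exact: Ck_continuous (cg j) Ux.
  by split.
split => // i.
have D x : U x -> is_derive x 'ev_i (f \o g)
    (\sum_j 'D_('ev_j) f (g x) * 'D_('ev_i) (fun x => g x 0 j) x).
  move=> Ux; apply: is_derive_chain; first by move=> j; exact: Ck_derivable (cg j) Ux.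
  exact: Ck_differentiable oV cf (gUV _ Ux).
split; first by move=> x /D[].
have H : Ck k U (fun x => \sum_j 'D_('ev_j) f (g x) * 'D_('ev_i) (fun x => g x 0 j) x).
  apply: Ck_sum => // j; apply: CkM => //.
    apply: (IH ('D_('ev_j) f)) => //; first by move=> j'; exact: CkW.
    by have [_ /(_ j)[_]] := cf.
  by have [_ /(_ i)[_]] := cg j.
by apply: Ck_eq oU _ H => x /D[_ ->].
Qed.

End Ck.

(** * Flat functions and bump functions *)

Section Bump.
Context {R : realType}.

Lemma is_derive_comp1 (V : normedModType R) (f : V -> R) (h : R -> R) x v :
  derivable f x v -> derivable h (f x) 1 ->
  is_derive x v (h \o f) ('D_1 h (f x) * 'D_v f x).
Proof.
move=> df dh.
have [c dc] : {c : R -> R | c = fun s => f (s *: v + x)} by eexists.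
have c0 : c 0 = f x by rewrite dc scale0r add0r.
have dc0 : derivable c 0 1 by rewrite dc; exact: ((derivable1P _ _ _).1 df).
have dh0 : derivable h (c 0) 1 by rewrite c0.
have E : h \o c = fun s => (h \o f) (s *: v + x) by rewrite dc.
have /derivable1_diffP dcc := dc0; have /derivable1_diffP dhc := dh0.
split.
  by apply/derivable1P; rewrite -E; apply/derivable1_diffP/differentiable_comp.
rewrite (derive1P (h \o f)) -E -derive1E (derive1_comp dc0 dh0) !derive1E c0.
by congr (_ * _); rewrite dc; apply/esym/derive1P.
Qed.

(* Up to linear combinations, the family [flat j] is stable under derivation. *)
Definition flat j (t : R) : R :=
  if 0 < t then t^-1 ^+ j * expR (- t^-1) else 0.

Lemma flat_ge0 j t : 0 <= flat j t.
Proof.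
by rewrite /flat; case: ifP => // t0; rewrite mulr_ge0 ?expR_ge0 ?exprn_ge0 ?invr_ge0 ?ltW.
Qed.

Lemma flat_gt0 j t : 0 < t -> 0 < flat j t.
Proof. by move=> t0; rewrite /flat t0 mulr_gt0 ?expR_gt0 ?exprn_gt0 ?invr_gt0. Qed.

Lemma flat_eq0 j t : t <= 0 -> flat j t = 0.
Proof. by rewrite /flat; case: ltP. Qed.

(** The exponential at [t^-1] dominates the term of degree [j + 2] of its series. The bound is
    quadratic so that the difference quotient of [flat j] at 0 tends to 0. *)
Lemma flat_le j t : flat j t <= (j.+2)`!%:R * t ^+ 2.
Proof.
rewrite /flat; case: ifP => t0; last by rewrite mulr_ge0 ?sqr_ge0.
have u0 : 0 < t^-1 by rewrite invr_gt0.
have := @expR_ge1Dxn R t^-1 j.+1 (ltW u0); set c := _`!%:R => H0.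
have {H0}H : t^-1 ^+ j.+2 / c <= expR t^-1 by apply: le_trans H0; rewrite lerDr.
have c0 : 0 < c by rewrite /c ltr0n fact_gt0.
rewrite expRN ler_pdivrMr ?expR_gt0 // -mulrA.
rewrite -ler_pdivrMl //; apply: le_trans (ler_wpM2l _ H).
  rewrite le_eqVlt; apply/orP; left; apply/eqP.
  by rewrite (exprSr t^-1 j.+1) (exprSr t^-1 j); field; rewrite (gt_eqF t0) (gt_eqF c0).
exact: sqr_ge0.
Qed.

Lemma is_derive_flat j (t : R) :
  is_derive t (1 : R) (flat j) (- j%:R * flat j.+1 t + flat j.+2 t).
Proof.
have [t0|t0|->] := ltgtP t 0.
- rewrite !flat_eq0 ?ltW // mulr0 addr0.
  apply: near_eq_is_derive (is_derive_cst 0 t 1); near=> s.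
  by rewrite flat_eq0 //; apply: ltW; near: s; exact: (open_near (@open_lt R 0) t0).
- have E : \forall s \near t, s^-1 ^+ j * expR (- s^-1) = flat j s.
    near=> s; rewrite /flat ifT //; near: s; exact: (open_near (@open_gt R 0) t0).
  apply: near_eq_is_derive E _.
  have tn0 : t != 0 by rewrite gt_eqF.
  have dV : is_derive t 1 (fun s : R => s^-1) (- t^-1 ^+ 2).
    split; first by apply: derivableV.
    by rewrite deriveV // derive_id [LHS]mulr1 exprVn.
  have dX : is_derive t 1 (fun s : R => s^-1 ^+ j) (t^-1 ^+ j.-1 *+ j * - t^-1 ^+ 2).
    have [d1 d2] := dV; have de := @exprn_derivable R j (t^-1) 1.
    apply: is_derive_eq (is_derive_comp1 d1 de) _.
    by rewrite exp_derive d2 /GRing.scale /= mulr1 mulr_natl.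
  have dN : is_derive t 1 (fun s : R => - s^-1) (t^-1 ^+ 2).
    by apply: is_derive_eq (is_deriveN dV) _; rewrite opprK.
  have dE : is_derive t 1 (fun s : R => expR (- s^-1)) (expR (- t^-1) * t^-1 ^+ 2).
    by apply: is_derive_eq (is_derive1_comp _ dN) _.
  apply: is_derive_eq (is_deriveM dX dE) _.
  rewrite /flat t0 /GRing.scale /=.
  case: j {dX} => [|j]; first by rewrite !expr0; ring.
  by rewrite /= !exprS -mulr_natl; ring.
- rewrite !flat_eq0 // mulr0 addr0.
  pose C : R := (j.+2)`!%:R.
  have C0 : 0 < C by rewrite ltr0n fact_gt0.
  have H : h^-1 *: ((flat j \o shift 0) (h *: (1 : R)) - flat j 0) @[h --> 0^'] --> (0 : R).
    apply/cvgrPdist_le => e e0; near=> h.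
    have h0 : h != 0 by near: h; exact: nbhs_dnbhs_neq.
    rewrite /= sub0r normrN addr0 [_%:A]mulr1 (@flat_eq0 j 0) // subr0.
    rewrite /GRing.scale /= normrM normfV (ger0_norm (flat_ge0 _ _)).
    rewrite mulrC ler_pdivrMr ?normr_gt0 //.
    apply: le_trans (flat_le _ _) _; rewrite -/C -real_normK ?num_real //.
    rewrite expr2 mulrA ler_wpM2r // -ler_pdivlMl // mulrC.
    near: h; apply: dnbhs0_le; by rewrite divr_gt0.
  split; first by apply/cvg_ex; exists 0.
  exact/cvg_lim.
Unshelve. all: by end_near. Qed.

Lemma continuous_flat j : continuous (flat j).
Proof.
move=> t; have [d _] := is_derive_flat j t.
by apply: differentiable_continuous; apply/derivable1_diffP.
Qed.

Lemma Ck_flat n k j (U : set 'rV[R]_n) f : open U -> Ck k U f ->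
  Ck k U (fun x => flat j (f x)).
Proof.
move=> oU; elim: k j => [|k IH] j cf.
all: have c x : U x -> {for x, continuous (fun x => flat j (f x))} by
  move=> Ux; apply: continuous_comp (Ck_continuous cf Ux) (@continuous_flat _ _).
  by split.
split => // i; have D x : U x -> is_derive x 'ev_i (fun x => flat j (f x))
    ((- j%:R * flat j.+1 (f x) + flat j.+2 (f x)) * 'D_('ev_i) f x).
  move=> Ux; have [d E] := is_derive_flat j (f x).
  by rewrite -E; exact: (is_derive_comp1 (Ck_derivable cf Ux) d).
split; first by move=> x /D[].
apply: (Ck_eq oU (fun x Ux => esym (@derive_val _ _ _ _ _ _ _ (D x Ux)))).
have [_ /(_ i)[_ cD]] := cf; have cf' := CkW cf.
exact: (CkM oU (CkD oU (CkM oU (Ck_cst k U _) (IH _ cf')) (IH _ cf')) cD).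
Qed.

(** The norm is the maximum of the coordinates, so a product of one-variable bumps works. [num j]
    vanishes at distance at least [2 * r] in the coordinate [j], [den j] at distance at most [r];
    they never vanish together, which keeps the quotient smooth. *)
Lemma bump_rV n (a : 'rV[R]_n) r : 0 < r -> exists b : 'rV[R]_n -> R,
  [/\ Cinfty setT b, forall y, `|y - a| <= r -> b y = 1 &
      forall y, 2 * r <= `|y - a| -> b y = 0].
Proof.
move=> r0.
pose num j (y : 'rV[R]_n) := flat 0 (4 * r ^+ 2 - (y 0 j - a 0 j) ^+ 2).
pose den j (y : 'rV[R]_n) := flat 0 ((y 0 j - a 0 j) ^+ 2 - r ^+ 2).
have den0 j y : num j y + den j y != 0.
  rewrite gt_eqF // /num /den; set s := (_ - _) ^+ 2.
  have [sr|sr] := ltP s (4 * r ^+ 2).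
    by rewrite ltr_pwDl ?flat_ge0 // flat_gt0 // subr_gt0.
  rewrite ltr_wpDl ?flat_ge0 // flat_gt0 // subr_gt0.
  by apply: lt_le_trans sr; rewrite ltr_pMl ?exprn_gt0 // ltr1n.
exists (fun y => \prod_j (num j y / (num j y + den j y))); split.
- move=> k; apply: Ck_prod => [|j]; first exact: openT.
  have cs : Ck k setT (fun y : 'rV[R]_n => (y 0 j - a 0 j) ^+ 2).
    have c1 := CkD openT (Ck_coord k setT j) (Ck_cst k setT (- a 0 j)).
    exact: (CkM openT c1 c1).
  have cn : Ck k setT (num j).
    apply: Ck_flat; first exact: openT.
    apply: (CkD openT (Ck_cst k setT _)).
    under eq_fun do rewrite -mulN1r.
    exact: (CkM openT (Ck_cst k setT _) cs).
  have cd : Ck k setT (den j).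
    apply: Ck_flat; first exact: openT.
    exact: (CkD openT cs (Ck_cst k setT _)).
  apply: (CkM openT cn); apply: CkV => //; first exact: openT.
  exact: (CkD openT cn cd).
- move=> y ya; apply: big1 => j _.
  have : `|y 0 j - a 0 j| <= r.
    by apply: le_trans ya; have := rV_norm_coord (y - a) j; rewrite !mxE.
  rewrite -ler_sqr ?nnegrE ?(ltW r0) // real_normK ?num_real // => H.
  have d0 : den j y = 0 by rewrite /den flat_eq0 // subr_le0.
  by have := den0 j y; rewrite d0 addr0 => n0; rewrite divff.
- move=> y ya; apply/eqP; apply: contraLR (ya) => /prodf_neq0 H.
  rewrite -ltNge; have [->|/eqP n0] := eqVneq (y - a) 0; first by rewrite normr0 mulr_gt0.
  have H2 j : `|(y - a) 0 j| < 2 * r.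
    rewrite ltNge; apply/negP => h; have := H j isT.
    rewrite /num flat_eq0 ?mul0r ?eqxx // subr_le0.
    have -> : 4 * r ^+ 2 = (2 * r) ^+ 2 by ring.
    rewrite -[X in _ <= X]real_normK ?num_real //.
    rewrite ler_sqr ?nnegrE ?mulr_ge0 ?(ltW r0) //.
    by move: h; rewrite !mxE.
  rewrite [ltLHS]/Num.Def.normr/= mx_normrE; apply/bigmax_ltP; split.
    by rewrite mulr_gt0.
  by move=> [i j] _; rewrite (ord1 i).
Qed.

End Bump.

(** * Averages over [0, 1] and Hadamard's lemma *)

Section Average.
Context {R : realType}.
Implicit Types h : R -> R.

Lemma antiderivative (T : R) h : continuous h ->
  exists F : R -> R, forall t : R, `|t| < T -> is_derive t (1 : R) F (h t).
Proof.
move=> ch; exists (fun x => \int[lebesgue_measure]_(t in [set` `[- T, x]]) h t)%R.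
move=> t; rewrite ltr_norml => /andP[t1 t2].
have [] := @continuous_FTC1_closed R h (- T) t T t2 _ t1 (ch t).
  apply: continuous_compact_integrable; first exact: segment_compact.
  exact: continuous_subspaceT.
by move=> d E; split; [exact: d|rewrite -derive1E].
Qed.

Definition itv01 : set R := `[0, 1]%classic.

Lemma derive_bound (h : R -> R) (C : R) (a b : R) (F : R -> R) :
  (forall t : R, Num.min a b <= t <= Num.max a b -> is_derive t (1 : R) F (h t)) ->
  (forall t : R, Num.min a b <= t <= Num.max a b -> `|h t| <= C) ->
  `|F b - F a| <= C * `|b - a|.
Proof.
have H (u v : R) : u <= v ->
    (forall t : R, u <= t <= v -> is_derive t (1 : R) F (h t)) ->
    (forall t : R, u <= t <= v -> `|h t| <= C) -> `|F v - F u| <= C * `|v - u|.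
  move=> uv dF hC; have [||c cuv ->] := @MVT_segment R F h u v uv.
  - by move=> x; rewrite in_itv /= => /andP[? ?]; apply: dF; rewrite !ltW.
  - apply: continuous_in_subspaceT => s; rewrite inE /= in_itv /= => /dF[d _].
    by apply: differentiable_continuous; apply/derivable1_diffP.
  rewrite normrM ler_wpM2r //; apply: hC.
  by move: cuv; rewrite in_itv.
have [ab|ba] := leP a b; first exact: H.
by move=> dF hC; rewrite distrC (distrC b); apply: H => //; exact: ltW.
Qed.

(** The integral of [h] over [0, 1], through a chosen antiderivative, so that its properties follow
    from the mean value theorem. The range [|t| < 2] contains the closed interval in its interior;
    for continuous [h] an antiderivative exists there and the default of [xget] does not occur. *)
Definition avg h : R :=
  let F := xget h [set F | forall t : R, `|t| < 2 -> is_derive t (1 : R) F (h t)] in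
  F 1 - F 0.

Lemma avgE h (F : R -> R) : continuous h -> (forall t : R, itv01 t -> is_derive t (1 : R) F (h t)) ->
  avg h = F 1 - F 0.
Proof.
move=> ch dF; rewrite /avg; set S := [set _ | _].
have dG : S (xget h S).
  by apply: xgetPex; have [G dG] := @antiderivative 2 h ch; exists G.
move: (xget h S : R -> R) dG => G; rewrite /S /= => {S} dG.
have dGF (t : R) : 0 <= t <= 1 -> is_derive t (1 : R) (fun t => G t - F t) 0.
  move=> It; have It' : itv01 t by rewrite /itv01 /= in_itv.
  have d1 := dF _ It'.
  have d2 : is_derive t (1 : R) G (h t).
    by apply: dG; move: It => /andP[? ?]; rewrite ger0_norm //; lra.
  by apply: is_derive_eq (is_deriveB d2 d1) _; rewrite subrr.
have := @derive_bound (fun=> 0) 0 0 1; rewrite min_l // max_r //.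
move=> /(_ (fun t => G t - F t) dGF) H.
have /= {H} := H (fun t It => eq_ind_r (fun x => x <= 0) (lexx 0) (normr0 R)).
rewrite mul0r normr_le0 => /eqP E.
have H (a b c d : R) : a - c - (b - d) = 0 -> a - b = c - d by lra.
exact: H E.
Qed.

Lemma avg_bound h C : continuous h -> (forall t : R, itv01 t -> `|h t| <= C) ->
  `|avg h| <= C.
Proof.
move=> ch hC; have [F dF] := @antiderivative 2 h ch.
have dF' t : itv01 t -> is_derive t (1 : R) F (h t).
  rewrite /itv01 /= in_itv /= => /andP[? ?]; apply: dF.
  by rewrite ger0_norm //; lra.
rewrite (avgE ch dF'); have := @derive_bound h C 0 1 F.
rewrite min_l // max_r // subr0 normr1 mulr1.
have I t : 0 <= t <= 1 -> itv01 t by rewrite /itv01 /= in_itv.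
move=> H; exact: (H (fun t It => dF' t (I t It)) (fun t It => hC t (I t It))).
Qed.

Lemma avg_lin h1 h2 (a : R) : continuous h1 -> continuous h2 ->
  avg (fun t => a * h1 t + h2 t) = a * avg h1 + avg h2.
Proof.
move=> c1 c2; have [F1 d1] := @antiderivative 2 h1 c1.
have [F2 d2] := @antiderivative 2 h2 c2.
have I2 t : itv01 t -> `|t| < 2.
  rewrite /itv01 /= in_itv /= => /andP[? ?].
  by rewrite ger0_norm //; lra.
rewrite (avgE c1 (fun t It => d1 t (I2 t It))) (avgE c2 (fun t It => d2 t (I2 t It))).
have c12 : continuous (fun t => a * h1 t + h2 t).
  move=> t; apply: (@continuousD _ _ _ (fun t => a * h1 t)); last exact: c2.
  by apply: (@continuousM _ _ (cst a)); [exact: cst_continuous|exact: c1].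
have d12 (t : R) : itv01 t ->
    is_derive t (1 : R) (fun t => a * F1 t + F2 t) (a * h1 t + h2 t).
  move=> It; have [e1 e2] := (d1 t (I2 t It), d2 t (I2 t It)).
  exact: (is_deriveD (is_deriveZ a e1) e2).
by rewrite (avgE c12 d12); lra.
Qed.

End Average.

Section Hadamard.
Context {R : realType}.
Implicit Types h : R -> R.

Lemma continuous_mul (T : topologicalType) (f g : T -> R) :
  continuous f -> continuous g -> continuous (fun t => f t * g t).
Proof. by move=> cf cg t; exact: (continuousM (cf t) (cg t)). Qed.

Lemma continuous_add (T : topologicalType) (f g : T -> R) :
  continuous f -> continuous g -> continuous (fun t => f t + g t).
Proof. by move=> cf cg t; exact: (continuousD (cf t) (cg t)). Qed.

Lemma continuous_scale (T : topologicalType) (c : R) (g : T -> R) :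
  continuous g -> continuous (fun t => c * g t).
Proof. by move=> cg; apply: continuous_mul => //; exact: cst_continuous. Qed.

Lemma avg_cst (c : R) : avg (fun=> c) = c.
Proof.
have cc : continuous (fun _ : R => c) by move=> t; exact: cst_continuous.
have dc (t : R) : itv01 t -> is_derive t (1 : R) (fun t : R => c *: t) c.
  by move=> _; apply: is_derive_eq (is_deriveZ c (is_derive_id t 1)) _; exact: mulr1.
by rewrite (avgE cc dc) /GRing.scale /= mulr1 mulr0 subr0.
Qed.

Lemma avgZ h c : continuous h -> avg (fun t => c * h t) = c * avg h.
Proof.
move=> ch; have c0 : continuous (fun _ : R => 0 : R) by move=> t; exact: cst_continuous.
have := @avg_lin R h (fun=> 0) c ch c0; rewrite avg_cst addr0 => <-.
by congr avg; apply/funext => t; rewrite addr0.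
Qed.

Lemma avgD h1 h2 : continuous h1 -> continuous h2 ->
  avg (fun t => h1 t + h2 t) = avg h1 + avg h2.
Proof.
move=> c1 c2; have := @avg_lin R h1 h2 1 c1 c2; rewrite mul1r => <-.
by congr avg; apply/funext => t; rewrite mul1r.
Qed.

Lemma continuous_sum_ord n (h : 'I_n -> R -> R) :
  (forall i, continuous (h i)) -> continuous (fun t => \sum_i h i t).
Proof. by move=> ch t; apply: (@cvg_sum_ord _ _ (nbhs t)) => i; exact: ch. Qed.

Lemma avg_sum n (h : 'I_n -> R -> R) : (forall i, continuous (h i)) ->
  avg (fun t => \sum_i h i t) = \sum_i avg (h i).
Proof.
elim: n h => [|n IH] h ch.
  rewrite big_ord0 -[RHS](avg_cst 0); congr avg; apply/funext => t.
  by rewrite big_ord0.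
rewrite big_ord_recl -IH; last by move=> i; exact: ch.
rewrite -avgD; [|exact: ch|by apply: continuous_sum_ord => i; exact: ch].
by congr avg; apply/funext => t; rewrite big_ord_recl.
Qed.

Lemma avg_dist h1 h2 C : continuous h1 -> continuous h2 ->
  (forall t, itv01 t -> `|h1 t - h2 t| <= C) -> `|avg h1 - avg h2| <= C.
Proof.
move=> c1 c2 H.
have c2' : continuous (fun t => -1 * h2 t).
  by move=> t; apply: (@continuousM _ _ (cst (-1))); [exact: cst_continuous|exact: c2].
rewrite -[- avg h2]mulN1r -avgZ // -avgD //; apply: avg_bound.
  by move=> t; apply: (@continuousD _ _ _ h1); [exact: c1|exact: c2'].
by move=> t It; rewrite mulN1r; exact: H.
Qed.

Section rV.
Context {n : nat} (a : 'rV[R]_n).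
Implicit Types phi : 'rV[R]_n -> R.

Definition ray (t : R) (y : 'rV[R]_n) := a + t *: (y - a).

Lemma continuous_ray y : continuous (ray^~ y).
Proof.
by move=> t; apply: cvgD; [exact: cvg_cst|exact: scalel_continuous].
Qed.

(** Compactness of [0, 1] makes the continuity of [phi] uniform along the segment; this is what lets
    limits and difference quotients pass through [avg]. *)
Lemma uniform_on_ray phi y e : continuous phi -> 0 < e -> exists2 d, 0 < d &
  forall t, itv01 t -> forall z, `|z - ray t y| <= d ->
    `|phi z - phi (ray t y)| <= e.
Proof.
move=> cphi e0.
have K := (compact_near_coveringP _).1 (@segment_compact R 0 1).
have D : \forall d \near (0 : R)^'+, itv01 `<=` (fun t => forall z,
    `|z - ray t y| <= d -> `|phi z - phi (ray t y)| <= e).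
  apply: (K R (0 : R)^'+ (fun d t => forall z, `|z - ray t y| <= d ->
    `|phi z - phi (ray t y)| <= e)).
  move=> t0 _; have /cvgrPdist_le/(_ _ (divr_gt0 e0 (ltr0n _ 2))) := cphi (ray t0 y).
  move=> /nbhs_ballP[r /= r0 rP].
  have r2 : 0 < r / 2 by rewrite divr_gt0.
  have nt : \forall t \near t0, `|ray t0 y - ray t y| < r / 2.
    by have /cvgrPdist_lt/(_ _ r2) := @continuous_ray y t0; apply.
  near=> t d => z zd.
  have A : `|ray t0 y - ray t y| < r / 2 by near: t.
  have B : d < r / 2 by near: d; exact: nbhs_right_lt.
  have H1 : `|phi (ray t0 y) - phi z| <= e / 2.
    apply: rP; rewrite -ball_normE /= (splitr r).
    apply: le_lt_trans (ltrD A (le_lt_trans zd B)).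
    by rewrite (distrC z) -[X in `|X| <= _](subrKA (ray t y)) ler_normD.
  have H2 : `|phi (ray t0 y) - phi (ray t y)| <= e / 2.
    apply: rP; rewrite -ball_normE /=; apply: lt_trans A _.
    by rewrite ltr_pdivrMr // ltr_pMr // ltr1n.
  rewrite (splitr e); apply: le_trans (lerD H1 H2).
  by rewrite (distrC _ (phi z)) -[X in `|X| <= _](subrKA (phi (ray t0 y))) ler_normD.
have [d [dP d0]] := filter_ex (filterI D (@nbhs_right_gt R 0)).
by exists d.
Unshelve. all: by end_near. Qed.

(** Each derivative in [y] brings out a factor [t]; the powers of [t] make the family stable under
    differentiation. *)
Definition moment k phi y := avg (fun t => t ^+ k * phi (ray t y)).

Lemma continuous_moment_integrand k (phi : 'rV[R]_n -> R) (y : 'rV[R]_n) : continuous phi ->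
  continuous (fun t : R => t ^+ k * phi (ray t y)).
Proof.
move=> cphi; apply: continuous_mul; first exact: exprn_continuous.
move=> t; apply: (@continuous_comp _ _ _ (ray^~ y) phi); last exact: cphi.
exact: continuous_ray.
Qed.

Lemma itv01_expr (t : R) k : itv01 t -> `|t ^+ k| <= 1.
Proof.
rewrite /itv01 /= in_itv /= => /andP[t0 t1].
by rewrite ger0_norm ?exprn_ge0 // exprn_ile1.
Qed.

Lemma continuous_moment k phi : continuous phi -> continuous (moment k phi).
Proof.
move=> cphi y; apply/(@cvgrPdist_le _ _ _ (nbhs y)) => e e0.
have [d d0 dP] := @uniform_on_ray phi y e cphi e0.
have Nd : \forall z \near y, `|y - z| <= d.
  by apply/nbhs_ballP; exists d => // z; rewrite -ball_normE => /ltW.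
near=> z; have zd : `|y - z| <= d by near: z.
apply: avg_dist; [exact: continuous_moment_integrand..|].
move=> t It; rewrite -mulrBr normrM -[e]mul1r ler_pM ?itv01_expr // distrC.
apply: dP => //; rewrite /ray opprD addrACA subrr add0r -scalerBr opprB addrA subrK.
rewrite normrZ; have := itv01_expr 1 It; rewrite expr1 => t1.
by rewrite -[d]mul1r ler_pM // distrC.
Unshelve. all: by end_near. Qed.

(** Differentiation under the integral: by [MVT_dir] the difference quotient of the integrand is
    [t ^+ k.+1] times a value of the derivative at distance at most [|h|] from the ray, where
    [uniform_on_ray] applies. *)
Lemma is_derive_moment k phi y i : continuous phi ->
  (forall x, derivable phi x 'ev_i) -> continuous (fun x => 'D_('ev_i) phi x) ->
  is_derive y 'ev_i (moment k phi) (moment k.+1 (fun x => 'D_('ev_i) phi x) y).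
Proof.
move=> cphi dphi cD; set D := (X in continuous X) in cD *.
have H : h^-1 *: ((moment k phi \o shift y) (h *: 'ev_i) - moment k phi y) @[h --> 0^']
    --> moment k.+1 D y.
  apply/cvgrPdist_le => e e0.
  have [d d0 dP] := @uniform_on_ray D y e cD e0.
  near=> h.
  have h0 : h != 0 by near: h; exact: nbhs_dnbhs_neq.
  have hd : `|h| <= d by near: h; exact: dnbhs0_le.
  rewrite -[_ *: (_ - _)]/(_ * (_ - _)) /= mulrBr -mulNr -!avgZ; try exact: continuous_moment_integrand.
  have cc c z : continuous (fun t : R => c * (t ^+ k * phi (ray t z))).
    exact/continuous_scale/continuous_moment_integrand.
  rewrite -avgD //; apply: avg_dist.
  - exact: continuous_moment_integrand.
  - exact: continuous_add.
  move=> t It.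
  have -> : ray t (h *: 'ev_i + y) = ray t y + (t * h) *: 'ev_i.
    by rewrite /ray -addrA scalerDr scalerA addrCA addrC.
  have [s sb E] := @MVT_dir R n phi (ray t y) i (t * h) (fun s _ => dphi _).
  have -> : phi (ray t y + (t * h) *: 'ev_i) =
     phi (ray t y) + t * h * D (ray t y + s *: 'ev_i) by rewrite -E subrKC.
  have -> : h^-1 * (t ^+ k * (phi (ray t y) + t * h * D (ray t y + s *: 'ev_i))) +
     - h^-1 * (t ^+ k * phi (ray t y)) = t ^+ k.+1 * D (ray t y + s *: 'ev_i).
    by rewrite exprS; field.
  rewrite -mulrBr normrM -[e]mul1r ler_pM ?itv01_expr // distrC.
  apply: dP => //; rewrite addrC addKr; apply: le_trans hd.
  have /andP[t0 t1] : 0 <= t <= 1 by move: It; rewrite /itv01 /= in_itv.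
  have sh : `|s| <= `|h|.
    have : `|t * h| <= `|h| by rewrite normrM (ger0_norm t0) ler_piMl.
    apply: le_trans; move: sb; rewrite /Num.min /Num.max.
    by case: ltP => ?; move=> /andP[? ?]; rewrite ler_norml;
      case: (ger0P (t * h)) => ?; apply/andP; split; lra.
  apply: rV_norm_le => // j; rewrite !mxE normrM eqxx /=.
  by case: (j == i); rewrite ?normr1 ?mulr1 // normr0 mulr0.
split; first by apply/cvg_ex; exists (moment k.+1 D y).
exact/cvg_lim.
Unshelve. all: by end_near. Qed.

Lemma Ck_moment j k phi : Cinfty setT phi -> Ck j setT (moment k phi).
Proof.
elim: j k phi => [|j IH] k phi sphi.
all: have cphi : continuous phi by move=> x; exact: Ck_continuous (sphi 0%N) I.
  by split => // x _; exact: continuous_moment.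
split; first by move=> x _; exact: continuous_moment.
move=> i; have [_ /(_ i)[dphi _]] := sphi 1%N.
have sD : Cinfty setT (fun x => 'D_('ev_i) phi x).
  by move=> l; have [_ /(_ i)[_]] := sphi l.+1.
have cD : continuous (fun x => 'D_('ev_i) phi x).
  by move=> x; exact: Ck_continuous (sD 0%N) I.
have dm y := @is_derive_moment k phi y i cphi (fun x => dphi x I) cD.
split; first by move=> x _; have [] := dm x.
have -> : (fun x => 'D_('ev_i) (moment k phi) x) =
          moment k.+1 (fun x => 'D_('ev_i) phi x).
  by apply/funext => y; have [_ ->] := dm y.
exact: IH.
Qed.

(** The fundamental theorem of calculus for [F] on the segment from [a] to [y]: [G i] is the average
    of the i-th partial derivative there. Derivations require the smoothness of [G i], also at [a],
    which a mere quotient would not give. *)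
Lemma hadamard F : Cinfty setT F -> exists G : 'I_n -> 'rV[R]_n -> R,
  [/\ forall i, Cinfty setT (G i), forall i, G i a = 'D_('ev_i) F a &
      forall y, F y = F a + \sum_i (y 0 i - a 0 i) * G i y].
Proof.
move=> sF; exists (fun i => moment 0 (fun x => 'D_('ev_i) F x)).
have sD i : Cinfty setT (fun x => 'D_('ev_i) F x).
  by move=> l; have [_ /(_ i)[_]] := sF l.+1.
have cD i : continuous (fun x => 'D_('ev_i) F x).
  by move=> x; exact: Ck_continuous (sD i 0%N) I.
split.
- by move=> i j; exact: Ck_moment.
- move=> i; rewrite /moment -[RHS]avg_cst; congr avg; apply/funext => t.
  by rewrite expr0 mul1r /ray subrr scaler0 addr0.
move=> y; apply/eqP; rewrite addrC -subr_eq; apply/eqP.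
have cg i : continuous (fun t : R => t ^+ 0 * 'D_('ev_i) F (ray t y)).
  exact: (@continuous_moment_integrand 0 _ y (cD i)).
rewrite /moment; under eq_bigr do rewrite -(avgZ _ (cg _)).
rewrite -avg_sum; last first.
  by move=> i; exact: continuous_scale.
have ch : continuous (fun t : R => \sum_(i < n) (y 0 i - a 0 i) * (t ^+ 0 * 'D_('ev_i) F (ray t y))).
  by apply: continuous_sum_ord => i; exact: continuous_scale.
have dh (t : R) : itv01 t -> is_derive t (1 : R) (F \o ray^~ y)
    (\sum_(i < n) (y 0 i - a 0 i) * (t ^+ 0 * 'D_('ev_i) F (ray t y))).
  move=> _.
  have dr j : is_derive t (1 : R) (fun t => (ray t y) 0 j) (y 0 j - a 0 j).
    have -> : (fun t => (ray t y) 0 j) = (fun t : R => a 0 j + (y 0 j - a 0 j) *: t).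
      by apply/funext => u; rewrite !mxE /GRing.scale /= [RHS]addrC [LHS]addrC mulrC.
    have := is_deriveD (is_derive_cst (a 0 j) t 1)
      (is_deriveZ (y 0 j - a 0 j) (is_derive_id t 1)).
    by move=> H; apply: is_derive_eq H _; rewrite add0r; exact: mulr1.
  have dF : differentiable F (ray t y).
    exact: (Ck_differentiable openT (sF 1%N)).
  have := @is_derive_chain R _ n (ray^~ y) F t 1 (fun j => @ex_derive _ _ _ _ _ _ _ (dr j)) dF.
  move=> H; apply: is_derive_eq H _; apply: eq_bigr => i _.
  by rewrite expr0 mul1r mulrC (@derive_val _ _ _ _ _ _ _ (dr i)).
by rewrite (avgE ch dh) /= /ray scale1r scale0r addr0 subrKC.
Qed.

End rV.
End Hadamard.

Lemma rV_dist_coord (R : realType) n (y z : 'rV[R]_n) j :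
  `|y 0 j - z 0 j| <= `|y - z|.
Proof. by have := rV_norm_coord (y - z) j; rewrite !mxE. Qed.

(** * Ordinary differential equations *)

Section ODE.
Context {R : realType} {n : nat}.
Implicit Types (u v w : R -> 'rV[R]_n) (F : 'rV[R]_n -> 'rV[R]_n).

Definition has_velocity u (t : R) (x : 'rV[R]_n) :=
  forall j, is_derive t (1 : R) (fun s : R => u s 0 j) (x 0 j).

Lemma has_velocity_continuous u t x : has_velocity u t x -> {for t, continuous u}.
Proof.
move=> du; apply: rV_continuous => j; have [d _] := du j.
by apply: differentiable_continuous; apply/derivable1_diffP.
Qed.

Definition lipschitz_with L F := forall x y, `|F x - F y| <= L * `|x - y|.

Lemma lipschitz_with_continuous L F : lipschitz_with L F -> continuous F.
Proof.
move=> FL x; apply/(@cvgrPdist_le _ _ _ (nbhs x)) => e e0.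
have L1 : 0 < `|L| + 1 by rewrite ltr_wpDl.
apply/nbhs_ballP; exists (e / (`|L| + 1)); first by rewrite /= divr_gt0.
move=> y; rewrite -ball_normE /= ltr_pdivlMr // => /ltW H.
apply: le_trans (FL x y) _; apply: le_trans H; rewrite mulrC ler_wpM2l //.
by apply: le_trans (ler_norm _) _; rewrite lerDl.
Qed.

(** The one estimate behind the contraction in [picard], the uniqueness of solutions and the bound
    on the distance travelled. The condition on [s] treats times before and after [t0] alike. *)
Lemma velocity_dist u v (du dv : R -> 'rV[R]_n) t0 t C :
  u t0 = v t0 ->
  (forall s : R, `|s - t0| <= `|t - t0| -> has_velocity u s (du s)) ->
  (forall s : R, `|s - t0| <= `|t - t0| -> has_velocity v s (dv s)) ->
  (forall s : R, `|s - t0| <= `|t - t0| -> `|du s - dv s| <= C) ->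
  `|u t - v t| <= C * `|t - t0|.
Proof.
move=> E0 Hu Hv HC.
have C0 : 0 <= C by apply: le_trans (HC t0 _); rewrite // subrr normr0.
have bt (s : R) : Num.min t0 t <= s <= Num.max t0 t -> `|s - t0| <= `|t - t0|.
  rewrite /Num.min /Num.max; case: ltP => h /andP[h1 h2];
  by rewrite ler_norml; case: (ger0P (t - t0)) => ?; apply/andP; split; lra.
apply: rV_norm_le; first by rewrite mulr_ge0.
move=> j; rewrite !mxE.
have d (s : R) : Num.min t0 t <= s <= Num.max t0 t ->
    is_derive s (1 : R) (fun r : R => u r 0 j - v r 0 j) (du s 0 j - dv s 0 j).
  by move=> /bt st; exact: (is_deriveB (Hu s st j) (Hv s st j)).
have c (s : R) : Num.min t0 t <= s <= Num.max t0 t -> `|du s 0 j - dv s 0 j| <= C.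
  move=> /bt st; apply: le_trans (HC s st).
  by have := rV_norm_coord (du s - dv s) j; rewrite !mxE.
have := @derive_bound R _ C t0 t _ d c.
by rewrite E0 subrr subr0.
Qed.

Lemma exp2_small (c e : R) : 0 < e -> exists k, c / 2 ^+ k <= e.
Proof.
move=> e0; set k := (Num.truncn `|c / e|).+1; exists k.
have k2 : 0 < 2 ^+ k :> R by rewrite exprn_gt0.
rewrite ler_pdivrMr // mulrC -ler_pdivrMr //.
apply: le_trans (ler_norm _) _.
have /ltW := truncnS_gt `|c / e|; rewrite -/k => H.
by apply: le_trans H _; rewrite -natrX ler_nat ltnW // ltn_expl.
Qed.

Lemma le0_geometric (x c : R) : (forall k, x <= c / 2 ^+ k) -> x <= 0.
Proof.
move=> H; rewrite leNgt; apply/negP => x0.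
have x2 : 0 < x / 2 by rewrite divr_gt0.
have [k ck] := exp2_small c x2.
have := le_trans (H k) ck; rewrite leNgt ltr_pdivrMr // ltr_pMr // ltr1n //.
Qed.

Lemma geometric_limit (x : nat -> R) (C : R) :
  (forall k, `|x k.+1 - x k| <= C / 2 ^+ k) ->
  exists l, forall k, `|x k - l| <= 2 * C / 2 ^+ k.
Proof.
move=> H; pose d k : R := 2 * C / 2 ^+ k.
have dS k : d k = d k.+1 + C / 2 ^+ k.
  by rewrite /d exprS; field; rewrite expf_neq0.
have C0 k : 0 <= C / 2 ^+ k by apply: le_trans (H k).
have d0 k : 0 <= d k by rewrite /d -mulrA mulr_ge0.
have step k m : `|x (m + k)%N - x k| <= d k - d (m + k)%N.
  elim: m => [|m IH]; first by rewrite !add0n !subrr normr0.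
  rewrite addSn; have := H (m + k)%N; have := dS (m + k)%N.
  have := ler_normD (x (m + k).+1 - x (m + k)%N) (x (m + k)%N - x k).
  rewrite subrKA => *; lra.
have bnd k m : x k - d k <= x m + d m.
  have [km|mk] := leqP k m.
    have := step k (m - k)%N; rewrite subnK // ler_norml => /andP[? _].
    have := d0 m; lra.
  have := step m (k - m)%N; rewrite subnK 1?ltnW // ler_norml => /andP[_ ?].
  have := d0 k; lra.
exists (sup (range (fun k => x k - d k))) => k.
have ub : has_sup (range (fun k => x k - d k)).
  split; first by exists (x 0%N - d 0%N), 0%N.
  by exists (x 0%N + d 0%N) => _ [m _ <-].
rewrite -/(d k) ler_norml; apply/andP; split.
  rewrite lerBrDr addrC lerBlDr; apply: sup_le_ub; first by case: ub.
  by move=> _ [m _ <-]; exact: bnd.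
by rewrite lerBlDr addrC -lerBlDr; apply: sup_upper_bound => //; exists k.
Qed.

(** For [0 <= T], the retraction of the line onto [-T, T]. It extends to all times what is built on
    a segment, and to all points what is given on a box, without increasing distances. *)
Definition clamp (T t : R) : R := Num.max (- T) (Num.min T t).

Lemma continuous_clamp T : continuous (clamp T).
Proof.
move=> t; apply: (@continuous_comp _ _ _ (fun t => Num.min T t) (fun t => Num.max (- T) t)).
  by apply: (@continuous_min _ _ (cst T) id); [exact: cst_continuous|].
by apply: (@continuous_max _ _ (cst (- T)) id); [exact: cst_continuous|].
Qed.

Lemma clamp_le T t : 0 <= T -> `|clamp T t| <= T.
Proof.
move=> T0; rewrite /clamp /Num.max /Num.min ler_norml.
by case: (ltP T t) => ?; case: ltP => ?; apply/andP; split; lra.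
Qed.

Lemma clamp_id T t : `|t| <= T -> clamp T t = t.
Proof. by rewrite ler_norml => /andP[? ?]; rewrite /clamp min_r // max_r. Qed.

Lemma clamp_dist T s t : 0 <= T -> `|clamp T s - clamp T t| <= `|s - t|.
Proof.
move=> T0; have H (x y : R) : x <= y ->
    clamp T x <= clamp T y /\ clamp T y - clamp T x <= y - x.
  move=> xy; rewrite /clamp /Num.max /Num.min.
  by case: (ltP T x) => ?; case: (ltP T y) => ?;
    do ?[case: (ltP (- T) _) => ?]; split; lra.
have [st|/ltW ts] := leP s t.
  by have [h1 h2] := H _ _ st; rewrite distrC (distrC s) !ger0_norm // subr_ge0.
by have [h1 h2] := H _ _ ts; rewrite !ger0_norm // subr_ge0.
Qed.

Section picard.
Variables (F : 'rV[R]_n -> 'rV[R]_n) (L T : R) (y0 : 'rV[R]_n).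
Hypotheses (FL : lipschitz_with L F) (L0 : 0 < L) (T0 : 0 < T) (LT : L * T <= 1 / 2).

(** [v] is the integral of [F \o u] starting from [y0], frozen outside [-T, T]; the iterates are
    then continuous on the whole line and can be compared at all times. *)
Definition picard_step u v := exists G : R -> 'rV[R]_n,
  [/\ forall t, `|t| <= T -> has_velocity G t (F (u t)), G 0 = y0 &
      forall t, v t = G (clamp T t)].

Lemma picard_step_ex u : continuous u -> exists v, picard_step u v.
Proof.
move=> cu; have cF := lipschitz_with_continuous FL.
have /choice[G dG] : forall j, exists G : R -> R, forall t : R, `|t| < T + 1 ->
    is_derive t (1 : R) G (F (u t) 0 j).
  move=> j; apply: (@antiderivative R (T + 1) (fun t => F (u t) 0 j)) => t.
  apply: (@continuous_comp _ _ _ (F \o u) (fun x : 'rV[R]_n => x 0 j)).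
    by apply: continuous_comp; [exact: cu|exact: cF].
  exact: coord_continuous.
pose G' (t : R) : 'rV[R]_n := \row_j (G j t - G j 0 + y0 0 j).
exists (fun t => G' (clamp T t)), G'; split => //.
  move=> t tT j.
  have -> : (fun s : R => G' s 0 j) = (fun s : R => G j s - (G j 0 - y0 0 j)).
    by apply/funext => s; rewrite mxE opprB addrA addrAC.
  have tT1 : `|t| < T + 1 by apply: le_lt_trans tT _; rewrite ltrDl.
  have := is_deriveB (dG j t tT1) (is_derive_cst (G j 0 - y0 0 j) t 1).
  by rewrite subr0.
by apply/rowP => j; rewrite mxE subrr add0r.
Qed.

Lemma picard_step_continuous u v : picard_step u v -> continuous v.
Proof.
move=> [G [dG _ vE]] t.
rewrite (_ : v = G \o clamp T); last by apply/funext.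
apply: continuous_comp; first exact: continuous_clamp.
by apply: has_velocity_continuous (dG _ _); exact/clamp_le/ltW.
Qed.

(** Integration over a time at most [T] multiplies the distance by at most [L * T <= 1 / 2]. *)
Lemma picard_step_dist u v u' v' C : picard_step u v -> picard_step u' v' ->
  (forall t, `|u t - u' t| <= C) -> forall t, `|v t - v' t| <= C / 2.
Proof.
move=> [G [dG G0 vE]] [G' [dG' G'0 vE']] H t; rewrite vE vE'.
set s := clamp T t; have sT : `|s| <= T by exact/clamp_le/ltW.
have C0 : 0 <= C by apply: le_trans (H 0).
have := @velocity_dist G G' (fun t => F (u t)) (fun t => F (u' t)) 0 s (L * C).
rewrite G0 G'0 subr0 => /(_ erefl) D.
have {D} : `|G s - G' s| <= L * C * `|s|.
  apply: D => r; rewrite subr0 => rs.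
  - by apply: dG; apply: le_trans rs sT.
  - by apply: dG'; apply: le_trans rs sT.
  - by apply: le_trans (FL _ _) _; rewrite ler_pM2l.
move/le_trans; apply; apply: (@le_trans _ _ (L * C * T)).
  by rewrite ler_wpM2l // mulr_ge0 // ltW.
have := ler_wpM2r C0 LT; lra.
Qed.

Lemma picard : exists u, u 0 = y0 /\
  forall t, `|t| < T -> has_velocity u t (F (u t)).
Proof.
have /choice[Phi PhiP] : forall u, exists v, continuous u -> picard_step u v.
  move=> u; have [cu|ncu] := pselect (continuous u); last by exists u.
  by have [v uv] := picard_step_ex cu; exists v.
pose U k := iter k Phi (fun=> y0).
have cU k : continuous (U k).
  elim: k => [|k IH]; first by move=> t; exact: cst_continuous.
  exact: picard_step_continuous (PhiP _ IH).
have stepU k : picard_step (U k) (U k.+1) by apply: PhiP; exact: cU.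
pose C := `|F y0| * T.
have dU k t : `|U k.+1 t - U k t| <= C / 2 ^+ k.
  elim: k t => [|k IH] t; last first.
    have -> : C / 2 ^+ k.+1 = C / 2 ^+ k / 2 by rewrite exprS invfM mulrCA mulrC.
    exact: picard_step_dist (stepU k.+1) (stepU k) IH t.
  rewrite expr0 divr1; have [G [dG G0 ->]] := stepU 0%N.
  set s := clamp T t; have sT : `|s| <= T by exact/clamp_le/ltW.
  have := @velocity_dist G (fun=> y0) (fun t => F y0) (fun t => 0) 0 s `|F y0|.
  rewrite G0 subr0 => /(_ erefl) D.
  have {D} : `|G s - y0| <= `|F y0| * `|s|.
    apply: D => r; rewrite ?subr0 => rs //.
    - by apply: dG; apply: le_trans rs sT.
    - by move=> j; rewrite mxE; exact: is_derive_cst.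
  by move/le_trans; apply; rewrite ler_wpM2l.
have /choice[l lP] : forall tj : R * 'I_n, exists l, forall k,
    `|U k tj.1 0 tj.2 - l| <= 2 * C / 2 ^+ k.
  move=> [t j] /=; apply: geometric_limit => k; apply: le_trans (dU k t).
  by have := rV_norm_coord (U k.+1 t - U k t) j; rewrite !mxE.
pose u (t : R) : 'rV[R]_n := \row_j l (t, j).
have C0 : 0 <= C by rewrite mulr_ge0 // ltW.
have uU k t : `|U k t - u t| <= 2 * C / 2 ^+ k.
  apply: rV_norm_le; first by rewrite divr_ge0 ?exprn_ge0 // mulr_ge0.
  by move=> j; rewrite !mxE; exact: (lP (t, j) k).
have cu : continuous u.
  move=> t; apply/(@cvgrPdist_le _ _ _ (nbhs t)) => e e0.
  have e3 : 0 < e / 3 by rewrite divr_gt0.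
  have [k kP] := exp2_small (2 * C) e3.
  have /cvgrPdist_le/(_ _ e3) := cU k t; apply: filterS => s Hs.
  have H1 := le_trans (uU k t) kP; have H2 := le_trans (uU k s) kP.
  have -> : e = e / 3 + e / 3 + e / 3 by lra.
  have -> : u t - u s = (u t - U k t) + (U k t - U k s) + (U k s - u s).
    by rewrite subrKA subrKA.
  apply: le_trans (ler_normD _ _) _; apply: lerD => //.
  by apply: le_trans (ler_normD _ _) _; apply: lerD => //; rewrite distrC.
(* Both sides are within a multiple of [1 / 2 ^+ k] of the iterate [U k.+1]. *)
have uE : Phi u = u.
  apply/funext => t; apply/eqP; rewrite -subr_eq0 -normr_le0.
  apply: (@le0_geometric _ (2 * C)) => k.
  have H1 := picard_step_dist (PhiP _ cu) (stepU k)
    (fun t => eq_ind_r (fun x => x <= 2 * C / 2 ^+ k) (uU k t) (distrC (u t) (U k t))) t.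
  rewrite -(subrKA (U k.+1 t)); apply: le_trans (ler_normD _ _) _.
  apply: le_trans (lerD H1 (uU k.+1 t)) _.
  by rewrite exprS le_eqVlt; apply/orP; left; apply/eqP; field; rewrite expf_neq0.
have [G [dG G0 uG]] := PhiP _ cu; rewrite uE in uG.
exists u; split; first by rewrite uG clamp_id ?normr0 ?G0 // ltW.
move=> t tT j.
apply: (@near_eq_is_derive _ _ _ (fun s => G s 0 j)); last exact: dG (ltW tT) j.
have : \forall s \near t, `|s| < T.
  apply: (@open_near _ [set s : R | `|s| < T]) => //.
  apply: open_comp (@open_lt R T) => s _; exact: norm_continuous.
by apply: filterS => s sT; rewrite uG clamp_id // ltW.
Qed.

End picard.

(** During a time [tau] with [L * tau <= 1 / 2], any bound on the distance of the two solutions can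
    be halved. The first bound, 1, comes from continuity at [t0]. *)
Lemma ode_unique F L u w t0 e : lipschitz_with L F -> 0 < L -> 0 < e ->
  (forall t, `|t - t0| < e -> has_velocity u t (F (u t))) ->
  (forall t, `|t - t0| < e -> has_velocity w t (F (w t))) ->
  u t0 = w t0 -> \forall t \near t0, u t = w t.
Proof.
move=> FL L0 e0 du dw E0.
have nE : \forall t \near t0, `|u t - w t| <= 1.
  have H v : (forall t, `|t - t0| < e -> has_velocity v t (F (v t))) ->
      \forall t \near t0, `|v t0 - v t| <= 1 / 2.
    move=> dv; have c : {for t0, continuous v}.
      by apply: has_velocity_continuous (dv t0 _); rewrite subrr normr0.
    by have /cvgrPdist_le := c; apply; rewrite divr_gt0.
  apply: filterS2 (H _ du) (H _ dw) => t h1 h2.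
  have -> : u t - w t = (w t0 - w t) - (u t0 - u t).
    by rewrite E0 opprB [RHS]addrC subrKA.
  apply: le_trans (ler_normB _ _) _.
  by have -> : 1 = 1 / 2 + 1 / 2 :> R; [lra|exact: lerD].
have [e1 /= e10 e1P] := (nbhs_ballP _ _).1 nE.
pose tau := Num.min (Num.min e e1 / 2) (1 / 2 / L).
have tau0 : 0 < tau by rewrite /tau !lt_min !divr_gt0 // lt_min e0.
have tau_lt : tau < Num.min e e1.
  have m0 : 0 < Num.min e e1 by rewrite lt_min e0.
  apply: (@le_lt_trans _ _ (Num.min e e1 / 2)); first by rewrite ge_min lexx.
  by rewrite ltr_pdivrMr // ltr_pMr // ltr1n.
have Ltau : L * tau <= 1 / 2.
  by rewrite mulrC -ler_pdivlMr // ge_min lexx orbT.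
have D k t : `|t - t0| <= tau -> `|u t - w t| <= 1 / 2 ^+ k.
  elim: k t => [|k IH] t tt.
    rewrite expr0 divr1; apply: e1P; rewrite -ball_normE /= distrC.
    by apply: le_lt_trans tt (lt_le_trans tau_lt _); rewrite ge_min lexx orbT.
  have se (s : R) : `|s - t0| <= `|t - t0| -> `|s - t0| < e.
    move=> st; apply: le_lt_trans st (le_lt_trans tt (lt_le_trans tau_lt _)).
    by rewrite ge_min lexx.
  have := @velocity_dist u w (fun s => F (u s)) (fun s => F (w s)) t0 t (L * (1 / 2 ^+ k)) E0.
  move=> D; have {D} : `|u t - w t| <= L * (1 / 2 ^+ k) * `|t - t0|.
    apply: D => s st; [exact: du (se _ st)|exact: dw (se _ st)|].
    apply: le_trans (FL _ _) _; rewrite ler_pM2l //; apply: IH.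
    exact: le_trans st tt.
  move/le_trans; apply; have k0 : 0 < 1 / 2 ^+ k :> R by rewrite divr_gt0 ?exprn_gt0.
  apply: (@le_trans _ _ (L * (1 / 2 ^+ k) * tau)).
    by rewrite ler_wpM2l // mulr_ge0 // ltW.
  rewrite mulrAC exprS; apply: le_trans (ler_wpM2r (ltW k0) Ltau) _.
  by rewrite le_eqVlt; apply/orP; left; apply/eqP; field; rewrite expf_neq0.
apply/nbhs_ballP; exists tau => // t; rewrite -ball_normE /= distrC => /ltW tt.
apply/eqP; rewrite -subr_eq0 -normr_le0; apply: (@le0_geometric _ 1) => k.
exact: D.
Qed.

End ODE.

Lemma between_ball (R : realType) n (y z x a : 'rV[R]_n) r : 0 <= r ->
  `|y - a| <= r -> `|z - a| <= r -> between y z x -> `|x - a| <= r.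
Proof.
move=> r0 yr zr b; apply: rV_norm_le => // k.
have := le_trans (rV_norm_coord (y - a) k) yr.
have := le_trans (rV_norm_coord (z - a) k) zr.
have := b k; rewrite !mxE /Num.min /Num.max !ler_norml.
by case: ltP => ? /andP[? ?] /andP[? ?] /andP[? ?]; apply/andP; split; lra.
Qed.

(** [F'] is [F] after the coordinatewise clamp onto a box around [a], on which the partial
    derivatives are bounded. A bounded and globally Lipschitz field spares [picard] any condition on
    domains. *)
Lemma lipschitz_ext (R : realType) n m (F : 'rV[R]_n -> 'rV[R]_m) U a : open U -> U a ->
  (forall j, Ck 1 U (fun x => F x 0 j)) ->
  exists r L C (F' : 'rV[R]_n -> 'rV[R]_m), [/\ 0 < r, 0 < L,
    forall x y, `|F' x - F' y| <= L * `|x - y|,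
    forall x, `|F' x| <= C &
    forall x, `|x - a| <= r -> F' x = F x].
Proof.
move=> oU Ua cF.
have H : \forall y \near a, forall ji : 'I_m * 'I_n,
    derivable (fun x => F x 0 ji.1) y 'ev_(ji.2) /\
    `|'D_('ev_(ji.2)) (fun x => F x 0 ji.1) y| <=
    \sum_j \sum_i (`|'D_('ev_i) (fun x => F x 0 j) a| + 1).
  apply: (@filter_forall _ _ (fun ji y => derivable (fun x => F x 0 ji.1) y 'ev_(ji.2) /\
    `|'D_('ev_(ji.2)) (fun x => F x 0 ji.1) y| <=
    \sum_j \sum_i (`|'D_('ev_i) (fun x => F x 0 j) a| + 1)) (nbhs a)).
  move=> [j i] /=; have [_ /(_ i)[d c]] := cF j.
  have c1 := @Ck_continuous _ _ 0%N _ _ _ c Ua.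
  have /cvgrPdist_le/(_ _ ltr01) := c1.
  apply: filterS2 (open_near oU Ua) => y Uy Hy; split; first exact: d.
  apply: (@le_trans _ _ (`|'D_('ev_i) (fun x => F x 0 j) a| + 1)).
    rewrite -lerBlDl; apply: le_trans (lerB_dist _ _) _.
    by rewrite distrC.
  rewrite (bigD1 j) //= (bigD1 i) //= -addrA lerDl addr_ge0 //.
    by apply: sumr_ge0 => *; rewrite addr_ge0.
  by apply: sumr_ge0 => *; apply: sumr_ge0 => *; rewrite addr_ge0.
have [r0 /= r00 rH] := (nbhs_ballP _ _).1 H.
set K := \sum_j _ in rH.
have K0 : 0 <= K by apply: sumr_ge0 => *; apply: sumr_ge0 => *; rewrite addr_ge0.
pose r := r0 / 2.
have rp : 0 < r by rewrite divr_gt0.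
pose cl (x : 'rV[R]_n) : 'rV[R]_n := \row_i (a 0 i + clamp r (x 0 i - a 0 i)).
have cl_in x : `|cl x - a| <= r.
  apply: rV_norm_le => [|j]; first exact: ltW.
  by rewrite !mxE addrAC subrr add0r; exact/clamp_le/ltW.
have cl_id x : `|x - a| <= r -> cl x = x.
  move=> xr; apply/rowP => i; rewrite mxE clamp_id ?subrKC //.
  by apply: le_trans xr; have := rV_norm_coord (x - a) i; rewrite !mxE.
have cl_lip x y : `|cl x - cl y| <= `|x - y|.
  apply: rV_norm_le => // i; apply: le_trans (rV_norm_coord _ i).
  rewrite !mxE opprD addrACA subrr add0r; apply: le_trans (clamp_dist _ _ (ltW rp)) _.
  by rewrite opprB addrA subrK.
have in_r0 z : `|z - a| <= r -> forall ji : 'I_m * 'I_n,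
    derivable (fun x => F x 0 ji.1) z 'ev_(ji.2) /\
    `|'D_('ev_(ji.2)) (fun x => F x 0 ji.1) z| <= K.
  move=> zr; apply: rH; rewrite -ball_normE /= distrC; apply: le_lt_trans zr _.
  by rewrite /r ltr_pdivrMr // ltr_pMr // ltr1n.
(* The summand 1 keeps [L] positive when [n] or [K] is 0. *)
pose L := n%:R * K + 1; exists r, L, (`|F a| + L * r), (F \o cl).
have L0 : 0 < L by rewrite ltr_wpDl // mulr_ge0.
have FL x y : `|F (cl x) - F (cl y)| <= L * `|x - y|.
  apply: rV_norm_le => [|j]; first by rewrite mulr_ge0 // ltW.
  have in_box z : between (cl x) (cl y) z -> `|z - a| <= r.
    exact: between_ball (ltW rp) (cl_in x) (cl_in y).
  rewrite [in X in `|X|]mxE [in X in `|X|]mxE.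
  have [|xi bxi ->] := @mean_value R n (fun x => F x 0 j) (cl x) (cl y).
    by move=> z /in_box zr i; have [] := in_r0 z zr (j, i).
  apply: le_trans (ler_norm_sum _ _ _) _.
  apply: (@le_trans _ _ (\sum_(i < n) K * `|x - y|)).
    apply: ler_sum => i _; rewrite normrM mulrC; apply: ler_pM => //.
      by have [] := in_r0 _ (in_box _ (bxi i)) (j, i).
    exact: le_trans (rV_dist_coord _ _ i) (cl_lip x y).
  by rewrite sumr_const card_ord -[leLHS]mulr_natl [leLHS]mulrA ler_wpM2r // lerDl.
split=> //; last by move=> x xr /=; rewrite cl_id.
move=> x /=; rewrite -[F (cl x)](subrK (F a)) addrC.
apply: le_trans (ler_normD _ _) _; rewrite lerD2l.
have aE : cl a = a by apply: cl_id; rewrite subrr normr0 ltW.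
have := FL (cl x) a; rewrite aE (cl_id _ (cl_in x)) => /le_trans; apply.
by rewrite ler_wpM2l // ltW.
Qed.

Lemma open_preim (T S : topologicalType) (W : set T) (V : set S) (g : T -> S) :
  open W -> open V -> (forall x, W x -> {for x, continuous g}) ->
  open (W `&` g @^-1` V).
Proof.
move=> oW oV cg; rewrite openE => x [Wx Vx]; apply: filterI.
  exact: open_near oW Wx.
by apply: (cg x Wx); exact: open_near oV Vx.
Qed.

Lemma near_comp (T S : topologicalType) (g : T -> S) (t : T) (P : set S) :
  {for t, continuous g} ->
  (\forall q \near g t, P q) -> \forall s \near t, P (g s).
Proof. by move=> cg; exact: cg. Qed.

(** * Smoothness near a point of R^n *)

Section SmoothNear.
Context {R : realType}.

Definition smooth_near n (f : 'rV[R]_n -> R) y :=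
  exists U, [/\ open U, U y & Cinfty U f].

Section basics.
Context {n : nat}.
Implicit Types (f g : 'rV[R]_n -> R) (U : set 'rV[R]_n).

Lemma Cinfty_near U f : (forall y, U y -> smooth_near f y) -> Cinfty U f.
Proof.
move=> H k; apply: Ck_local => x /H[V [oV Vx sV]].
by exists V; split => //; exact: sV.
Qed.

Lemma smooth_near_near f y : smooth_near f y -> \forall z \near y, smooth_near f z.
Proof.
by move=> [U [oU Uy sf]]; apply: filterS (open_near oU Uy) => z Uz; exists U.
Qed.

Lemma smooth_near_eq f g y : (\forall z \near y, f z = g z) ->
  smooth_near f y -> smooth_near g y.
Proof.
move=> fg [U [oU Uy sf]].
exists (U `&` interior (fun z => f z = g z)); split.
- by apply: openI => //; exact: open_interior.
- by [].
- move=> k; apply: (@Ck_eq _ _ _ _ f).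
  + by apply: openI => //; exact: open_interior.
  + by move=> x [_ /interior_subset].
  + by apply: Ck_sub (sf k) => x [].
Qed.

Lemma smooth_near_continuous f y : smooth_near f y -> {for y, continuous f}.
Proof. by move=> [U [oU Uy sf]]; exact: Ck_continuous (sf 0%N) Uy. Qed.

Lemma smooth_near_differentiable f y : smooth_near f y -> differentiable f y.
Proof. by move=> [U [oU Uy sf]]; exact: Ck_differentiable oU (sf 1%N) Uy. Qed.

Lemma smooth_near_derive f y i : smooth_near f y ->
  smooth_near (fun x => 'D_('ev_i) f x) y.
Proof.
by move=> [U [oU Uy sf]]; exists U; split => // k; have [_ /(_ i)[_]] := sf k.+1.
Qed.

Lemma smooth_near_cst (a : R) y : smooth_near (fun _ : 'rV[R]_n => a) y.
Proof. by exists setT; split; [exact: openT| |move=> k; exact: Ck_cst]. Qed.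

Lemma smooth_near_coord j y : smooth_near (fun x : 'rV[R]_n => x 0 j) y.
Proof. by exists setT; split; [exact: openT| |move=> k; exact: Ck_coord]. Qed.

Lemma smooth_near2 f g y : smooth_near f y -> smooth_near g y ->
  exists U, [/\ open U, U y, Cinfty U f & Cinfty U g].
Proof.
move=> [U [oU Uy sf]] [V [oV Vy sg]]; exists (U `&` V); split => //.
- exact: openI.
- by move=> k; apply: Ck_sub (sf k) => x [].
- by move=> k; apply: Ck_sub (sg k) => x [].
Qed.

Lemma smooth_nearD f g y : smooth_near f y -> smooth_near g y ->
  smooth_near (fun x => f x + g x) y.
Proof.
move=> sf sg; have [U [oU Uy {}sf {}sg]] := smooth_near2 sf sg.
by exists U; split => // k; exact: CkD.
Qed.

Lemma smooth_nearM f g y : smooth_near f y -> smooth_near g y ->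
  smooth_near (fun x => f x * g x) y.
Proof.
move=> sf sg; have [U [oU Uy {}sf {}sg]] := smooth_near2 sf sg.
by exists U; split => // k; exact: CkM.
Qed.

Lemma smooth_nearV f y : smooth_near f y -> f y != 0 ->
  smooth_near (fun x => (f x)^-1) y.
Proof.
move=> [U [oU Uy sf]] f0.
have oN : open [set z : R | z != 0].
  have -> : [set z : R | z != 0] = [set z : R | z < 0] `|` [set z | 0 < z].
    by apply/seteqP; split => z /=; [rewrite neq_lt => /orP[]; [left|right]|
      case => ?; rewrite neq_lt; apply/orP; [left|right]].
  by apply: openU; [exact: open_lt|exact: open_gt].
have oV := open_preim oU oN (fun x Ux => Ck_continuous (sf 0%N) Ux).
exists (U `&` f @^-1` [set z | z != 0]); split => // k.
by apply: CkV => // [x []//|]; apply: Ck_sub (sf k) => x [].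
Qed.

End basics.

Lemma smooth_near_comp n m (g : 'rV[R]_n -> 'rV[R]_m) (f : 'rV[R]_m -> R) y :
  (forall j, smooth_near (fun x => g x 0 j) y) -> smooth_near f (g y) ->
  smooth_near (f \o g) y.
Proof.
move=> sg [V [oV Vy sf]].
have nU : \forall x \near y, forall j, smooth_near (fun x => g x 0 j) x.
  apply: (@filter_forall _ _ (fun j x => smooth_near (fun x => g x 0 j) x) (nbhs y)).
  by move=> j; exact: smooth_near_near.
pose U := interior (fun x => forall j, smooth_near (fun x => g x 0 j) x).
have oU : open U by exact: open_interior.
have oUV : open (U `&` g @^-1` V).
  apply: open_preim => // x /interior_subset sx; apply: rV_continuous => j.
  exact: smooth_near_continuous.
exists (U `&` g @^-1` V); split => // k.
apply: (Ck_comp oUV oV _ _ (sf k)); last by move=> x [].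
move=> j; have : Cinfty U (fun x => g x 0 j).
  by apply: Cinfty_near => x /interior_subset.
by move=> /(_ k); apply: Ck_sub => x [].
Qed.

Lemma bump_in n (U : set 'rV[R]_n) a : open U -> U a ->
  exists r (b : 'rV[R]_n -> R), [/\ 0 < r, Cinfty setT b,
    (forall y, `|y - a| <= r -> b y = 1),
    (forall y, 2 * r <= `|y - a| -> b y = 0) &
    (forall y, `|y - a| <= 2 * r -> U y)].
Proof.
move=> oU Ua; have [e /= e0 eU] := (nbhs_ballP _ _).1 (open_near oU Ua).
have r0 : 0 < e / 3 by rewrite divr_gt0.
have [b [sb b1 b0]] := bump_rV a r0.
(* With [e / 3], the closed box of radius [2 * r], outside which the bump vanishes, still lies in
   the ball of radius [e]. *)
exists (e / 3), b; split => // y ya; apply: eU; rewrite -ball_normE /= distrC.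
by apply: le_lt_trans ya _; rewrite mulrCA gtr_pMr // ltr_pdivrMr // mul1r ltr_nat.
Qed.

Lemma smooth_near_ext n (f : 'rV[R]_n -> R) a : smooth_near f a ->
  exists2 F, Cinfty setT F & \forall y \near a, F y = f y.
Proof.
move=> [U [oU Ua sf]]; have [r [b [r0 sb b1 b0 bU]]] := bump_in oU Ua.
exists (fun y => b y * f y); last first.
  apply/nbhs_ballP; exists r => // y; rewrite -ball_normE /= distrC => /ltW ya.
  by rewrite b1 // mul1r.
apply: Cinfty_near => y _; have [yr|yr] := leP (`|y - a|) (2 * r).
  by apply: smooth_nearM; [exists setT; split => //; exact: openT|exists U; split => //; exact: bU].
apply: smooth_near_eq (smooth_near_cst 0 y).
have : \forall z \near y, 2 * r < `|z - a|.
  apply/nbhs_ballP; exists (`|y - a| - 2 * r); first by rewrite /= subr_gt0.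
  move=> z; rewrite -ball_normE /= => yz.
  by have := ler_normD (y - z) (z - a); rewrite subrKA => ?; lra.
by apply: filterS => z /ltW zr; rewrite b0 // mul0r.
Qed.

End SmoothNear.

(** * Manifolds, tangent vectors and integral curves *)

Section Premanifold.
Context {R : realType}.

(** Charts together with the separation that makes cutoff functions smooth; [prod_premanifold] shows
    that this notion passes to products. *)
Definition premanifold (M : atlas_space R) : Prop :=
  [/\ hausdorff_space M, (forall c, atlas M c -> is_chart c),
      (forall x : M, exists2 c, atlas M c & cdom c x) &
      (forall c d, atlas M c -> atlas M d -> compatible c d)].

Lemma smooth_manifold_pre (M : atlas_space R) : smooth_manifold M -> premanifold M.
Proof. by move=> [h _ c v k]. Qed.

Lemma chart_image_open (T : topologicalType) n (c : chart R T n) W :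
  is_chart c -> open W -> open (cmap c @` (cdom c `&` W)).
Proof.
move=> [oc om ck _ ci] oW.
rewrite (_ : _ @` _ = (cmap c @` cdom c) `&` cinv c @^-1` W).
  exact: open_preim.
apply/seteqP; split => [_ [x [cx Wx] <-]|_ [[x cx <-] Wx]].
  by split; [exists x|rewrite /= ck].
by exists x => //; split => //; rewrite /= ck in Wx.
Qed.

Section oneM.
Context {M : atlas_space R}.
Hypothesis hM : premanifold M.
Implicit Types (f g : M -> R) (x : M) (c d : chart R M (dim M)).

Lemma atlas_chart c : atlas M c -> is_chart c.
Proof. by have [_ H _ _] := hM; exact: H. Qed.

Lemma chart_at x : exists2 c, atlas M c & cdom c x.
Proof. by have [_ _ H _] := hM; exact: H. Qed.

Lemma cdom_open c : atlas M c -> open (cdom c).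
Proof. by move=> /atlas_chart[]. Qed.

Lemma cmapK c x : atlas M c -> cdom c x -> cinv c (cmap c x) = x.
Proof. by move=> /atlas_chart[_ _ H _ _]; exact: H. Qed.

Lemma cmap_continuous c x : atlas M c -> cdom c x -> {for x, continuous (cmap c)}.
Proof. by move=> /atlas_chart[_ _ _ H _]; exact: H. Qed.

Lemma cinv_continuous c x : atlas M c -> cdom c x ->
  {for cmap c x, continuous (cinv c)}.
Proof. by move=> /atlas_chart[_ _ _ _ H] cx; apply: H; exists x. Qed.

Lemma near_cdom c x : atlas M c -> cdom c x -> \forall y \near x, cdom c y.
Proof. by move=> ac cx; exact: open_near (cdom_open ac) cx. Qed.

Lemma near_cinv c x (P : set M) : atlas M c -> cdom c x ->
  (\forall y \near x, P y) -> \forall z \near cmap c x, P (cinv c z).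
Proof.
by move=> ac cx nP; apply: (cinv_continuous ac cx); rewrite /= cmapK.
Qed.

Lemma near_cmap c x (P : set 'rV[R]_(dim M)) : atlas M c -> cdom c x ->
  (\forall z \near cmap c x, P z) -> \forall y \near x, P (cmap c y).
Proof. by move=> ac cx nP; exact: (cmap_continuous ac cx). Qed.

Lemma near_cmap_image c x : atlas M c -> cdom c x ->
  \forall z \near cmap c x, (cmap c @` cdom c) z.
Proof.
by move=> ac cx; apply: open_near; [have [] := atlas_chart ac|exists x].
Qed.

Lemma cinvK_image c z : atlas M c -> (cmap c @` cdom c) z -> cmap c (cinv c z) = z.
Proof. by move=> ac [x cx <-]; rewrite cmapK. Qed.

Definition smooth_at f x :=
  exists c, [/\ atlas M c, cdom c x & smooth_near (f \o cinv c) (cmap c x)].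

Lemma smooth_at_chart f x d : smooth_at f x -> atlas M d -> cdom d x ->
  smooth_near (f \o cinv d) (cmap d x).
Proof.
move=> [c [ac cx sf]] ad dx.
have [_ _ _ compat] := hM.
have oU : open (cmap d @` (cdom d `&` cdom c)).
  by apply: chart_image_open; [exact: atlas_chart|exact: cdom_open].
have sg j : smooth_near (fun y => cmap c (cinv d y) 0 j) (cmap d x).
  by exists (cmap d @` (cdom d `&` cdom c)); split => //; [exists x|exact: compat].
apply: (@smooth_near_eq _ _ ((f \o cinv c) \o (cmap c \o cinv d))); last first.
  by apply: smooth_near_comp => //=; rewrite cmapK.
have : \forall y \near cmap d x, cdom c (cinv d y).
  by apply: near_cinv => //; exact: near_cdom.
by apply: filterS => y cy /=; rewrite cmapK.
Qed.

Lemma smooth_funP f : smooth_fun f <-> forall x, smooth_at f x.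
Proof.
split=> [sf x|sf c ac].
  have [c ac cx] := chart_at x; exists c; split => //.
  exists (cmap c @` cdom c); split; [by have [] := atlas_chart ac|by exists x|].
  exact: sf.
by apply: Cinfty_near => _ [x cx <-]; exact: smooth_at_chart.
Qed.

Lemma smooth_at_eq f g x : (\forall y \near x, f y = g y) ->
  smooth_at f x -> smooth_at g x.
Proof.
move=> fg [c [ac cx sf]]; exists c; split => //.
by apply: smooth_near_eq sf; exact: (near_cinv ac cx fg).
Qed.

Lemma smooth_at_continuous f x : smooth_at f x -> {for x, continuous f}.
Proof.
move=> [c [ac cx sf]].
have cf : {for x, continuous ((f \o cinv c) \o cmap c)}.
  by apply: continuous_comp; [exact: cmap_continuous|exact: smooth_near_continuous].
have E : \forall y \near x, ((f \o cinv c) \o cmap c) y = f y.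
  by apply: filterS (near_cdom ac cx) => y cy /=; rewrite cmapK.
rewrite /prop_for /continuous_at -(nbhs_singleton E).
by apply: cvg_trans cf; apply: near_eq_cvg E.
Qed.

Lemma smooth_at_near f x : smooth_at f x -> \forall y \near x, smooth_at f y.
Proof.
move=> [c [ac cx sf]].
apply: filterS2 (near_cdom ac cx) (near_cmap ac cx (smooth_near_near sf)).
by move=> y cy sy; exists c.
Qed.

Lemma smooth_at_cst (a : R) x : smooth_at (fun=> a) x.
Proof.
by have [c ac cx] := chart_at x; exists c; split => //; exact: smooth_near_cst.
Qed.

Lemma smooth_atD f g x : smooth_at f x -> smooth_at g x ->
  smooth_at (fun y => f y + g y) x.
Proof.
move=> sf sg; have [c ac cx] := chart_at x; exists c; split => //.
by have := smooth_nearD (smooth_at_chart sf ac cx) (smooth_at_chart sg ac cx).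
Qed.

Lemma smooth_atM f g x : smooth_at f x -> smooth_at g x ->
  smooth_at (fun y => f y * g y) x.
Proof.
move=> sf sg; have [c ac cx] := chart_at x; exists c; split => //.
by have := smooth_nearM (smooth_at_chart sf ac cx) (smooth_at_chart sg ac cx).
Qed.

Lemma smooth_atV f x : smooth_at f x -> f x != 0 ->
  smooth_at (fun y => (f y)^-1) x.
Proof.
move=> [c [ac cx sf]] f0; exists c; split => //.
by apply: (smooth_nearV sf); rewrite /= cmapK.
Qed.

Lemma smooth_funD f g : smooth_fun f -> smooth_fun g -> smooth_fun (fun y => f y + g y).
Proof.
by move=> /smooth_funP sf /smooth_funP sg; apply/smooth_funP => x; exact: smooth_atD.
Qed.

Lemma smooth_funM f g : smooth_fun f -> smooth_fun g -> smooth_fun (fun y => f y * g y).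
Proof.
by move=> /smooth_funP sf /smooth_funP sg; apply/smooth_funP => x; exact: smooth_atM.
Qed.

Lemma smooth_fun_cst (a : R) : smooth_fun (fun _ : M => a).
Proof. by apply/smooth_funP => x; exact: smooth_at_cst. Qed.

Lemma smooth_fun_sum n (F : 'I_n -> M -> R) : (forall i, smooth_fun (F i)) ->
  smooth_fun (fun y => \sum_i F i y).
Proof.
elim: n F => [|n IH] F sF.
  rewrite (_ : (fun y => _) = fun=> 0); first exact: smooth_fun_cst.
  by apply/funext => y; rewrite big_ord0.
rewrite (_ : (fun y => _) = fun y => F ord0 y + \sum_i F (lift ord0 i) y).
  by apply: smooth_funD => //; exact: IH.
by apply/funext => y; rewrite big_ord_recl.
Qed.

Lemma smooth_fun_continuous f : smooth_fun f -> continuous f.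
Proof. by move=> /smooth_funP sf x; exact: smooth_at_continuous. Qed.

(** The last clause is the extension by zero of a [phi] that is smooth on [W] only; local data in a
    chart become global functions in this way. *)
Lemma cutoff (W : set M) p : open W -> W p -> exists chi : M -> R,
  [/\ \forall q \near p, chi q = 1, forall q, ~ W q -> chi q = 0 &
   forall phi : M -> R, (forall q, W q -> smooth_at phi q) ->
     smooth_fun (fun q => chi q * phi q)].
Proof.
move=> oW Wp; have [c ac cp] := chart_at p.
have oV : open (cmap c @` (cdom c `&` W)).
  by apply: chart_image_open => //; exact: atlas_chart.
have Va : (cmap c @` (cdom c `&` W)) (cmap c p) by exists p.
have [r [b [r0 sb b1 b0 bV]]] := bump_in oV Va.
pose chi q := if `[< cdom c q >] then b (cmap c q) else 0.
pose B : set 'rV[R]_(dim M) := [set y | `|y - cmap c p| <= 2 * r].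
have bd y : ~ B y -> b y = 0.
  by move=> /negP; rewrite -ltNge => /ltW; exact: b0.
have cB : compact B.
  apply: bounded_closed_compact.
    exists (2 * r + `|cmap c p|); split; first exact: num_real.
    move=> z zr y By; apply: ltW; apply: le_lt_trans zr.
    by rewrite -[y](subrK (cmap c p)); apply: le_trans (ler_normD _ _) _; rewrite lerD2r.
  rewrite (_ : B = closed_ball (cmap c p) (2 * r)).
    exact: closed_ball_closed.
  rewrite closed_ballE ?mulr_gt0 //; apply/seteqP; split => y /=;
    by rewrite /closed_ball_ /= distrC.
pose K := cinv c @` B.
have BV y : B y -> (cmap c @` (cdom c `&` W)) y by exact: bV.
have cK : compact K.
  apply: continuous_compact cB; apply: continuous_in_subspaceT => y.
  by rewrite inE => /BV[x [cx _] <-]; exact: cinv_continuous.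
(* Separation enters here: a compact set in a Hausdorff space is closed, so [chi] vanishes near
   every point outside [K]. *)
have clK : closed K by apply: compact_closed cK; have [] := hM.
have chi0 q : ~ K q -> chi q = 0.
  move=> nK; rewrite /chi; case: asboolP => // cq; apply: bd => Bq; apply: nK.
  by exists (cmap c q) => //; rewrite cmapK.
have KW q : K q -> cdom c q /\ W q.
  by move=> [y /BV[x [cx Wx] <-] <-]; rewrite cmapK.
have schi q : cdom c q -> smooth_at chi q.
  move=> cq; exists c; split => //.
  apply: (@smooth_near_eq _ _ b); last by exists setT; split => //; exact: openT.
  apply: filterS (near_cmap_image ac cq) => _ [z cz <-] /=.
  by rewrite cmapK // /chi asboolT.
exists chi; split.
- have : \forall q \near p, `|cmap c q - cmap c p| <= r.
    apply: (near_cmap ac cp (P := fun z => `|z - cmap c p| <= r)).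
    by apply/nbhs_ballP; exists r => // z; rewrite -ball_normE /= distrC => /ltW.
  by apply: filterS2 (near_cdom ac cp) => q cq qr; rewrite /chi asboolT // b1.
- by move=> q nW; apply: chi0 => /KW[].
- move=> phi sphi; apply/smooth_funP => q.
  have [Kq|nKq] := pselect (K q).
    by have [cq Wq] := KW q Kq; apply: smooth_atM; [exact: schi|exact: sphi].
  apply: smooth_at_eq (smooth_at_cst 0 q).
  apply: filterS (open_near (closed_openC clK) nKq) => z /chi0 ->.
  by rewrite mul0r.
Qed.

Lemma cutoff_smooth (W : set M) p : open W -> W p -> exists chi : M -> R,
  [/\ smooth_fun chi, \forall q \near p, chi q = 1 & forall q, ~ W q -> chi q = 0].
Proof.
move=> oW Wp; have [chi [c1 c0 sc]] := cutoff oW Wp; exists chi; split => //.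
have := sc (fun=> 1) (fun q _ => smooth_at_cst 1 q).
by under eq_fun do rewrite mulr1.
Qed.

Lemma smooth_ext f x : smooth_at f x ->
  exists2 F, smooth_fun F & \forall y \near x, F y = f y.
Proof.
move=> /smooth_at_near sf; have := nbhs_interior sf => /nbhs_singleton Wx.
have [chi [c1 _ sc]] := cutoff (@open_interior _ _) Wx.
exists (fun q => chi q * f q).
  by apply: sc => q /interior_subset.
by apply: filterS c1 => y ->; rewrite mul1r.
Qed.

End oneM.
End Premanifold.

(** * Tangent vectors as derivations, and local frames *)

Section Tangents.
Context {R : realType} {M : atlas_space R}.
Implicit Types (f g : M -> R) (x : M).

Lemma tvalP x (v : tangent x) : derivation_at x (tval v).
Proof. by have /asboolP := valP v. Qed.

Lemma tval_ext x (v w : tangent x) :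
  (forall f, smooth_fun f -> tval v f = tval w f) -> v = w.
Proof.
move=> H; apply: val_inj; apply/funext => f /=.
have [sf|nsf] := pselect (smooth_fun f); first exact: H.
by have [v0 _ _] := tvalP v; have [w0 _ _] := tvalP w; rewrite v0 // w0.
Qed.

Lemma tangent_ex x (D : (M -> R) -> R) :
  (forall (a : R) f g, smooth_fun f -> smooth_fun g ->
     D (fun y => a * f y + g y) = a * D f + D g) ->
  (forall f g, smooth_fun f -> smooth_fun g ->
     D (fun y => f y * g y) = f x * D g + g x * D f) ->
  premanifold M ->
  exists v : tangent x, forall f, smooth_fun f -> tval v f = D f.
Proof.
move=> lD mD hM; pose D' f : R^o := if `[< smooth_fun f >] then D f else 0.
have D'E f : smooth_fun f -> D' f = D f by move=> sf; rewrite /D' asboolT.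
have dD : derivation_pred x D'.
  apply/asboolP; split => [f nf|a f g sf sg|f g sf sg].
  - by rewrite /D' asboolF.
  - rewrite !D'E ?lD //; apply: smooth_funD => //.
    by apply: smooth_funM => //; exact: smooth_fun_cst.
  - by rewrite !D'E ?mD //; exact: smooth_funM.
by exists (Tangent dD) => f sf /=; exact: D'E.
Qed.

Lemma tval_lin x (a : R) (u v : tangent x) f :
  tval (a *: u + v) f = a * tval u f + tval v f.
Proof. by []. Qed.

Lemma tval0 x f : tval (0 : tangent x) f = 0.
Proof. by []. Qed.

Lemma tvalZv x (a : R) (u : tangent x) f : tval (a *: u) f = a * tval u f.
Proof. by []. Qed.

Lemma tvalDv x (u v : tangent x) f : tval (u + v) f = tval u f + tval v f.
Proof. by []. Qed.

Lemma tvalNv x (u : tangent x) f : tval (- u) f = - tval u f.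
Proof. by []. Qed.

Lemma tval_sumv x n (u : 'I_n -> tangent x) f :
  tval (\sum_i u i) f = \sum_i tval (u i) f.
Proof. by elim/big_rec2: _ => // i a b _ <-. Qed.

Hypothesis hM : premanifold M.

Lemma tvalD x (v : tangent x) f g : smooth_fun f -> smooth_fun g ->
  tval v (fun y => f y + g y) = tval v f + tval v g.
Proof.
move=> sf sg; have [_ vD _] := tvalP v.
have := vD 1 f g sf sg; rewrite mul1r => <-.
by congr tval; apply/funext => y; rewrite mul1r.
Qed.

Lemma tvalM x (v : tangent x) f g : smooth_fun f -> smooth_fun g ->
  tval v (fun y => f y * g y) = f x * tval v g + g x * tval v f.
Proof. by move=> sf sg; have [_ _ vM] := tvalP v; exact: vM. Qed.

Lemma tval_cst x (v : tangent x) a : tval v (fun=> a) = 0.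
Proof.
have [_ vD vM] := tvalP v.
have s1 := @smooth_fun_cst _ _ hM.
have E0 : tval v (fun=> 0) = 0.
  have := tvalD v (s1 0) (s1 0); rewrite (_ : (fun y => 0 + 0) = fun=> 0).
    by move=> H; lra.
  by apply/funext => y; rewrite addr0.
have E1 : tval v (fun=> 1) = 0.
  have := tvalM v (s1 1) (s1 1); rewrite (_ : (fun y => 1 * 1) = fun=> 1).
    by move=> H; lra.
  by apply/funext => y; rewrite mulr1.
have Ea : (fun _ : M => a * 1 + 0) = fun=> a.
  by apply/funext => y; rewrite mulr1 addr0.
by have := vD a _ _ (s1 1) (s1 0); rewrite Ea E0 E1 mulr0 addr0.
Qed.

Lemma tvalZ x (v : tangent x) a f : smooth_fun f ->
  tval v (fun y => a * f y) = a * tval v f.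
Proof.
by move=> sf; rewrite tvalM //; [rewrite tval_cst mulr0 addr0|exact: smooth_fun_cst].
Qed.

Lemma tval_sum x (v : tangent x) n (F : 'I_n -> M -> R) :
  (forall i, smooth_fun (F i)) ->
  tval v (fun y => \sum_i F i y) = \sum_i tval v (F i).
Proof.
elim: n F => [|n IH] F sF.
  rewrite big_ord0 -[RHS](tval_cst v 0); congr tval.
  by apply/funext => y; rewrite big_ord0.
rewrite big_ord_recl -IH // -tvalD //; last by apply: smooth_fun_sum.
by congr tval; apply/funext => y; rewrite big_ord_recl.
Qed.

(** Derivations are local: [h = f - g] equals [psi * h] everywhere, with [psi = 1 - chi]. Both
    factors vanish at [x], so the Leibniz rule gives 0. *)
Lemma tval_near x (v : tangent x) f g : smooth_fun f -> smooth_fun g ->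
  (\forall y \near x, f y = g y) -> tval v f = tval v g.
Proof.
move=> sf sg fg; have := nbhs_interior fg => /nbhs_singleton Wx.
have [chi [sc c1 c0]] := cutoff_smooth hM (@open_interior _ _) Wx.
have sN (h : M -> R) : smooth_fun h -> smooth_fun (fun y => -1 * h y).
  by move=> sh; apply: smooth_funM => //; exact: smooth_fun_cst.
pose h y := f y + -1 * g y; pose psi y := 1 + -1 * chi y.
have sh : smooth_fun h by apply: smooth_funD => //; exact: sN.
have sp : smooth_fun psi.
  by apply: smooth_funD => //; [exact: smooth_fun_cst|exact: sN].
have E : h = fun y => psi y * h y.
  apply/funext => y; have [Wy|nWy] := pselect (interior (fun y => f y = g y) y).
    by rewrite /h (interior_subset Wy) mulN1r subrr mulr0.
  by rewrite /psi c0 // mulr0 addr0 mul1r.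
have h0 : h x = 0 by rewrite /h (nbhs_singleton fg) mulN1r subrr.
have p0 : psi x = 0 by rewrite /psi (nbhs_singleton c1) mulN1r subrr.
have : tval v h = 0 by rewrite E tvalM // h0 p0 !mul0r addr0.
by rewrite /h tvalD ?tvalZ //; [move=> H; lra|exact: sN].
Qed.

(** By [tval_near] only [f] near [x] matters. There Hadamard's lemma writes [f] as a constant plus
    the sum of the [(y i - a 0 i) * g i], and at [x] the Leibniz rule leaves the values of the
    [g i], which are the partial derivatives. *)
Lemma tval_chart x c (y : 'I_(dim M) -> M -> R) (v : tangent x) f :
  atlas M c -> cdom c x -> (forall j, smooth_fun (y j)) ->
  (forall j, \forall z \near x, y j z = cmap c z 0 j) -> smooth_fun f ->
  tval v f = \sum_j 'D_('ev_j) (f \o cinv c) (cmap c x) * tval v (y j).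
Proof.
move=> ac cx sy yE sf.
have sfc : smooth_near (f \o cinv c) (cmap c x).
  by apply: smooth_at_chart => //; exact: (smooth_funP hM f).1 sf x.
(* [hadamard] is about functions smooth on all of R^n, hence the extension [F]; its coefficients
   come back to [M] multiplied by a cutoff. *)
have [F sF FE] := smooth_near_ext sfc.
have [G [sG Ga FG]] := hadamard (cmap c x) sF.
have [chi [c1 c0 sc]] := cutoff hM (cdom_open hM ac) cx.
pose g i q := chi q * (G i \o cmap c) q.
have sg i : smooth_fun (g i).
  apply: sc => q cq; exists c; split => //.
  apply: (@smooth_near_eq _ _ (G i)); last by exists setT; split => //; exact: openT.
  by apply: filterS (near_cmap_image hM ac cq) => z zi /=; rewrite (cinvK_image hM).
pose a := cmap c x.
have sya i : smooth_fun (fun z => y i z + - a 0 i).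
  by apply: smooth_funD => //; exact: smooth_fun_cst.
have syg i : smooth_fun (fun z => (y i z + - a 0 i) * g i z) by exact: smooth_funM.
pose h z := F a + \sum_i (y i z + - a 0 i) * g i z.
have sh : smooth_fun h.
  by apply: smooth_funD => //; [exact: smooth_fun_cst|exact: smooth_fun_sum].
have fh : \forall z \near x, f z = h z.
  have yE' : \forall z \near x, forall j, y j z = cmap c z 0 j.
    exact: (@filter_forall _ _ (fun j z => y j z = cmap c z 0 j) (nbhs x)).
  near=> z.
  have cz : cdom c z by near: z; exact: near_cdom.
  have -> : f z = F (cmap c z).
    suff -> : F (cmap c z) = (f \o cinv c) (cmap c z) by rewrite /= cmapK.
    by near: z; exact: (near_cmap hM ac cx FE).
  rewrite FG /h; congr (_ + _); apply: eq_bigr => i _.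
  have -> : chi z = 1 -> g i z = G i (cmap c z) by rewrite /g => ->; rewrite mul1r.
    by congr ((_ - _) * _); apply/esym; move: i; near: z.
  by near: z.
rewrite (tval_near v sf sh fh) /h tvalD //; last 2 first.
- exact: smooth_fun_cst.
- exact: smooth_fun_sum.
rewrite tval_cst add0r tval_sum //; apply: eq_bigr => i _.
rewrite tvalM // tvalD ?tval_cst ?addr0 //; last exact: smooth_fun_cst.
rewrite (nbhs_singleton (yE i)) subrr mul0r add0r /g (nbhs_singleton c1) mul1r /=.
by rewrite Ga; congr (_ * _); apply: near_eq_derive.
Unshelve. all: by end_near. Qed.

(** Coordinates and coordinate fields of the chart [c], valid on [V] but defined on all of [M]:
    tangent vectors act on global functions only, and the smoothness and closedness of forms are
    tested on global fields. *)
Record local_frame x (c : chart R M (dim M)) (y : 'I_(dim M) -> M -> R)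
    (E : 'I_(dim M) -> vfield M) (V : set M) : Prop := LocalFrame {
  lf_atlas : atlas M c;
  lf_open : open V;
  lf_in : V x;
  lf_dom : V `<=` cdom c;
  lf_smooth : forall i, smooth_fun (y i);
  lf_coord : forall q i, V q -> y i q = cmap c q 0 i;
  lf_vfield : forall i, smooth_vfield (E i);
  lf_partial : forall q i f, V q -> smooth_fun f ->
    tval (E i q) f = 'D_('ev_i) (f \o cinv c) (cmap c q);
  lf_span : forall q (v : tangent q), V q -> v = \sum_i tval v (y i) *: E i q }.

(** Coordinates and partial derivatives are multiplied by a cutoff to become global; [V] is the part
    of the chart where the cutoff is 1 nearby. *)
Lemma frame_ex x : exists c y E V, local_frame x c y E V.
Proof.
have [c ac cx] := chart_at hM x.
have [chi [c1 c0 sc]] := cutoff hM (cdom_open hM ac) cx.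
have sfc f q : smooth_fun f -> cdom c q -> smooth_near (f \o cinv c) (cmap c q).
  by move=> sf cq; apply: smooth_at_chart => //; exact: (smooth_funP hM f).1 sf q.
pose D i q (f : M -> R) : R := chi q * 'D_('ev_i) (f \o cinv c) (cmap c q).
have DP i q : exists v : tangent q, forall f, smooth_fun f -> tval v f = D i q f.
  have df h : smooth_fun h -> cdom c q -> derivable (h \o cinv c) (cmap c q) 'ev_i.
    by move=> sh cq; apply: diff_derivable; apply: smooth_near_differentiable; exact: sfc.
  apply: tangent_ex => //.
  - move=> a f g sf sg; rewrite /D; have [cq|ncq] := pselect (cdom c q); last first.
      by rewrite c0 // !mul0r mulr0 addr0.
    have d1 := is_deriveD (is_deriveZ a (derivableP (df _ sf cq))) (derivableP (df _ sg cq)).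
    have [_ ->] : is_derive (cmap c q) 'ev_i ((fun y => a * f y + g y) \o cinv c) _ := d1.
    by rewrite /GRing.scale /=; ring.
  - move=> f g sf sg; rewrite /D; have [cq|ncq] := pselect (cdom c q); last first.
      by rewrite c0 // !mul0r !mulr0 addr0.
    have d1 := is_deriveM (derivableP (df _ sf cq)) (derivableP (df _ sg cq)).
    have [_ ->] : is_derive (cmap c q) 'ev_i ((fun y => f y * g y) \o cinv c) _ := d1.
    by rewrite /GRing.scale /= cmapK //; ring.
pose E i : vfield M := fun q =>
  xget 0 [set v : tangent q | forall f, smooth_fun f -> tval v f = D i q f].
have EP i q f : smooth_fun f -> tval (E i q) f = D i q f.
  by move=> sf; have := @xgetPex _ 0 _ (DP i q); apply.
pose y j q := chi q * cmap c q 0 j.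
have sy j : smooth_fun (y j).
  apply: sc => q cq; exists c; split => //.
  apply: smooth_near_eq (smooth_near_coord j _).
  by apply: filterS (near_cmap_image hM ac cq) => z zi /=; rewrite (cinvK_image hM).
pose V := interior (fun q => chi q = 1) `&` cdom c.
have oV : open V by apply: openI; [exact: open_interior|exact: cdom_open].
have V1 q : V q -> chi q = 1 by move=> [/interior_subset].
exists c, y, E, V; split => //.
- by move=> q [].
- by move=> q i Vq; rewrite /y V1 // mul1r.
- move=> i f sf; rewrite (_ : vapply _ _ = fun q => chi q *
    ('D_('ev_i) (f \o cinv c) \o cmap c) q); last first.
    by apply/funext => q; rewrite /vapply EP.
  apply: sc => q cq; exists c; split => //.
  apply: smooth_near_eq (smooth_near_derive i (sfc _ _ sf cq)).
  by apply: filterS (near_cmap_image hM ac cq) => z zi /=; rewrite (cinvK_image hM).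
- by move=> q i f Vq sf; rewrite EP // /D V1 // mul1r.
- move=> q v Vq; apply: tval_ext => f sf; rewrite tval_sumv.
  rewrite (@tval_chart q c y) //; last 2 first.
  + by case: Vq.
  + by move=> j; apply: filterS (open_near oV Vq) => z Vz; rewrite /y V1 // mul1r.
  apply: eq_bigr => j _; rewrite tvalZv mulrC; congr (_ * _).
  by rewrite EP // /D V1 // mul1r.
Qed.

Lemma lf_dual x c y E V q i j : local_frame x c y E V -> V q ->
  tval (E i q) (y j) = (i == j)%:R.
Proof.
move=> H Vq; rewrite (lf_partial H) //; last exact: lf_smooth H j.
have cq := lf_dom H Vq; have ac := lf_atlas H.
have := near_cinv hM ac cq (open_near (lf_open H) Vq).
move=> /(filterS2 _)/(_ (near_cmap_image hM ac cq)) N.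
have -> : 'D_('ev_i) (y j \o cinv c) (cmap c q) =
    'D_('ev_i) (fun z : 'rV[R]_(dim M) => z 0 j) (cmap c q).
  apply: near_eq_derive; apply: N => z Vz zi /=.
  by rewrite (lf_coord H) // (cinvK_image hM).
have [_ ->] := is_derive_coord (cmap c q) 'ev_i j.
by rewrite !mxE eqxx eq_sym.
Qed.

Lemma lf_tangent_eq x c y E V q (v w : tangent q) : local_frame x c y E V -> V q ->
  (forall i, tval v (y i) = tval w (y i)) -> v = w.
Proof.
move=> H Vq vw; rewrite (lf_span H v Vq) (lf_span H w Vq).
by apply: eq_bigr => i _; rewrite vw.
Qed.

Lemma lf_comb x c y E V q (a : 'I_(dim M) -> R) j : local_frame x c y E V -> V q ->
  tval (\sum_i a i *: E i q) (y j) = a j.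
Proof.
move=> H Vq; rewrite tval_sumv (bigD1 j) // big1 => [|i ij].
  rewrite [LHS]addr0.
  by rewrite tvalZv (lf_dual _ _ H Vq) eqxx mulr1.
by rewrite tvalZv (lf_dual _ _ H Vq) (negPf ij) mulr0.
Qed.

End Tangents.

(** * Integral curves: local existence and uniqueness *)

Section Curves.
Context {R : realType} {M : atlas_space R}.
Hypothesis hM : premanifold M.
Implicit Types (gam : R -> M) (X : vfield M).

(** Continuity is not part of [velocity], which only speaks of functions along the curve. For a
    cutoff [chi] supported in a given neighbourhood, [chi \o gam] is derivable, hence positive near
    [t], which keeps [gam] in that neighbourhood. *)
Lemma velocity_continuous gam t x (v : tangent x) : velocity gam t v ->
  {for t, continuous gam}.
Proof.
move=> [gx dg] W nW; rewrite gx in nW; have Wx := nbhs_singleton (nbhs_interior nW).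
have [chi [sc c1 c0]] := cutoff_smooth hM (@open_interior _ _) Wx.
have [d _] := dg _ sc.
have cc : {for t, continuous (chi \o gam)}.
  by apply: differentiable_continuous; apply/derivable1_diffP.
have n0 : nbhs ((chi \o gam) t) [set z : R | 0 < z].
  apply: open_nbhs_nbhs; split; first exact: open_gt.
  by rewrite /= gx (nbhs_singleton c1) ltr01.
have N : nbhs t ((chi \o gam) @^-1` [set z : R | 0 < z]) := cc _ n0.
suff : nbhs t (gam @^-1` W) by [].
apply: filterS N => s H /=; apply: interior_subset.
by apply: contrapT => /c0 E; move: H; rewrite /= E ltxx.
Qed.

Lemma velocity_coord x0 c y E V gam t x (v : tangent x) :
  local_frame x0 c y E V -> V x -> velocity gam t v ->
  has_velocity (cmap c \o gam) t (\row_i tval v (y i)).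
Proof.
move=> H Vx vg j; have cg := velocity_continuous vg; have [gx dg] := vg.
rewrite mxE; apply: near_eq_is_derive (dg _ (lf_smooth H j)).
have : \forall s \near t, V (gam s).
  by apply: cg; rewrite /= gx; exact: open_near (lf_open H) Vx.
by apply: filterS => s Vs /=; rewrite (lf_coord H).
Qed.

Lemma velocity_of_coord x0 c y E V gam t x w :
  local_frame x0 c y E V -> V x -> gam t = x -> {for t, continuous gam} ->
  has_velocity (cmap c \o gam) t w ->
  velocity gam t (\sum_i w 0 i *: E i x).
Proof.
move=> H Vx gx cg dw; split => // f sf.
have ac := lf_atlas H; have cx := lf_dom H Vx.
have nE : \forall s \near t, ((f \o cinv c) \o (cmap c \o gam)) s = (f \o gam) s.
  have : \forall s \near t, cdom c (gam s).
    by apply: cg; rewrite /= gx; exact: near_cdom.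
  by apply: filterS => s cs /=; rewrite cmapK.
apply: near_eq_is_derive nE _.
have df : differentiable (f \o cinv c) ((cmap c \o gam) t).
  apply: smooth_near_differentiable; rewrite /= gx.
  by apply: smooth_at_chart => //; exact: (smooth_funP hM f).1 sf x.
have dd := @is_derive_chain R _ _ (cmap c \o gam) _ t 1
  (fun j => @ex_derive _ _ _ _ _ _ _ (dw j)) df.
apply: is_derive_eq dd _; rewrite tval_sumv; apply: eq_bigr => j _.
by rewrite tvalZv (lf_partial H) //= gx mulrC (@derive_val _ _ _ _ _ _ _ (dw j)).
Qed.

Lemma has_velocity_line n (a w : 'rV[R]_n) t :
  has_velocity (fun s => a + s *: w) t w.
Proof.
move=> j; have -> : (fun s : R => (a + s *: w) 0 j) = (fun s : R => a 0 j + w 0 j *: s).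
  by apply/funext => s; rewrite !mxE /GRing.scale /= [RHS]addrC [LHS]addrC mulrC.
have H := is_deriveD (is_derive_cst (a 0 j) t 1)
  (is_deriveZ (w 0 j) (is_derive_id t 1)).
by apply: is_derive_eq H _; rewrite add0r; exact: mulr1.
Qed.

Lemma has_velocity_near n (u w : R -> 'rV[R]_n) t x :
  (\forall s \near t, u s = w s) -> has_velocity u t x -> has_velocity w t x.
Proof.
by move=> uw H j; apply: near_eq_is_derive (H j); apply: filterS uw => s ->.
Qed.

Lemma velocity_near gam gam' t x (v : tangent x) :
  (\forall s \near t, gam s = gam' s) -> velocity gam t v -> velocity gam' t v.
Proof.
move=> uw [gx H]; split; first by rewrite -(nbhs_singleton uw).
by move=> f sf; apply: near_eq_is_derive (H f sf); apply: filterS uw => s /= ->.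
Qed.

Lemma velocity_ex x (v : tangent x) : exists gam, velocity gam 0 v.
Proof.
have [c [y [E [V H]]]] := frame_ex hM x.
have ac := lf_atlas H; have Vx := lf_in H; have cx := lf_dom H Vx.
pose w : 'rV[R]_(dim M) := \row_i tval v (y i).
pose u (s : R) := cmap c x + s *: w.
have u0 : u 0 = cmap c x by rewrite /u scale0r addr0.
have cu : {for 0, continuous u} := has_velocity_continuous (has_velocity_line _ _ _).
exists (cinv c \o u).
have -> : v = \sum_i w 0 i *: E i x.
  by rewrite {1}(lf_span H v Vx); apply: eq_bigr => i _; rewrite mxE.
apply: (velocity_of_coord H Vx).
- by rewrite /= u0 cmapK.
- by apply: continuous_comp => //; rewrite u0; exact: cinv_continuous.
apply: has_velocity_near (has_velocity_line (cmap c x) w 0).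
have : \forall s \near (0 : R), (cmap c @` cdom c) (u s).
  by apply: cu; rewrite /= u0; exact: near_cmap_image.
by apply: filterS => s us /=; rewrite (cinvK_image hM).
Qed.

Definition integral_curve X gam t := velocity gam t (X (gam t)).

Lemma near_ball_lt (t e t0 : R) : `|t - t0| < e -> \forall s \near t, `|s - t0| < e.
Proof.
move=> te; apply/nbhs_ballP; exists (e - `|t - t0|); first by rewrite /= subr_gt0.
move=> s; rewrite -ball_normE /= distrC => st.
by have := ler_normD (s - t) (t - t0); rewrite subrKA => ?; lra.
Qed.

Section local_ode.
Variables (X : vfield M) (x : M) (c : chart R M (dim M))
  (y : 'I_(dim M) -> M -> R) (E : 'I_(dim M) -> vfield M) (V : set M).
Hypotheses (sX : smooth_vfield X) (H : local_frame x c y E V).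

Let F (z : 'rV[R]_(dim M)) : 'rV[R]_(dim M) := \row_j vapply X (y j) (cinv c z).

Lemma field_in_chart : exists r L C F', [/\ 0 < r, 0 < L, 
  lipschitz_with L F', forall z, `|F' z| <= C &
  forall q, V q -> `|cmap c q - cmap c x| <= r ->
    F' (cmap c q) = \row_j tval (X q) (y j)].
Proof.
have ac := lf_atlas H; have Vx := lf_in H.
have oU : open (cmap c @` (cdom c `&` V)).
  by apply: chart_image_open; [exact: atlas_chart|exact: lf_open H].
have Ua : (cmap c @` (cdom c `&` V)) (cmap c x).
  by exists x => //; split => //; exact: lf_dom H _ Vx.
have [|r [L [C [F' [r0 L0 FL FC FE]]]]] := @lipschitz_ext R _ _ F _ _ oU Ua.
  move=> j; apply: (@Ck_sub _ _ _ (cmap c @` cdom c)).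
    by move=> _ [q [cq _] <-]; exists q.
  have := sX (lf_smooth H j) ac 1%N; apply: Ck_eq.
    by have [] := atlas_chart hM ac.
  by move=> z _; rewrite mxE.
exists r, L, C, F'; split => // q Vq qr; rewrite FE //.
by apply/rowP => j; rewrite !mxE cmapK //; exact: lf_dom H _ Vq.
Qed.

(** A solution of the extended field [F'] that starts within [rho / 2] of [x] travels less than
    [rho / 2] before time [e]. It thus stays where [F'] is the field [X] read in the chart, and [e]
    is the same for all these starting points. *)
Lemma flow_near_aux : exists2 e : R, 0 < e &
  \forall x' \near x, exists gam, gam 0 = x' /\
    forall t, `|t| < e -> integral_curve X gam t.
Proof.
have ac := lf_atlas H; have Vx := lf_in H; have cx := lf_dom H Vx.
have [r [L [C [F' [r0 L0 FL FC FE]]]]] := field_in_chart.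
have oU : open (cmap c @` (cdom c `&` V)).
  by apply: chart_image_open; [exact: atlas_chart|exact: lf_open H].
have Ua : (cmap c @` (cdom c `&` V)) (cmap c x) by exists x.
have [r1 /= r10 r1P] := (nbhs_ballP _ _).1 (open_near oU Ua).
pose rho := Num.min r r1.
have rho0 : 0 < rho by rewrite lt_min r0.
pose T := 1 / 2 / L; have T0 : 0 < T by rewrite !divr_gt0.
have LT : L * T <= 1 / 2 by rewrite /T mulrC divfK // gt_eqF.
have C0 : 0 <= C by apply: le_trans (FC 0).
have C1 : 0 < C + 1 by rewrite ltr_wpDl.
(* [C + 1] instead of [C] avoids dividing by a zero speed bound. *)
pose e := Num.min T (rho / 2 / (C + 1)).
have e0 : 0 < e by rewrite lt_min T0 !divr_gt0.
exists e => //.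
have N : \forall x' \near x, `|cmap c x' - cmap c x| < rho / 2.
  apply: (near_cmap hM ac cx (P := fun z => `|z - cmap c x| < rho / 2)).
  have r2 : 0 < rho / 2 by rewrite divr_gt0.
  by apply/nbhs_ballP; exists (rho / 2) => // z; rewrite -ball_normE /= distrC.
apply: filterS2 N (near_cdom hM ac cx) => x' x'r cx'.
have [u [u0 du]] := picard (cmap c x') FL L0 T0 LT.
have eT (t : R) : `|t| < e -> `|t| < T.
  by move=> /lt_le_trans; apply; rewrite ge_min lexx.
have ur (t : R) : `|t| < e -> `|u t - cmap c x| < rho.
  move=> te; rewrite -(subrKA (u 0)); apply: le_lt_trans (ler_normD _ _) _.
  rewrite (splitr rho) u0; apply: ler_ltD => //.
  have := @velocity_dist R _ u (fun=> u 0) (fun s => F' (u s)) (fun=> 0) 0 t C erefl.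
  rewrite subr0 => D; have {D} : `|u t - u 0| <= C * `|t|.
    apply: D => s; rewrite ?subr0 => st //.
    - by apply: du; apply: le_lt_trans st (eT _ te).
    - by move=> j; rewrite mxE; exact: is_derive_cst.
  rewrite u0 => /le_trans; apply.
  have te2 : `|t| <= rho / 2 / (C + 1).
    by apply: ltW; apply: lt_le_trans te _; rewrite ge_min lexx orbT.
  apply: (@le_trans _ _ ((C + 1) * `|t|)); first by rewrite ler_wpM2r // lerDl.
  by rewrite mulrC -ler_pdivlMr.
have uU (t : R) : `|t| < e -> exists q, [/\ V q, cmap c q = u t & cinv c (u t) = q].
  move=> te; have : (cmap c @` (cdom c `&` V)) (u t).
    apply: r1P; rewrite -ball_normE /= distrC.
    by apply: lt_le_trans (ur t te) _; rewrite ge_min lexx orbT.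
  by move=> [q [cq Vq] <-]; exists q; rewrite cmapK.
exists (cinv c \o u); split; first by rewrite /= u0 cmapK.
move=> t te; have [q [Vq qE Eq]] := uU t te.
rewrite /integral_curve /= Eq.
have dut := du t (eT t te).
have E1 : F' (u t) = \row_j tval (X q) (y j).
  rewrite -qE; apply: FE => //; rewrite qE; apply: ltW.
  by apply: lt_le_trans (ur t te) _; rewrite ge_min lexx.
have -> : X q = \sum_i F' (u t) 0 i *: E i q.
  by rewrite {1}(lf_span H (X q) Vq) E1; apply: eq_bigr => i _; rewrite mxE.
apply: (velocity_of_coord H Vq) => //.
- apply: continuous_comp; first exact: has_velocity_continuous dut.
  by rewrite -qE; apply: cinv_continuous => //; exact: lf_dom H _ Vq.
apply: has_velocity_near dut.
have : \forall s \near t, `|s| < e.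
  by have := @near_ball_lt t e 0; rewrite subr0 => /(_ te); apply: filterS => s; rewrite subr0.
by apply: filterS => s /uU[q' [_ q'E Eq']] /=; rewrite Eq' q'E.
Qed.

Lemma integral_unique_aux g1 g2 (t0 : R) :
  (\forall t \near t0, integral_curve X g1 t) ->
  (\forall t \near t0, integral_curve X g2 t) ->
  g1 t0 = x -> g2 t0 = x -> \forall t \near t0, g1 t = g2 t.
Proof.
move=> i1 i2 E1 E2.
have ac := lf_atlas H; have Vx := lf_in H; have cx := lf_dom H Vx.
have [r [L [C [F' [r0 L0 FL FC FE]]]]] := field_in_chart.
have N g : (\forall t \near t0, integral_curve X g t) -> g t0 = x ->
    \forall t \near t0, V (g t) /\ has_velocity (cmap c \o g) t (F' (cmap c (g t))).
  move=> ig gx; have cg := velocity_continuous (nbhs_singleton ig).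
  have nV : \forall t \near t0, V (g t) /\ `|cmap c (g t) - cmap c x| <= r.
    apply: (near_comp (P := fun q => V q /\ `|cmap c q - cmap c x| <= r) cg).
    rewrite gx; suff nr : \forall q \near x, `|cmap c q - cmap c x| <= r.
      by apply: filterS2 (open_near (lf_open H) Vx) nr => q.
    apply: (near_cmap hM ac cx (P := fun z => `|z - cmap c x| <= r)).
    by apply/nbhs_ballP; exists r => // z; rewrite -ball_normE /= distrC => /ltW.
  apply: filterS2 ig nV => t igt [Vt tr]; split => //.
  rewrite FE //; exact: (velocity_coord H Vt igt).
have nn : \forall t \near t0,
    (V (g1 t) /\ has_velocity (cmap c \o g1) t (F' (cmap c (g1 t)))) /\
    (V (g2 t) /\ has_velocity (cmap c \o g2) t (F' (cmap c (g2 t)))).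
  by apply: filterS2 (N _ i1 E1) (N _ i2 E2) => t.
have [e /= e0 eP] := (nbhs_ballP _ _).1 nn.
have eb (t : R) : `|t - t0| < e -> ball t0 e t by rewrite -ball_normE /= distrC.
have := @ode_unique R _ F' L (cmap c \o g1) (cmap c \o g2) t0 e FL L0 e0
  (fun t te => (eP t (eb t te)).1.2) (fun t te => (eP t (eb t te)).2.2).
rewrite /= E1 E2 => /(_ erefl).
apply: filterS2 nn => t [[V1 _] [V2 _]] EE.
by rewrite -(cmapK hM ac (lf_dom H V1)) EE (cmapK hM ac (lf_dom H V2)).
Qed.

End local_ode.

Lemma flow_near X (x : M) : smooth_vfield X -> exists2 e : R, 0 < e &
  \forall x' \near x, exists gam, gam 0 = x' /\
    forall t, `|t| < e -> integral_curve X gam t.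
Proof.
by move=> sX; have [c [y [E [V H]]]] := frame_ex hM x; exact: flow_near_aux H.
Qed.

Lemma integral_unique_near X g1 g2 (t0 : R) : smooth_vfield X ->
  (\forall t \near t0, integral_curve X g1 t) ->
  (\forall t \near t0, integral_curve X g2 t) ->
  g1 t0 = g2 t0 -> \forall t \near t0, g1 t = g2 t.
Proof.
move=> sX i1 i2 E; have [c [y [E' [V H]]]] := frame_ex hM (g2 t0).
exact: (integral_unique_aux sX H).
Qed.

(** The set of times where the curves agree is open by local uniqueness and closed because [M] is
    Hausdorff; the interval is connected. *)
Lemma integral_unique X g1 g2 (a b t0 : R) : smooth_vfield X ->
  (forall t, a < t < b -> integral_curve X g1 t) ->
  (forall t, a < t < b -> integral_curve X g2 t) ->
  a < t0 < b -> g1 t0 = g2 t0 -> forall t, a < t < b -> g1 t = g2 t.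
Proof.
move=> sX i1 i2 abt0 E0 t abt.
have cI : connected (`]a, b[%classic : set R).
  by apply/connected_intervalP; exact: interval_is_interval.
have oI : open (`]a, b[%classic : set R) by exact: interval_open.
have nI (s : R) : a < s < b -> \forall r \near s, a < r < b.
  move=> abs; have : (`]a, b[%classic : set R) s by rewrite /= in_itv.
  by move=> /(open_near oI); apply: filterS => r; rewrite /= in_itv.
have cg g s : (forall t, a < t < b -> integral_curve X g t) -> a < s < b ->
    {for s, continuous g}.
  by move=> ig abs; exact: velocity_continuous (ig s abs).
have neq (s : R) : a < s < b -> g1 s <> g2 s -> \forall r \near s, g1 r <> g2 r.
  move=> abs ne; have [hH _ _ _] := hM.
  have [[A B] /= [A1 B2] [oA oB AB]] : exists2 AB : set M * set M,
      (g1 s \in AB.1 /\ g2 s \in AB.2) & [/\ open AB.1, open AB.2 & AB.1 `&` AB.2 == set0].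
    by rewrite open_hausdorff in hH; apply: hH; exact/eqP.
  rewrite !inE in A1 B2.
  have n1 : \forall r \near s, A (g1 r) by apply: (cg _ _ i1 abs); exact: open_near oA A1.
  have n2 : \forall r \near s, B (g2 r) by apply: (cg _ _ i2 abs); exact: open_near oB B2.
  apply: filterS2 n1 n2 => r Ar Br Er; move/eqP/seteqP: AB => [AB _].
  by apply: (AB (g1 r)); split => //; rewrite Er.
have := cI ((`]a, b[%classic : set R) `&` [set s | g1 s = g2 s]).
have -> : g1 t = g2 t <-> ([set s | g1 s = g2 s] : set R) t by [].
move=> H; suff : ((`]a, b[%classic : set R) `&` [set s | g1 s = g2 s]) t by case.
rewrite H; first by rewrite /= in_itv.
- by exists t0; split => //=; rewrite in_itv.
- exists (interior [set s | g1 s = g2 s]); first exact: open_interior.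
  apply/seteqP; split => s [Is]; last by move=> /interior_subset.
  rewrite /= => Es; split => //; have abs : a < s < b by move: Is; rewrite /= in_itv.
  apply: (integral_unique_near sX) Es.
    by apply: filterS (nI s abs) => r; exact: i1.
  by apply: filterS (nI s abs) => r; exact: i2.
- exists (~` interior [set s | g1 s <> g2 s]).
    by apply: open_closedC; exact: open_interior.
  apply/seteqP; split => s [Is]; have abs : a < s < b by move: Is; rewrite /= in_itv.
    by move=> Es; split => // /interior_subset.
  by move=> nE; split => //; apply: contrapT => ne; apply: nE; exact: neq.
Qed.

End Curves.

(** * Completeness of vector fields *)

Section Complete.
Context {R : realType} {G M : atlas_space R}.
Hypotheses (hG : premanifold G) (hM : premanifold M).

Lemma integral_curve_shift (X : vfield G) gam (s t : R) :
  integral_curve X gam (t + s) -> integral_curve X (fun r => gam (r + s)) t.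
Proof.
move=> [gx dg]; split => // f sf.
have [d E] := dg f sf.
have d1 : derivable (fun r : R => r + s) t 1.
  by have [] := is_deriveD (is_derive_id t 1) (is_derive_cst s t 1).
have := is_derive_comp1 d1 d; rewrite E.
have [_ ->] := is_deriveD (is_derive_id t 1) (is_derive_cst s t 1).
by rewrite addr0 mulr1.
Qed.

Lemma integral_curve_near (X : vfield G) gam gam' (t : R) :
  (\forall s \near t, gam s = gam' s) -> integral_curve X gam t ->
  integral_curve X gam' t.
Proof.
move=> N; have E := nbhs_singleton N; rewrite /integral_curve -E.
exact: velocity_near.
Qed.

Lemma near_open_itv (a b t : R) : a < t < b -> \forall s \near t, a < s < b.
Proof.
move=> abt; have : (`]a, b[%classic : set R) t by rewrite /= in_itv.
move=> /(open_near (interval_open _ _)) H.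
by apply: filterS (H _ _) => // s; rewrite /= in_itv.
Qed.

(** [h] and [k] start at the points of [gam] at times [A - e / 2] and [- (A - e / 2)] and last for a
    time [e], which passes the ends by [e / 2]. On the overlaps they agree with [gam] by
    uniqueness. *)
Lemma integral_curve_extend (X : vfield G) gam h k (A e : R) :
  smooth_vfield X -> 0 < e -> e <= A ->
  (forall t, `|t| < A -> integral_curve X gam t) ->
  h 0 = gam (A - e / 2) -> (forall t, `|t| < e -> integral_curve X h t) ->
  k 0 = gam (- (A - e / 2)) -> (forall t, `|t| < e -> integral_curve X k t) ->
  exists gam', gam' 0 = gam 0 /\
    forall t, `|t| < A + e / 2 -> integral_curve X gam' t.
Proof.
move=> sX e0 eA ig h0 ih k0 ik; set s := A - e / 2 in h0 k0.
have s0 : 0 < s by rewrite /s; lra.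
have hE (r : R) : A - e < r < A -> gam r = h (r + - s).
  apply: (@integral_unique _ _ hG X gam (fun r => h (r + - s)) (A - e) A s sX).
  - by move=> t ?; apply: ig; rewrite ltr_norml; apply/andP; split; lra.
  - move=> t ?; apply: integral_curve_shift; apply: ih.
    by rewrite ltr_norml /s; apply/andP; split; lra.
  - by rewrite /s; apply/andP; split; lra.
  - by rewrite subrr h0.
have kE (r : R) : - A < r < - (A - e) -> gam r = k (r + s).
  apply: (@integral_unique _ _ hG X gam (fun r => k (r + s)) (- A) (- (A - e)) (- s) sX).
  - by move=> t ?; apply: ig; rewrite ltr_norml; apply/andP; split; lra.
  - move=> t ?; apply: integral_curve_shift; apply: ik.
    by rewrite ltr_norml /s; apply/andP; split; lra.
  - by rewrite /s; apply/andP; split; lra.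
  - by rewrite addNr k0.
exists (fun t => if s <= t then h (t + - s) else if t <= - s then k (t + s) else gam t).
split.
  by rewrite leNgt s0 /= leNgt oppr_lt0 s0.
move=> t; rewrite ltr_norml => /andP[t1 t2].
have [st|ts] := leP s t.
  apply: (@integral_curve_near X (fun r => h (r + - s))); last first.
    by apply: integral_curve_shift; apply: ih; rewrite ltr_norml /s; apply/andP; split; rewrite /s in st; lra.
  (* The margin is at most [s], to stay clear of the branch of [k], and at most [e / 2], to stay
     where [gam] and [h] agree. *)
  have /near_open_itv : s - Num.min s (e / 2) < t < t + 1.
    have : 0 < Num.min s (e / 2) by rewrite lt_min s0 divr_gt0.
    by move=> ?; apply/andP; split; lra.
  apply: filterS => r /andP[r1 _]; case: leP => // rs.
  have m1 : Num.min s (e / 2) <= s by rewrite ge_min lexx.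
  rewrite leNgt; have -> /= : - s < r by lra.
  apply/esym/hE; have : Num.min s (e / 2) <= e / 2 by rewrite ge_min lexx orbT.
  by move=> ?; apply/andP; split; rewrite /s in r1 rs *; lra.
have [tks|kst] := leP t (- s).
  apply: (@integral_curve_near X (fun r => k (r + s))); last first.
    by apply: integral_curve_shift; apply: ik; rewrite ltr_norml /s; apply/andP; split; rewrite /s in tks; lra.
  have /near_open_itv : t - 1 < t < - s + Num.min s (e / 2).
    have : 0 < Num.min s (e / 2) by rewrite lt_min s0 divr_gt0.
    by move=> ?; apply/andP; split; lra.
  apply: filterS => r /andP[_ r2].
  have m1 : Num.min s (e / 2) <= s by rewrite ge_min lexx.
  have m2 : Num.min s (e / 2) <= e / 2 by rewrite ge_min lexx orbT.
  rewrite leNgt; have -> /= : r < s by lra.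
  case: leP => // rs; apply/esym/kE.
  by apply/andP; split; rewrite /s in r2 rs m1 *; lra.
apply: (@integral_curve_near X gam); last first.
  by apply: ig; rewrite ltr_norml; apply/andP; split; rewrite /s in ts kst; lra.
have /near_open_itv : - s < t < s by rewrite ts kst.
apply: filterS => r /andP[r1 r2].
by rewrite leNgt r2 /= leNgt r1.
Qed.

(** The curve at time [t] is taken from the solution that lives up to the first integer above [|t|];
    uniqueness makes these choices agree. *)
Lemma complete_of_bounded (X : vfield G) : smooth_vfield X ->
  (forall g0 (T : R), exists gam, gam 0 = g0 /\
    forall t, `|t| < T -> integral_curve X gam t) -> complete_vfield X.
Proof.
move=> sX H g0.
have /choice[gam gamP] : forall n : nat, exists gam, gam 0 = g0 /\
    forall t, `|t| < n.+1%:R -> integral_curve X gam t.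
  by move=> n; exact: H.
have agree m n (t : R) : (m <= n)%N -> `|t| < m.+1%:R -> gam m t = gam n t.
  move=> mn tm; apply: (integral_unique hG sX (t0 := 0) (a := - m.+1%:R) (b := m.+1%:R)).
  - by move=> r ?; apply: (gamP m).2; rewrite ltr_norml.
  - move=> r ?; apply: (gamP n).2; apply: (@lt_le_trans _ _ m.+1%:R).
      by rewrite ltr_norml.
    by rewrite ler_nat.
  - by rewrite oppr_lt0 ltr0n.
  - by rewrite (gamP m).1 (gamP n).1.
  - by move: tm; rewrite ltr_norml.
pose N (t : R) := Num.truncn `|t|.
have NP (t : R) : `|t| < (N t).+1%:R by exact: truncnS_gt.
exists (fun t => gam (N t) t); split; first by rewrite (gamP _).1.
move=> t; apply: (@integral_curve_near X (gam (N t))); last exact: (gamP _).2 (NP t).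
have : \forall r \near t, `|r| < (N t).+1%:R.
  have := @near_ball_lt R t (N t).+1%:R 0; rewrite subr0 => /(_ (NP t)).
  by apply: filterS => r; rewrite subr0.
apply: filterS => r rN; have [le|/ltnW le] := leqP (N t) (N r).
  exact: agree.
by apply/esym/agree => //; exact: NP.
Qed.

(* The time of existence of integral curves starting at the points [e y],
   uniform on compact pieces of an integral curve of [Y], is transported to all
   the points over these pieces. *)
Lemma complete_lift (X : vfield G) (Y : vfield M) (J : G -> M) (e : M -> G) :
  smooth_vfield X -> smooth_vfield Y -> continuous e -> complete_vfield Y ->
  (forall gam t, integral_curve X gam t -> integral_curve Y (J \o gam) t) ->
  (forall g (eta : R) gam, gam 0 = e (J g) ->
    (forall t, `|t| < eta -> integral_curve X gam t) ->
    exists gam', gam' 0 = g /\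
      forall t, `|t| < eta -> integral_curve X gam' t) ->
  complete_vfield X.
Proof.
move=> sX sY ce cY XY tr; apply: complete_of_bounded => // g0 T.
have [T0|T0] := leP T 0.
  by exists (fun=> g0); split => // t tT; have := le_lt_trans (normr_ge0 t) (lt_le_trans tT T0); rewrite ltxx.
have [x [x0 ix]] := cY (J g0).
have K := (compact_near_coveringP _).1 (@segment_compact R (- T) T).
have D : \forall eps \near (0 : R)^'+, `[- T, T]%classic `<=` (fun s => exists gam,
    gam 0 = e (x s) /\ forall t, `|t| < eps -> integral_curve X gam t).
  apply: (K R (0 : R)^'+ (fun eps s => exists gam,
    gam 0 = e (x s) /\ forall t, `|t| < eps -> integral_curve X gam t)).
  move=> s _; have [eta eta0 N] := flow_near hG (e (x s)) sX.
  have cex : {for s, continuous (e \o x)}.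
    by apply: continuous_comp; [exact: velocity_continuous (ix s)|exact: ce].
  have N2 := near_comp cex N.
  near=> s' eps.
  have ee : eps < eta by near: eps; exact: nbhs_right_lt.
  have [gam [g1 g2]] : exists gam, gam 0 = (e \o x) s' /\
    forall t, `|t| < eta -> integral_curve X gam t by near: s'.
  by exists gam; split => // t te; apply: g2; apply: lt_trans te ee.
have [eps0 [epsP0 eps00]] := filter_ex (filterI D (@nbhs_right_gt R 0)).
pose eps := Num.min eps0 T.
have eps_gt0 : 0 < eps by rewrite lt_min T0 andbT.
have epsT : eps <= T by rewrite ge_min lexx orbT.
have start s g : `|s| <= T -> J g = x s -> exists gam, gam 0 = g /\
    forall t, `|t| < eps -> integral_curve X gam t.
  move=> sT Jg; have [|gam [g1 g2]] := epsP0 s.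
    by rewrite /= in_itv /= -ler_norml.
  apply: (tr g eps gam); first by rewrite Jg.
  by move=> t te; apply: g2; apply: lt_le_trans te _; rewrite ge_min lexx.
pose C A := exists gam, gam 0 = g0 /\ forall t, `|t| < A -> integral_curve X gam t.
have Cle A A' : A' <= A -> C A -> C A'.
  move=> AA [gam [g1 g2]]; exists gam; split => // t tA; apply: g2.
  exact: lt_le_trans tA AA.
have Cext A : eps <= A -> A <= T -> C A -> C (A + eps / 2).
  move=> eA AT [gam [g1 g2]].
  (* [J \o gam] is the integral curve [x], so the ends of [gam] lie over the compact piece and
     [start] prolongs [gam] there by a time independent of [A]. *)
  have Jx (t : R) : - A < t < A -> (J \o gam) t = x t.
    apply: (integral_unique hM sY (t0 := 0)).
    - by move=> r ?; apply: XY; apply: g2; rewrite ltr_norml.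
    - by move=> r _; exact: ix.
    - by apply/andP; split; lra.
    - by rewrite /= g1 x0.
  have e2 : 0 < eps / 2 by rewrite divr_gt0.
  have [||h [h1 h2]] := @start (A - eps / 2) (gam (A - eps / 2)).
  - by rewrite ler_norml; apply/andP; split; lra.
  - by apply: Jx; apply/andP; split; lra.
  have [||k [k1 k2]] := @start (- (A - eps / 2)) (gam (- (A - eps / 2))).
  - by rewrite normrN ler_norml; apply/andP; split; lra.
  - by apply: Jx; apply/andP; split; lra.
  by have := integral_curve_extend sX eps_gt0 eA g2 h1 h2 k1 k2; rewrite g1.
(* Each step gains [eps / 2]; the cap [T] is there because [start] covers the times up to [T]
   only. *)
have Ck k : C (Num.min T (eps + k%:R * (eps / 2))).
  elim: k => [|k IH].
    rewrite mul0r addr0; apply: (Cle eps); first by rewrite ge_min lexx orbT.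
    by apply: (start 0); rewrite ?x0 // normr0 ltW.
  apply: Cle (Cext _ _ _ IH).
  - rewrite -natr1 mulrDl mul1r addrA; case: (leP T (eps + k%:R * (eps / 2))) => H.
      by rewrite ge_min; apply/orP; left; rewrite lerDl divr_ge0 // ltW.
    by rewrite ge_min lexx orbT.
  - by rewrite le_min epsT lerDl mulr_ge0 // divr_ge0 // ltW.
  - by rewrite ge_min lexx.
have [k kP] : exists k : nat, T <= k%:R * (eps / 2).
  exists (Num.truncn `|T / (eps / 2)|).+1; rewrite -ler_pdivrMr ?divr_gt0 //.
  by apply: le_trans (ler_norm _) _; apply: ltW; exact: truncnS_gt.
have := Ck k; rewrite min_l //; apply: le_trans kP _.
by rewrite lerDr ltW.
Unshelve. all: by end_near. Qed.

End Complete.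

Lemma open_setX (T S : topologicalType) (A : set T) (B : set S) :
  open A -> open B -> open (A `*` B).
Proof.
move=> oA oB; rewrite openE => -[x y] [Ax By]; exists (A, B) => //=.
by split; exact: open_near.
Qed.

(** * Smooth maps and products *)

Section SmoothMaps.
Context {R : realType}.
Implicit Types M N P Q : atlas_space R.

(** The working form of smoothness: it composes without charts, and cutoff functions give back
    continuity. *)
Definition smooth_pullback M N (J : M -> N) := forall f, smooth_fun f -> smooth_fun (f \o J).

Lemma smooth_map_on_at M N (U : set M) (J : M -> N) x f :
  premanifold M -> premanifold N -> open U -> U x -> smooth_map_on U J ->
  smooth_at f (J x) -> smooth_at (f \o J) x.
Proof.
move=> hM hN oU Ux [cJ sJ] sf.
have [c ac cx] := chart_at hM x; have [d ad dx] := chart_at hN (J x).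
exists c; split => //.
have oW : open (U `&` J @^-1` cdom d).
  by apply: open_preim => //; exact: cdom_open.
have oV : open (cmap c @` (cdom c `&` (U `&` J @^-1` cdom d))).
  by apply: chart_image_open => //; exact: atlas_chart.
have Vx : (cmap c @` (cdom c `&` (U `&` J @^-1` cdom d))) (cmap c x) by exists x.
apply: (@smooth_near_eq _ _ ((f \o cinv d) \o (fun y => cmap d (J (cinv c y))))).
  apply: filterS (open_near oV Vx) => _ [z [cz [Uz dz]] <-] /=.
  by rewrite !cmapK.
apply: smooth_near_comp; last first.
  by rewrite /= cmapK //; exact: smooth_at_chart.
move=> j; exists (cmap c @` (cdom c `&` (U `&` J @^-1` cdom d))); split => //.
by have := sJ c d ac ad j; rewrite setIA.
Qed.

Lemma smooth_map_pullback M N (J : M -> N) : premanifold M -> premanifold N ->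
  smooth_map J -> smooth_pullback J.
Proof.
move=> hM hN sJ f /(smooth_funP hN) sf; apply/(smooth_funP hM) => x.
by apply: (smooth_map_on_at hM hN openT _ sJ).
Qed.

Lemma smooth_pullback_continuous M N (J : M -> N) : premanifold M -> premanifold N ->
  smooth_pullback J -> continuous J.
Proof.
move=> hM hN sJ x W nW; have Wx := nbhs_singleton (nbhs_interior nW).
have [chi [sc c1 c0]] := cutoff_smooth hN (@open_interior _ _) Wx.
have cc : {for x, continuous (chi \o J)} := @smooth_fun_continuous _ _ hM _ (sJ _ sc) x.
have n0 : nbhs ((chi \o J) x) [set z : R | 0 < z].
  apply: open_nbhs_nbhs; split; first exact: open_gt.
  by rewrite /= (nbhs_singleton c1) ltr01.
have Nx : nbhs x ((chi \o J) @^-1` [set z : R | 0 < z]) := cc _ n0.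
suff : nbhs x (J @^-1` W) by [].
apply: filterS Nx => s H /=; apply: interior_subset.
by apply: contrapT => /c0 E; move: H; rewrite /= E ltxx.
Qed.

Lemma smooth_pullback_comp M N P (J : M -> N) (K : N -> P) :
  smooth_pullback J -> smooth_pullback K -> smooth_pullback (K \o J).
Proof. by move=> sJ sK f sf; exact: sJ (sK f sf). Qed.

Lemma smooth_pullback_at M N (J : M -> N) x f : premanifold M -> premanifold N ->
  smooth_pullback J -> smooth_at f (J x) -> smooth_at (f \o J) x.
Proof.
move=> hM hN sJ /(smooth_ext hN)[F sF FE].
apply: (smooth_at_eq hM) ((smooth_funP hM _).1 (sJ F sF) x).
exact: (near_comp (@smooth_pullback_continuous _ _ J hM hN sJ x) FE).
Qed.

Lemma smooth_pullback_cst M N (y : N) : premanifold M ->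
  smooth_pullback (fun _ : M => y).
Proof. by move=> hM f sf; exact: (@smooth_fun_cst _ _ hM). Qed.

Lemma smooth_pullback_id M : smooth_pullback (@id M).
Proof. by []. Qed.

Lemma smooth_at_coord M c x j : premanifold M -> atlas M c -> cdom c x ->
  smooth_at (fun q : M => cmap c q 0 j) x.
Proof.
move=> hM ac cx; exists c; split => //.
apply: (smooth_near_eq _ (smooth_near_coord j (cmap c x))).
by apply: filterS (near_cmap_image hM ac cx) => z zi /=; rewrite (cinvK_image hM).
Qed.

Section Tmap.
Context {M N : atlas_space R}.
Hypotheses (hM : premanifold M) (hN : premanifold N).
Variable J : M -> N.
Hypothesis sJ : smooth_pullback J.

Lemma tmapE x (v : tangent x) g : smooth_fun g -> tval (tmap J v) g = tval v (g \o J).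
Proof.
move=> sg; rewrite /tmap; apply: (@xgetPex _ 0 [set w : tangent (J x) |
  forall g, smooth_fun g -> tval w g = tval v (g \o J)]) => //.
apply: (@tangent_ex _ _ (J x) (fun g => tval v (g \o J))) => //.
- move=> a f h sf sh; have [_ vD _] := tvalP v.
  by have := vD a (f \o J) (h \o J) (sJ sf) (sJ sh).
- by move=> f h sf sh; have := tvalM v (sJ sf) (sJ sh).
Qed.

Lemma tmap_linear x (a : R) (u v : tangent x) :
  tmap J (a *: u + v) = a *: tmap J u + tmap J v.
Proof.
by apply: tval_ext => f sf; rewrite tval_lin !tmapE // tval_lin.
Qed.

Lemma velocity_tmap gam t x (v : tangent x) : velocity gam t v ->
  velocity (J \o gam) t (tmap J v).
Proof.
move=> [gx dg]; split => [|f sf]; first by rewrite /= gx.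
by rewrite tmapE //; exact: (dg _ (sJ sf)).
Qed.

End Tmap.

Section Product.
Context {M N : atlas_space R}.
Hypotheses (hM : premanifold M) (hN : premanifold N).
Let P := prod_manifold M N.

Lemma continuous_lsubmx (n m : nat) : continuous (fun y : 'rV[R]_(n + m) => lsubmx y : 'rV[R]_n).
Proof.
move=> y; apply: rV_continuous => j.
rewrite (_ : (fun y => _) = fun y : 'rV[R]_(n + m) => y 0 (lshift m j)).
  exact: coord_continuous.
by apply/funext => z; rewrite mxE.
Qed.

Lemma continuous_rsubmx (n m : nat) : continuous (fun y : 'rV[R]_(n + m) => rsubmx y : 'rV[R]_m).
Proof.
move=> y; apply: rV_continuous => j.
rewrite (_ : (fun y => _) = fun y : 'rV[R]_(n + m) => y 0 (rshift n j)).
  exact: coord_continuous.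
by apply/funext => z; rewrite mxE.
Qed.

Lemma prod_chart_is_chart c d : is_chart c -> is_chart d ->
  is_chart (prod_chart c d : chart R P (dim P)).
Proof.
move=> [oc omc ck cc ci] [od omd dk dc di].
have E : cmap (prod_chart c d) @` cdom (prod_chart c d) =
   (fun y => lsubmx y : 'rV[R]_(dim M)) @^-1` (cmap c @` cdom c) `&`
   (fun y => rsubmx y : 'rV[R]_(dim N)) @^-1` (cmap d @` cdom d).
  apply/seteqP; split => [_ [[x y] [/= cx dy] <-]|z [[x cx xE] [y dy yE]]].
    by split; rewrite /= ?row_mxKl ?row_mxKr; [exists x|exists y].
  by exists (x, y) => //=; rewrite xE yE hsubmxK.
split.
- by apply: open_setX.
- rewrite E; apply: openI; apply: open_comp => // y _.
    exact: continuous_lsubmx.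
  exact: continuous_rsubmx.
- by move=> [x y] [/= cx dy]; rewrite row_mxKl row_mxKr ck // dk.
- move=> [x y] [/= cx dy]; apply: rV_continuous => j.
  rewrite /=; case: (split_ordP j) => k ->.
    have -> : (fun p : M * N => (row_mx (cmap c p.1) (cmap d p.2) : 'rV[R]_(dim M + dim N))
        0 (lshift _ k)) = (fun p => cmap c p.1 0 k).
      by apply/funext => p; rewrite row_mxEl.
    apply: (@continuous_comp _ _ _ (fun p : M * N => p.1) (fun q => cmap c q 0 k)).
      exact: cvg_fst.
    apply: (@continuous_comp _ _ _ (cmap c) (fun z : 'rV[R]_(dim M) => z 0 k)).
      exact: cc.
    exact: coord_continuous.
  have -> : (fun p : M * N => (row_mx (cmap c p.1) (cmap d p.2) : 'rV[R]_(dim M + dim N))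
      0 (rshift _ k)) = (fun p => cmap d p.2 0 k).
    by apply/funext => p; rewrite row_mxEr.
  apply: (@continuous_comp _ _ _ (fun p : M * N => p.2) (fun q => cmap d q 0 k)).
    exact: cvg_snd.
  apply: (@continuous_comp _ _ _ (cmap d) (fun z : 'rV[R]_(dim N) => z 0 k)).
    exact: dc.
  exact: coord_continuous.
- rewrite E => y [cy dy] W [[A B] /= [nA nB] AB].
  have n1 : \forall z \near y, A (cinv c (lsubmx z)).
    apply: (@near_comp _ _ (fun z => lsubmx z : 'rV[R]_(dim M)) y (fun z => A (cinv c z))).
      exact: continuous_lsubmx.
    exact: (ci _ cy).
  have n2 : \forall z \near y, B (cinv d (rsubmx z)).
    apply: (@near_comp _ _ (fun z => rsubmx z : 'rV[R]_(dim N)) y (fun z => B (cinv d z))).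
      exact: continuous_rsubmx.
    exact: (di _ dy).
  suff : \forall z \near y, W (cinv c (lsubmx z), cinv d (rsubmx z)) by [].
  by apply: filterS2 n1 n2 => z Az Bz; exact: AB.
Qed.

Lemma smooth_near_lsubmx n m (f : 'rV[R]_n -> R) (y : 'rV[R]_(n + m)) :
  smooth_near f (lsubmx y) -> smooth_near (fun z : 'rV[R]_(n + m) => f (lsubmx z)) y.
Proof.
move=> sf; apply: (@smooth_near_comp _ _ _ (fun z : 'rV[R]_(n + m) => lsubmx z) f) => // j.
have <- : (fun z : 'rV[R]_(n + m) => z 0 (lshift m j)) = (fun z => lsubmx z 0 j).
  by apply/funext => z; rewrite mxE.
exact: smooth_near_coord.
Qed.

Lemma smooth_near_rsubmx n m (f : 'rV[R]_m -> R) (y : 'rV[R]_(n + m)) :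
  smooth_near f (rsubmx y) -> smooth_near (fun z : 'rV[R]_(n + m) => f (rsubmx z)) y.
Proof.
move=> sf; apply: (@smooth_near_comp _ _ _ (fun z : 'rV[R]_(n + m) => rsubmx z) f) => // j.
have <- : (fun z : 'rV[R]_(n + m) => z 0 (rshift n j)) = (fun z => rsubmx z 0 j).
  by apply/funext => z; rewrite mxE.
exact: smooth_near_coord.
Qed.

Lemma prod_premanifold : premanifold P.
Proof.
have [hausM _ _ _] := hM; have [hausN _ _ _] := hN.
split.
- rewrite !open_hausdorff in hausM hausN *.
  move=> [x y] [x' y']; have [<-|xx'] := eqVneq x x'.
    rewrite xpair_eqE eqxx /= => /hausN[[A B] /= [A1 B1] [oA oB AB]].
    exists (setT `*` A, setT `*` B) => /=.
      by rewrite !inE in A1 B1 *.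
    split; [by apply: open_setX => //; exact: openT..|].
    apply/eqP/seteqP; split => // -[p q] [[_ Aq] [_ Bq]] /=.
    by move/eqP/seteqP: AB => [AB _]; exact: (AB q).
  move=> _; have /hausM[[A B] /= [A1 B1] [oA oB AB]] := xx'.
  exists (A `*` setT, B `*` setT) => /=.
    by rewrite !inE in A1 B1 *.
  split; [by apply: open_setX => //; exact: openT..|].
  apply/eqP/seteqP; split => // -[p q] [[Aq _] [Bq _]] /=.
  by move/eqP/seteqP: AB => [AB _]; exact: (AB p).
- move=> _ [c [d [ac ad ->]]].
  by apply: prod_chart_is_chart; [exact: (atlas_chart hM)|exact: (atlas_chart hN)].
- move=> [x y]; have [c ac cx] := chart_at hM x; have [d ad dy] := chart_at hN y.
  by exists (prod_chart c d) => //; exists c, d.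
- move=> _ _ [c [d [ac ad ->]]] [c' [d' [ac' ad' ->]]] j.
  apply: Cinfty_near => _ [[x y] [/= [cx dy] [cx' dy']] <-].
  case: (split_ordP j) => k -> /=.
    under eq_fun do rewrite row_mxEl.
    apply: (@smooth_near_lsubmx _ _ (fun z => cmap c' (cinv c z) 0 k)).
    rewrite row_mxKl; have := smooth_at_chart hM (smooth_at_coord k hM ac' cx') ac cx.
    exact.
  under eq_fun do rewrite row_mxEr.
  apply: (@smooth_near_rsubmx _ _ (fun z => cmap d' (cinv d z) 0 k)).
  rewrite row_mxKr; have := smooth_at_chart hN (smooth_at_coord k hN ad' dy') ad dy.
  exact.
Qed.

Lemma smooth_pullback_fst : @smooth_pullback P M (fun p => p.1).
Proof.
move=> f /(smooth_funP hM) sf; apply/(smooth_funP prod_premanifold) => -[x y].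
have [c ac cx] := chart_at hM x; have [d ad dy] := chart_at hN y.
exists (prod_chart c d); split => //; first by exists c, d.
apply: (@smooth_near_lsubmx _ _ (f \o cinv c)).
by rewrite /= row_mxKl; exact: smooth_at_chart.
Qed.

Lemma smooth_pullback_snd : @smooth_pullback P N (fun p => p.2).
Proof.
move=> f /(smooth_funP hN) sf; apply/(smooth_funP prod_premanifold) => -[x y].
have [c ac cx] := chart_at hM x; have [d ad dy] := chart_at hN y.
exists (prod_chart c d); split => //; first by exists c, d.
apply: (@smooth_near_rsubmx _ _ (f \o cinv d)).
by rewrite /= row_mxKr; exact: smooth_at_chart.
Qed.

(** A smooth function on a product is not built from functions of the factors, so this case goes
    through a product chart. *)
Lemma smooth_pullback_pair Q (J : Q -> M) (K : Q -> N) : premanifold Q ->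
  smooth_pullback J -> smooth_pullback K ->
  @smooth_pullback Q P (fun q => (J q, K q)).
Proof.
move=> hQ sJ sK f /(smooth_funP prod_premanifold) sf; apply/(smooth_funP hQ) => q.
have [c ac cx] := chart_at hM (J q); have [d ad dy] := chart_at hN (K q).
have [e ae eq] := chart_at hQ q; exists e; split => //.
pose g y : 'rV[R]_(dim P) := row_mx (cmap c (J (cinv e y))) (cmap d (K (cinv e y))).
have cJ := @smooth_pullback_continuous _ _ J hQ hM sJ q.
have cK := @smooth_pullback_continuous _ _ K hQ hN sK q.
have nJ : \forall z \near cmap e q, cdom c (J (cinv e z)).
  apply: (near_cinv hQ ae eq (P := fun z => cdom c (J z))).
  by apply: (near_comp cJ); exact: near_cdom.
have nK : \forall z \near cmap e q, cdom d (K (cinv e z)).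
  apply: (near_cinv hQ ae eq (P := fun z => cdom d (K z))).
  by apply: (near_comp cK); exact: near_cdom.
apply: (@smooth_near_eq _ _ ((f \o cinv (prod_chart c d)) \o g)).
  apply: filterS2 nJ nK => z cz dz.
  by rewrite /= /g row_mxKl row_mxKr (cmapK hM) // (cmapK hN).
apply: smooth_near_comp; last first.
  have -> : g (cmap e q) = cmap (prod_chart c d) (J q, K q).
    by rewrite /g (cmapK hQ).
  by apply: (smooth_at_chart prod_premanifold) => //; exists c, d.
move=> j; case: (split_ordP j) => k ->.
  have -> : (fun z => g z 0 (lshift _ k)) = ((fun q => cmap c q 0 k) \o J) \o cinv e.
    by apply/funext => z; rewrite /g row_mxEl.
  apply: smooth_at_chart => //; apply: smooth_pullback_at => //.
  exact: smooth_at_coord.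
have -> : (fun z => g z 0 (rshift _ k)) = ((fun q => cmap d q 0 k) \o K) \o cinv e.
  by apply/funext => z; rewrite /g row_mxEr.
apply: smooth_at_chart => //; apply: smooth_pullback_at => //.
exact: smooth_at_coord.
Qed.

End Product.
End SmoothMaps.

(** * Differential forms and bivectors *)

Section Bilinear.
Context {R : realType} {n : nat}.
Implicit Types (p q r : 'I_n -> R) (b : 'I_n -> 'I_n -> R).

Definition bil b p q := \sum_i \sum_j p i * q j * b i j.

Lemma bilB b p p' q : bil b (fun i => p i - p' i) q = bil b p q - bil b p' q.
Proof.
rewrite /bil -sumrB; apply: eq_bigr => i _; rewrite -sumrB; apply: eq_bigr => j _.
by rewrite !mulrBl.
Qed.

Lemma bil_anti b p q : (forall i j, b i j = - b j i) -> bil b p q = - bil b q p.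
Proof.
move=> ba; rewrite /bil exchange_big /= -sumrN; apply: eq_bigr => i _.
by rewrite -sumrN; apply: eq_bigr => j _; rewrite ba mulrN (mulrC (p j)).
Qed.

(** Here [e k i j] stands for the derivative of the coefficient [b i j] along the k-th coordinate
    field. The hypothesis is closedness on coordinate fields, and the conclusion is its contraction
    with three vectors. *)
Lemma bil_cyclic (e : 'I_n -> 'I_n -> 'I_n -> R) p q r :
  (forall i j k, e i j k - e j i k + e k i j = 0) ->
  bil (fun i j => \sum_k p k * e k i j) q r
  - bil (fun i j => \sum_k q k * e k i j) p r
  + bil (fun i j => \sum_k r k * e k i j) p q = 0.
Proof.
move=> E.
have -> : bil (fun i j => \sum_k p k * e k i j) q r =
    \sum_i \sum_j \sum_k p i * q j * r k * e i j k.
  rewrite /bil; transitivity (\sum_j \sum_k \sum_i p i * q j * r k * e i j k).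
    apply: eq_bigr => j _; apply: eq_bigr => k _; rewrite mulr_sumr.
    by apply: eq_bigr => i _; ring.
  under eq_bigr do rewrite exchange_big /=.
  by rewrite exchange_big.
have -> : bil (fun i j => \sum_k q k * e k i j) p r =
    \sum_i \sum_j \sum_k p i * q j * r k * e j i k.
  rewrite /bil; apply: eq_bigr => i _; rewrite [RHS]exchange_big /=.
  by apply: eq_bigr => k _; rewrite mulr_sumr; apply: eq_bigr => j _; ring.
have -> : bil (fun i j => \sum_k r k * e k i j) p q =
    \sum_i \sum_j \sum_k p i * q j * r k * e k i j.
  rewrite /bil; apply: eq_bigr => i _; apply: eq_bigr => j _.
  by rewrite mulr_sumr; apply: eq_bigr => k _; ring.
rewrite -sumrB -big_split /=; apply: big1 => i _.
rewrite -sumrB -big_split /=; apply: big1 => j _.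
rewrite -sumrB -big_split /=; apply: big1 => k _.
by rewrite -mulrBr -mulrDr E mulr0.
Qed.

End Bilinear.

Section Forms.
Context {R : realType}.
Implicit Types M N : atlas_space R.

Section OneForm.
Context {M : atlas_space R} (B : form2 M).
Hypothesis hB : is_form2 B.

Lemma form_lin_l x a (u v w : tangent x) : B (a *: u + v) w = a * B u w + B v w.
Proof. by have [H _ _ _] := hB; exact: H. Qed.

Lemma form_lin_r x a (u v w : tangent x) : B w (a *: u + v) = a * B w u + B w v.
Proof. by have [_ H _ _] := hB; exact: H. Qed.

Lemma form_alt x (v : tangent x) : B v v = 0.
Proof. by have [_ _ H _] := hB; exact: H. Qed.

Lemma form_Dl x (u v w : tangent x) : B (u + v) w = B u w + B v w.
Proof. by have := form_lin_l 1 u v w; rewrite scale1r mul1r. Qed.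

Lemma form_Dr x (u v w : tangent x) : B w (u + v) = B w u + B w v.
Proof. by have := form_lin_r 1 u v w; rewrite scale1r mul1r. Qed.

Lemma form_0l x (w : tangent x) : B 0 w = 0.
Proof. by have := form_Dl 0 0 w; rewrite addr0 => H; lra. Qed.

Lemma form_0r x (w : tangent x) : B w 0 = 0.
Proof. by have := form_Dr 0 0 w; rewrite addr0 => H; lra. Qed.

Lemma form_Zl x a (u w : tangent x) : B (a *: u) w = a * B u w.
Proof. by have := form_lin_l a u 0 w; rewrite form_0l !addr0. Qed.

Lemma form_Zr x a (u w : tangent x) : B w (a *: u) = a * B w u.
Proof. by have := form_lin_r a u 0 w; rewrite form_0r !addr0. Qed.

Lemma form_Nl x (u w : tangent x) : B (- u) w = - B u w.
Proof. by rewrite -scaleN1r form_Zl mulN1r. Qed.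

Lemma form_anti x (u v : tangent x) : B u v = - B v u.
Proof.
have := form_alt (u + v); rewrite form_Dl !form_Dr !form_alt => H; lra.
Qed.

Lemma form_suml x n (a : 'I_n -> R) (u : 'I_n -> tangent x) w :
  B (\sum_i a i *: u i) w = \sum_i a i * B (u i) w.
Proof.
elim: n a u => [|n IH] a u; first by rewrite !big_ord0 form_0l.
by rewrite !big_ord_recl form_lin_l IH.
Qed.

Lemma form_sumr x n (a : 'I_n -> R) (u : 'I_n -> tangent x) w :
  B w (\sum_i a i *: u i) = \sum_i a i * B w (u i).
Proof.
elim: n a u => [|n IH] a u; first by rewrite !big_ord0 form_0r.
by rewrite !big_ord_recl form_lin_r IH.
Qed.

Lemma form_smooth X Y : smooth_vfield X -> smooth_vfield Y -> smooth_fun (feval B X Y).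
Proof. by have [_ _ _ H] := hB; exact: H. Qed.

Lemma form_frame x0 c y E V q (v w : tangent q) : local_frame x0 c y E V -> V q ->
  B v w = bil (fun i j => B (E i q) (E j q)) (fun i => tval v (y i)) (fun i => tval w (y i)).
Proof.
move=> H Vq; rewrite {1}(lf_span H v Vq) {1}(lf_span H w Vq) form_suml /bil.
apply: eq_bigr => i _; rewrite form_sumr mulr_sumr; apply: eq_bigr => j _.
by rewrite mulrA.
Qed.

End OneForm.

Lemma lie_bracketE M (hM : premanifold M) (X Y : vfield M) x f :
  smooth_vfield X -> smooth_vfield Y -> smooth_fun f ->
  tval (lie_bracket X Y x) f = vapply X (vapply Y f) x - vapply Y (vapply X f) x.
Proof.
move=> sX sY sf; rewrite /lie_bracket; apply: (@xgetPex _ 0 [set w : tangent x |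
  forall f, smooth_fun f ->
    tval w f = vapply X (vapply Y f) x - vapply Y (vapply X f) x]) => //.
apply: (@tangent_ex _ _ x (fun f => vapply X (vapply Y f) x - vapply Y (vapply X f) x)) => //.
- move=> a g h sg sh.
  have H Z : vapply Z (fun y => a * g y + h y) = fun y => a * vapply Z g y + vapply Z h y.
    by apply/funext => y; have [_ vD _] := tvalP (Z y); exact: vD.
  have VD Z p q : smooth_fun p -> smooth_fun q ->
      vapply Z (fun y => a * p y + q y) x = a * vapply Z p x + vapply Z q x.
    by move=> sp sq; have [_ vD _] := tvalP (Z x); exact: vD.
  by rewrite !H !VD; try by [apply: sX|apply: sY]; ring.
- move=> g h sg sh.
  have H Z : vapply Z (fun y => g y * h y) = fun y => g y * vapply Z h y + h y * vapply Z g y.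
    by apply/funext => y; exact: tvalM.
  have S (g' h' : M -> R) (Z : vfield M) : smooth_fun g' -> smooth_fun h' -> smooth_vfield Z ->
     smooth_fun (fun y => g' y * vapply Z h' y).
    by move=> sg' sh' sZ; apply: smooth_funM => //; exact: sZ.
  have VM Z W : smooth_vfield W -> vapply Z (fun y => g y * vapply W h y + h y * vapply W g y) x =
      g x * vapply Z (vapply W h) x + vapply W h x * vapply Z g x +
      (h x * vapply Z (vapply W g) x + vapply W g x * vapply Z h x).
    move=> sW; rewrite {1}/vapply tvalD ?tvalM //; try by [apply: S|apply: sW].
  by rewrite !H !VM //; ring.
Qed.

(** * Pull back of closed 2-forms *)

Section Pullback.
Context {M N : atlas_space R} (J : N -> M) (B : form2 M).
Hypotheses (hM : premanifold M) (hN : premanifold N) (sJ : smooth_pullback J).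
Hypothesis (cB : closed_form2 B).
Let hB : is_form2 B. Proof. by case: cB. Qed.

Section local.
Variables (x0 : M) (c : chart R M (dim M)) (y : 'I_(dim M) -> M -> R)
  (E : 'I_(dim M) -> vfield M) (V : set M).
Hypothesis H : local_frame x0 c y E V.
Let u i := y i \o J.
Let b i j := feval B (E i) (E j).
(** The pull back evaluated on [X] and [Y], in coordinates. As the frame is global, this is smooth
    on all of [N]; it is the pull back only over [V]. *)
Let S (X Y : vfield N) g :=
  bil (fun i j => b i j (J g)) (fun i => vapply X (u i) g) (fun i => vapply Y (u i) g).

Let su i : smooth_fun (u i). Proof. exact: sJ (lf_smooth H i). Qed.
Let sb i j : smooth_fun (b i j).
Proof. by apply: form_smooth => //; exact: lf_vfield H _. Qed.

Lemma pullback_frame g (v w : tangent g) : V (J g) ->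
  pullback J B v w = bil (fun i j => b i j (J g)) (fun i => tval v (u i)) (fun i => tval w (u i)).
Proof.
move=> VJ; rewrite /pullback (form_frame hB _ _ H VJ).
by congr bil; apply/funext => i; rewrite (tmapE hM sJ) //; exact: lf_smooth H i.
Qed.

Let sS X Y : smooth_vfield X -> smooth_vfield Y -> smooth_fun (S X Y).
Proof.
move=> sX sY; rewrite /S /bil; apply: smooth_fun_sum => // i; apply: smooth_fun_sum => // j.
apply: smooth_funM => //; last exact: sJ (sb i j).
by apply: smooth_funM => //; [exact: sX|exact: sY].
Qed.

Let near_S X Y g : V (J g) -> \forall h \near g, S X Y h = feval (pullback J B) X Y h.
Proof.
move=> VJ; have cJ : {for g, continuous J} := @smooth_pullback_continuous _ _ _ J hN hM sJ g.
apply: filterS (near_comp cJ (open_near (lf_open H) VJ)) => h Vh.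
by rewrite /feval pullback_frame.
Qed.

Lemma pullback_smooth_at X Y g : smooth_vfield X -> smooth_vfield Y -> V (J g) ->
  smooth_at (feval (pullback J B) X Y) g.
Proof.
move=> sX sY VJ; apply: (smooth_at_eq hN (near_S X Y VJ)).
exact: ((smooth_funP hN _).1 (sS sX sY) g).
Qed.

Let db k i j q := tval (E k q) (b i j).

Let db_closed i j k q : V q -> db i j k q - db j i k q + db k i j q = 0.
Proof.
move=> Vq; have [_ dB0] := cB.
have := dB0 (E i) (E j) (E k) (lf_vfield H i) (lf_vfield H j) (lf_vfield H k) q.
(* Coordinate fields commute: the derivatives of the coordinates along them are constant near [q].
   Only the three derivatives of coefficients remain. *)
have br l m : lie_bracket (E l) (E m) q = 0.
  apply: (lf_tangent_eq H Vq) => p.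
  rewrite (lie_bracketE hM) ?tval0; [|exact: lf_vfield H _|exact: lf_vfield H _|exact: lf_smooth H _].
  have Z l' m' : vapply (E l') (vapply (E m') (y p)) q = 0.
    rewrite /vapply -[RHS](tval_cst hM (E l' q) (m' == p)%:R); apply: (tval_near hM).
    - exact: (lf_vfield H m') (lf_smooth H p).
    - exact: smooth_fun_cst.
    by apply: filterS (open_near (lf_open H) Vq) => z Vz; exact: lf_dual H Vz.
  by rewrite !Z subrr.
by rewrite /ext_derivative /feval !br !form_0l // !subr0 addr0.
Qed.

(** The fields on [N] need not project to [M], so naturality of the exterior derivative is checked
    by expansion in the frame. Second derivatives of the [u i] cancel against the brackets, and the
    derivatives of the coefficients cancel by [bil_cyclic]. *)
Lemma pullback_closed_at X Y Z g : smooth_vfield X -> smooth_vfield Y ->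
  smooth_vfield Z -> is_form2 (pullback J B) -> V (J g) ->
  ext_derivative (pullback J B) X Y Z g = 0.
Proof.
move=> sX sY sZ hJB VJ.
have D (X' Y' Z' : vfield N) : smooth_vfield X' -> smooth_vfield Y' -> smooth_vfield Z' ->
  vapply X' (feval (pullback J B) Y' Z') g =
   bil (fun i j => b i j (J g)) (fun i => vapply X' (vapply Y' (u i)) g)
      (fun i => vapply Z' (u i) g)
 + bil (fun i j => b i j (J g)) (fun i => vapply Y' (u i) g)
      (fun i => vapply X' (vapply Z' (u i)) g)
 + bil (fun i j => \sum_k vapply X' (u k) g * db k i j (J g))
      (fun i => vapply Y' (u i) g) (fun i => vapply Z' (u i) g).
  move=> sX' sY' sZ'.
  have -> : vapply X' (feval (pullback J B) Y' Z') g = tval (X' g) (S Y' Z').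
    apply: (tval_near hN).
    - exact: form_smooth.
    - exact: sS.
    - by apply: filterS (near_S Y' Z' VJ) => h ->.
  have sY'u i : smooth_fun (vapply Y' (u i)) := sY' _ (su i).
  have sZ'u i : smooth_fun (vapply Z' (u i)) := sZ' _ (su i).
  have sYZ i j : smooth_fun (fun h => vapply Y' (u i) h * vapply Z' (u j) h).
    exact: smooth_funM.
  have sbJ i j : smooth_fun (fun h => b i j (J h)) := sJ (sb i j).
  have st i j : smooth_fun (fun h => vapply Y' (u i) h * vapply Z' (u j) h * b i j (J h)).
    exact: smooth_funM.
  rewrite /S /bil tval_sum //; last by move=> i; exact: smooth_fun_sum.
  rewrite -!big_split /=; apply: eq_bigr => i _; rewrite tval_sum //.
  rewrite -!big_split /=; apply: eq_bigr => j _; rewrite tvalM // tvalM //.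
  have -> : tval (X' g) (fun h => b i j (J h)) = \sum_k vapply X' (u k) g * db k i j (J g).
    rewrite -(tmapE hM sJ (X' g) (sb i j)) {1}(lf_span H (tmap J (X' g)) VJ) tval_sumv.
    apply: eq_bigr => k _; rewrite tvalZv (tmapE hM sJ) //; exact: lf_smooth H k.
  rewrite -!/(vapply _ _ _); ring.
have L (X' Y' Z' : vfield N) : smooth_vfield X' -> smooth_vfield Y' ->
  feval (pullback J B) (lie_bracket X' Y') Z' g =
  bil (fun i j => b i j (J g)) (fun i => vapply X' (vapply Y' (u i)) g -
     vapply Y' (vapply X' (u i)) g) (fun i => vapply Z' (u i) g).
  move=> sX' sY'; rewrite /feval pullback_frame //.
  by congr bil; apply/funext => i; rewrite (lie_bracketE hN).
rewrite /ext_derivative !D // !L // !bilB.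
have ba i j : b i j (J g) = - b j i (J g) by rewrite /b /feval form_anti.
have A := bil_anti _ _ ba.
rewrite (A (fun i => vapply Y (u i) g) (fun i => vapply X (vapply Z (u i)) g)).
rewrite (A (fun i => vapply X (u i) g) (fun i => vapply Y (vapply Z (u i)) g)).
rewrite (A (fun i => vapply X (u i) g) (fun i => vapply Z (vapply Y (u i)) g)).
have := @bil_cyclic R _ (fun i j k => db i j k (J g)) (fun i => vapply X (u i) g)
  (fun i => vapply Y (u i) g) (fun i => vapply Z (u i) g)
  (fun i j k => db_closed i j k VJ).
move=> C; lra.
Qed.

End local.

Lemma pullback_form2 : is_form2 (pullback J B).
Proof.
split.
- by move=> g a v w z; rewrite /pullback (tmap_linear hM sJ) form_lin_l.
- by move=> g a v w z; rewrite /pullback (tmap_linear hM sJ) form_lin_r.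
- by move=> g v; rewrite /pullback form_alt.
- move=> X Y sX sY; apply/(smooth_funP hN) => g.
  have [c [y [E [V H]]]] := frame_ex hM (J g).
  exact: pullback_smooth_at H _ _ _ sX sY (lf_in H).
Qed.

Lemma pullback_closed : closed_form2 (pullback J B).
Proof.
split; first exact: pullback_form2.
move=> X Y Z sX sY sZ g; have [c [y [E [V H]]]] := frame_ex hM (J g).
exact: (pullback_closed_at H sX sY sZ pullback_form2 (lf_in H)).
Qed.

End Pullback.

Lemma form_sub_closed M (hM : premanifold M) (A B : form2 M) :
  closed_form2 A -> closed_form2 B -> closed_form2 (form_sub A B).
Proof.
move=> [hA dA] [hB dB]; split.
  split.
  - by move=> x a u v w; rewrite /form_sub !form_lin_l //; ring.
  - by move=> x a u v w; rewrite /form_sub !form_lin_r //; ring.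
  - by move=> x v; rewrite /form_sub !form_alt // subrr.
  - move=> X Y sX sY.
    have -> : feval (form_sub A B) X Y = fun x => feval A X Y x + -1 * feval B X Y x.
      by apply/funext => x; rewrite mulN1r.
    apply: smooth_funD => //; first exact: form_smooth.
    apply: smooth_funM => //; [exact: smooth_fun_cst|exact: form_smooth].
move=> X Y Z sX sY sZ x.
have E (X' Y' Z' : vfield M) : smooth_vfield Y' -> smooth_vfield Z' ->
   vapply X' (feval (form_sub A B) Y' Z') x =
   vapply X' (feval A Y' Z') x - vapply X' (feval B Y' Z') x.
  move=> sY' sZ'.
  have -> : feval (form_sub A B) Y' Z' = fun x => feval A Y' Z' x + -1 * feval B Y' Z' x.
    by apply/funext => z; rewrite mulN1r.
  have sA := form_smooth hA sY' sZ'; have sB := form_smooth hB sY' sZ'.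
  rewrite {1}/vapply tvalD //; last by apply: smooth_funM => //; exact: smooth_fun_cst.
  by rewrite tvalZ // mulN1r.
have := dA X Y Z sX sY sZ x; have := dB X Y Z sX sY sZ x.
rewrite /ext_derivative !E // /feval /form_sub => h1 h2.
rewrite -[RHS](subrr 0) -{1}h2 -h1; ring.
Qed.

End Forms.

(** * Orthogonals of kernels, in matrices *)

Section OrthogonalRanks.
Context {F : fieldType} {n m : nat}.
Variables (A : 'M[F]_n) (a b : 'M[F]_(n, m)).
Hypotheses (uA : A \in unitmx) (fa : row_full a) (fb : row_full b).

Let Kb := kermx b.
(** The orthogonal of the kernel of [b] for the form [u *m A *m v^T], vectors being rows. As [A] is
    invertible, its rank is complementary to that of the kernel. *)
Let Ob := kermx (A *m Kb^T).

Let rank_ker (c : 'M[F]_(n, m)) : row_full c -> \rank (kermx c) = (n - m)%N.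
Proof. by move=> /eqP fc; rewrite mxrank_ker fc. Qed.

Let rank_Ob : \rank Ob = (n - (n - m))%N.
Proof.
rewrite mxrank_ker; congr (_ - _)%N.
have -> : \rank (A *m Kb^T) = \rank Kb^T.
  have fA : row_full A by rewrite row_full_unit.
  by rewrite (eqmxMfull Kb^T fA).
by rewrite mxrank_tr rank_ker.
Qed.

Let le_mn : (m <= n)%N.
Proof. by have /eqP <- := fa; exact: rank_leq_row. Qed.

Let in_Ob (u : 'rV[F]_n) : (u <= Ob)%MS <->
  forall v : 'rV[F]_n, v *m b = 0 -> u *m A *m v^T = 0.
Proof.
split=> [/sub_kermxP uO v vb|H].
  have /submxP[w ->] : (v <= Kb)%MS by apply/sub_kermxP.
  by rewrite trmx_mul mulmxA -(mulmxA u) uO mul0mx.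
apply/sub_kermxP; rewrite mulmxA; apply/matrixP => i j.
have := H (row j Kb); rewrite -row_mul mulmx_ker row0 => /(_ erefl).
move=> /matrixP/(_ i 0); rewrite !mxE => E; rewrite -[RHS]E.
by apply: eq_bigr => k _; rewrite !mxE.
Qed.

(** The kernel of [a], of rank [n - m], lies in [Ob], of rank [n - (n - m) = m]. *)
Lemma isotropic_kernels_dim :
  (forall u v : 'rV[F]_n, u *m a = 0 -> v *m b = 0 -> u *m A *m v^T = 0) ->
  (n - m <= m)%N.
Proof.
move=> H; have : (kermx a <= Ob)%MS.
  by apply/row_subP => i; apply/in_Ob => v; apply: H; rewrite -row_mul mulmx_ker row0.
by move=> /mxrankS; rewrite rank_ker // rank_Ob subKn.
Qed.

(** Now [Ob], of rank [m], lies in the kernel of [a], of rank [n - m <= m]; the inclusion is an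
    equality. *)
Lemma coisotropic_kernels : (n - m <= m)%N ->
  (forall u : 'rV[F]_n, (forall v : 'rV[F]_n, v *m b = 0 -> u *m A *m v^T = 0) ->
     u *m a = 0) ->
  forall u v : 'rV[F]_n, u *m a = 0 -> v *m b = 0 -> u *m A *m v^T = 0.
Proof.
move=> nm H u v ua.
have sub : (Ob <= kermx a)%MS.
  by apply/row_subP => i; apply/sub_kermxP; apply: H; apply/in_Ob; exact: row_sub.
have ka : (kermx a <= Ob)%MS.
  by rewrite -(geq_leqif (mxrank_leqif_sup sub)) rank_ker // rank_Ob subKn.
apply: (in_Ob u).1; apply: submx_trans ka; exact/sub_kermxP.
Qed.

End OrthogonalRanks.

(** * The inverse of a nondegenerate 2-form *)

Section Sharp.
Context {R : realType} {M : atlas_space R}.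
Hypothesis hM : premanifold M.

Lemma smooth_at_sumr (I : Type) (r : seq I) (P : pred I) (F : I -> M -> R) x :
  (forall i, smooth_at (F i) x) -> smooth_at (fun y => \sum_(i <- r | P i) F i y) x.
Proof.
move=> sF; elim: r => [|i r IH].
  by under eq_fun do rewrite big_nil; exact: smooth_at_cst.
under eq_fun do rewrite big_cons.
by case: (P i) => //; exact: smooth_atD.
Qed.

Lemma smooth_at_prodr (I : Type) (r : seq I) (P : pred I) (F : I -> M -> R) x :
  (forall i, smooth_at (F i) x) -> smooth_at (fun y => \prod_(i <- r | P i) F i y) x.
Proof.
move=> sF; elim: r => [|i r IH].
  by under eq_fun do rewrite big_nil; exact: smooth_at_cst.
under eq_fun do rewrite big_cons.
by case: (P i) => //; exact: smooth_atM.
Qed.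

Lemma smooth_at_det n (A : M -> 'M[R]_n) x :
  (forall i j, smooth_at (fun y => A y i j) x) -> smooth_at (fun y => \det (A y)) x.
Proof.
move=> sA; apply: smooth_at_sumr => s; apply: smooth_atM => //.
  exact: smooth_at_cst.
exact: smooth_at_prodr.
Qed.

(** Cofactor formula: the entries of the inverse are polynomials in those of [A] divided by the
    determinant. *)
Lemma smooth_at_invmx n (A : M -> 'M[R]_n) x i j : (\forall y \near x, A y \in unitmx) ->
  (forall i j, smooth_at (fun y => A y i j) x) ->
  smooth_at (fun y => invmx (A y) i j) x.
Proof.
move=> uA sA.
apply: (@smooth_at_eq _ _ hM (fun y => (\det (A y))^-1 * ((-1) ^+ (j + i) * \det (row' j (col' i (A y)))))).
  by apply: filterS uA => y uy; rewrite /invmx uy !mxE.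
apply: smooth_atM => //.
  apply: (smooth_atV hM (smooth_at_det sA)).
  by have := nbhs_singleton uA; rewrite unitmxE unitfE.
apply: smooth_atM => //; first exact: smooth_at_cst.
apply: smooth_at_det => k l.
rewrite (_ : (fun y => _) = fun y => A y (lift j k) (lift i l)) //.
by apply/funext => y; rewrite !mxE.
Qed.

Lemma cotangent_frame x0 c y E V (q : M) (eta : cotangent q) (w : tangent q) :
  local_frame x0 c y E V -> V q -> eta w = \sum_i tval w (y i) * eta (E i q).
Proof.
move=> H Vq; rewrite {1}(lf_span H w Vq) linear_sum; apply: eq_bigr => i _.
by rewrite linearZ.
Qed.

(** A combination of the frame coordinates with constant coefficients. Poisson maps are defined by
    functions; this makes their property available for single covectors. *)
Lemma cotangent_differential (x : M) (eta : cotangent x) :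
  exists2 f : M -> R, smooth_fun f & forall w, eta w = tval w f.
Proof.
have [c [y [E [V H]]]] := frame_ex hM x; have Vx := lf_in H.
exists (fun z => \sum_i eta (E i x) * y i z).
  apply: smooth_fun_sum => // i; apply: smooth_funM => //; last exact: lf_smooth H i.
  exact: smooth_fun_cst.
move=> w; rewrite (cotangent_frame eta w H Vx) tval_sum //; last first.
  by move=> i; apply: smooth_funM => //; [exact: smooth_fun_cst|exact: lf_smooth H i].
by apply: eq_bigr => i _; rewrite (@tvalZ _ _ hM _ w _ _ (lf_smooth H i)); exact: mulrC.
Qed.

Lemma cotangent_ex (x : M) (f : tangent x -> R) :
  (forall (a : R) u v, f (a *: u + v) = a * f u + f v) ->
  exists eta : cotangent x, forall w, eta w = f w.
Proof.
move=> lf; have lin : linear (f : tangent x -> R^o) by move=> a u v; rewrite lf.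
pose fM := GRing.isLinear.Build R (tangent x) R^o *:%R f lin.
pose fL : {linear tangent x -> R^o} := HB.pack f fM.
by exists fL.
Qed.

Variable Om : form2 M.
Hypothesis hOm : is_form2 Om.
Hypothesis nd : forall (x : M) (v : tangent x), (forall w, Om v w = 0) -> v = 0.

Definition gram (E : 'I_(dim M) -> vfield M) q := \matrix_(i, j) Om (E i q) (E j q).

Lemma gram_form x0 c y E V q (v w : tangent q) : local_frame x0 c y E V -> V q ->
  ((\row_i tval v (y i)) *m gram E q *m (\row_i tval w (y i))^T) 0 0 = Om v w.
Proof.
move=> H Vq; rewrite (form_frame hOm v w H Vq) /bil.
rewrite !mxE exchange_big /=; apply: eq_bigr => j _.
rewrite !mxE mulr_suml; apply: eq_bigr => i _; rewrite !mxE; ring.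
Qed.

Lemma gram_unit x0 c y E V q : local_frame x0 c y E V -> V q -> gram E q \in unitmx.
Proof.
move=> H Vq; rewrite -row_free_unit; apply: inj_row_free => r rA.
pose v : tangent q := \sum_i r 0 i *: E i q.
have rE : \row_i tval v (y i) = r.
  by apply/rowP => i; rewrite mxE (lf_comb hM _ _ H Vq).
have v0 : v = 0.
  by apply: nd => w; rewrite -(gram_form v w H Vq) rE rA mul0mx mxE.
by rewrite -rE v0; apply/rowP => i; rewrite !mxE.
Qed.

Lemma sharp_ex (x : M) (eta : cotangent x) : exists v, forall w, Om v w = eta w.
Proof.
have [c [y [E [V H]]]] := frame_ex hM x; have Vx := lf_in H.
pose r := (\row_j eta (E j x)) *m invmx (gram E x).
pose v : tangent x := \sum_i r 0 i *: E i x.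
have rE : \row_i tval v (y i) = r.
  by apply/rowP => i; rewrite mxE (lf_comb hM _ _ H Vx).
exists v => w; rewrite -(gram_form v w H Vx) rE /r mulmxKV ?(gram_unit H Vx) //.
rewrite (cotangent_frame eta w H Vx) mxE; apply: eq_bigr => i _.
by rewrite !mxE mulrC.
Qed.

Lemma form_bivectorP (x : M) (eta : cotangent x) w : Om (form_bivector Om eta) w = eta w.
Proof. by have := @xgetPex _ 0 _ (sharp_ex eta); exact. Qed.

Lemma nondeg_eq x (u v : tangent x) : (forall w, Om u w = Om v w) -> u = v.
Proof.
move=> uv; apply/eqP; rewrite -subr_eq0; apply/eqP/nd => w.
by rewrite form_Dl // form_Nl // uv subrr.
Qed.

Lemma form_bivector_unique (x : M) (eta : cotangent x) v :
  (forall w, Om v w = eta w) -> form_bivector Om eta = v.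
Proof. by move=> H; apply: nondeg_eq => w; rewrite form_bivectorP H. Qed.

(** In a frame, the components of [X] are the functions [Om(X, E j)] multiplied by the inverse of
    the Gram matrix. *)
Lemma sharp_smooth (X : vfield M) :
  (forall Z, smooth_vfield Z -> smooth_fun (feval Om X Z)) -> smooth_vfield X.
Proof.
move=> sX f sf; apply/(smooth_funP hM) => x.
have [c [y [E [V H]]]] := frame_ex hM x; have Vx := lf_in H.
have nV := open_near (lf_open H) Vx.
have sA i j : smooth_at (fun q => gram E q i j) x.
  rewrite (_ : (fun q => _) = feval Om (E i) (E j)).
    exact: (smooth_funP hM _).1 (form_smooth hOm (lf_vfield H i) (lf_vfield H j)) x.
  by apply/funext => q; rewrite mxE.
have sI i j : smooth_at (fun q => invmx (gram E q) i j) x.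
  by apply: smooth_at_invmx => //; apply: filterS nV => q Vq; exact: gram_unit H Vq.
apply: (@smooth_at_eq _ _ hM (fun q => \sum_i
  (\sum_j feval Om X (E j) q * invmx (gram E q) j i) * vapply (E i) f q)); last first.
  apply: smooth_at_sumr => i; apply: smooth_atM => //; last first.
    exact: (smooth_funP hM _).1 (lf_vfield H i sf) x.
  apply: smooth_at_sumr => j; apply: smooth_atM => //.
  exact: (smooth_funP hM _).1 (sX _ (lf_vfield H j)) x.
apply: filterS nV => q Vq; rewrite /vapply.
have -> : tval (X q) f = \sum_i tval (X q) (y i) * tval (E i q) f.
  by rewrite {1}(lf_span H (X q) Vq) tval_sumv.
apply: eq_bigr => i _; congr (_ * _).
have rA : (\row_i tval (X q) (y i)) *m gram E q = \row_j feval Om X (E j) q.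
  apply/rowP => j; rewrite !mxE /feval.
  have -> : Om (X q) (E j q) = \sum_i tval (X q) (y i) * Om (E i q) (E j q).
    by rewrite {1}(lf_span H (X q) Vq) form_suml.
  by apply: eq_bigr => k _; rewrite !mxE.
have : (\row_i tval (X q) (y i)) = (\row_j feval Om X (E j) q) *m invmx (gram E q).
  by rewrite -rA mulmxK // (gram_unit H Vq).
move=> /rowP/(_ i); rewrite !mxE => ->.
by apply: eq_bigr => j _; rewrite mxE.
Qed.

End Sharp.

Section PoissonPush.
Context {R : realType} {G M : atlas_space R}.
Hypotheses (hG : premanifold G) (hM : premanifold M).
Variables (Om : form2 G) (pi : bivector M) (J : G -> M).
Hypotheses (hOm : is_form2 Om)
  (nd : forall (x : G) (v : tangent x), (forall w, Om v w = 0) -> v = 0).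
Hypotheses (sJ : smooth_pullback J) (hpi : is_bivector pi)
  (pJ : poisson_map (form_bivector Om) pi J).

(** Covectors are bundled linear maps, and equal values do not make equal bundles. The linearity
    clause of [is_bivector] compares values only; it is applied to [eta = 1 * theta + z] with [z] a
    zero covector. *)
Lemma bivector_eq (x : M) (eta theta : cotangent x) : (forall w, eta w = theta w) ->
  pi eta = pi theta.
Proof.
move=> E; have [lin _ _] := hpi.
have [z zE] := @cotangent_ex R M x (fun=> 0) (fun a u v => esym (etrans (addr0 _) (mulr0 a))).
have z0 : pi z = 0.
  have := lin x (-1) z z z; rewrite scaleN1r addNr; apply => v.
  by rewrite !zE mulr0 addr0.
have := lin x 1 eta theta z; rewrite scale1r z0 addr0; apply => v.
by rewrite zE mul1r addr0.
Qed.

Lemma bivector_ham_smooth f : smooth_fun f -> smooth_vfield (ham_vfield pi f).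
Proof. by move=> sf h sh; have [_ _ H] := hpi; exact: (H h f sh sf). Qed.

(** The pointwise form of the Poisson property: represent [eta] by a function [f], recognize [v] as
    the hamiltonian vector of [f \o J], and test both sides on functions. *)
Lemma poisson_push (g : G) (eta : cotangent (J g)) (v : tangent g) :
  (forall w, Om v w = eta (tmap J w)) -> tmap J v = pi eta.
Proof.
move=> vE; have [f sf fE] := cotangent_differential hM eta.
have vf : form_bivector Om (differential (f \o J) g) = v.
  apply: (form_bivector_unique hG hOm nd) => w.
  by rewrite vE fE (tmapE hM sJ).
apply: tval_ext => h sh; rewrite (tmapE hM sJ) //.
have [_ H] := pJ; have := H h f sh sf g; rewrite /pbracket vf => -[E].
rewrite -[LHS]/(differential (h \o J) g v) E.
by rewrite (@bivector_eq _ eta (differential f (J g))).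
Qed.

End PoissonPush.

(** * Translations in a symplectic groupoid *)

Section Separation.
Context {R : realType} {M : atlas_space R}.
Hypothesis hM : premanifold M.

Lemma smooth_separates (x y : M) : (forall f, smooth_fun f -> f x = f y) -> x = y.
Proof.
move=> H; apply: contrapT => xy; have [hH _ _ _] := hM.
have oW : open (~` [set y]).
  by apply: closed_openC; apply: accessible_closed_set1; exact: hausdorff_accessible.
have [chi [sc c1 c0]] := cutoff_smooth hM oW xy.
have := H _ sc; rewrite (nbhs_singleton c1) c0; last by move=> /(_ erefl).
by move=> /eqP; rewrite oner_eq0.
Qed.

(** The type of a tangent vector depends on its base point; this replaces rewriting along [x = y]
    inside a form. *)
Lemma form_transport (Om : form2 M) (x y : M) (v w : tangent x) (v' w' : tangent y) :
  x = y -> (forall f, smooth_fun f -> tval v f = tval v' f) ->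
  (forall f, smooth_fun f -> tval w f = tval w' f) -> Om x v w = Om y v' w'.
Proof.
move=> E; move: E v' w' => <- v' w' vE wE.
by rewrite (tval_ext vE) (tval_ext wE).
Qed.

Lemma tangent_transport (x y : M) (v : tangent x) : x = y ->
  exists v' : tangent y, forall f, tval v' f = tval v f.
Proof. by move=> <-; exists v. Qed.

(** A vector tangent to [L] is the velocity of a curve inside [L], along which [f1] and [f2] agree
    near time 0. *)
Lemma tangent_to_eq (L : set M) (x : M) (u : tangent x) (f1 f2 : M -> R) :
  tangent_to L x u -> smooth_fun f1 -> smooth_fun f2 ->
  (\forall y \near x, L y -> f1 y = f2 y) -> tval u f1 = tval u f2.
Proof.
move=> [c [Lc vc]] s1 s2 E; have cc := velocity_continuous hM vc.
have [c0 dc] := vc; have [_ <-] := dc _ s1; have [_ <-] := dc _ s2.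
apply: near_eq_derive; rewrite -c0 in E.
by apply: filterS (near_comp cc E) => t; apply.
Qed.

Lemma integral_curve_constant (N : atlas_space R) (K : M -> N) (X : vfield M)
    (gam : R -> M) (eta t : R) : premanifold N -> smooth_pullback K ->
  (forall q, tmap K (X q) = 0) ->
  (forall s, `|s| < eta -> integral_curve X gam s) -> `|t| < eta ->
  forall f : N -> R, smooth_fun f -> f (K (gam t)) = f (K (gam 0)).
Proof.
move=> hN sK KX ig te f sf.
have d (s : R) : Num.min 0 t <= s <= Num.max 0 t ->
    is_derive s (1 : R) (f \o K \o gam) 0.
  move=> st; have se : `|s| < eta.
    apply: le_lt_trans te; move: st; rewrite /Num.min /Num.max.
    by case: ltP => h /andP[? ?]; rewrite ler_norml;
      case: (ger0P t) => ?; apply/andP; split; lra.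
  have [_ /(_ _ (sK f sf))] := ig s se.
  by rewrite -(tmapE hN sK _ sf) KX.
have := @derive_bound R (fun=> 0) 0 0 t _ d
  (fun s _ => eq_ind_r (fun z => z <= 0) (lexx 0) (normr0 R)).
by rewrite mul0r normr_le0 subr_eq0 => /eqP.
Qed.

End Separation.

(* Left and right translations are treated at the same time. In [mu g h] the
   factor [g] is fixed and [h] moves along the fibres of [K], and
   [tri g h (mu g h)] is the corresponding point of the graph [L] of the
   multiplication: [mu g h = g h] with [J] the source and [K] the target for
   left translations, [mu g h = h g] with [J] the target and [K] the source
   for right translations. *)
Section Translations.
Context {R : realType} {G M : atlas_space R}.
Hypotheses (hG : premanifold G) (hM : premanifold M).
Variable Om : form2 G.
Hypothesis hOm : is_form2 Om.
Let G2 := prod_manifold G G.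
Let G3 := triple_manifold G.
Let hG2 : premanifold G2. Proof. exact: prod_premanifold. Qed.
Let hG3 : premanifold G3. Proof. exact: prod_premanifold. Qed.
Variables (L : set G3) (J K : G -> M) (e : M -> G) (mu : G -> G -> G).
Variables (tri : G -> G -> G -> G3) (q1 q2 q3 : G3 -> G) (q12 : G3 -> G2).
Hypothesis maximal : forall p, L p -> forall u,
  (forall w, tangent_to L p w -> triple_form Om u w = 0) -> tangent_to L p u.
Hypotheses (sJ : smooth_pullback J) (sK : smooth_pullback K).
Hypotheses (sq1 : smooth_pullback q1) (sq2 : smooth_pullback q2)
  (sq3 : smooth_pullback q3) (sq12 : smooth_pullback q12).
Hypotheses (tri1 : forall g h k, q1 (tri g h k) = g)
  (tri2 : forall g h k, q2 (tri g h k) = h)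
  (tri3 : forall g h k, q3 (tri g h k) = k)
  (tri12 : forall g h k k', q12 (tri g h k) = q12 (tri g h k')).
Hypotheses (stri2 : forall g k, smooth_pullback (fun h => tri g h k))
  (stri3 : forall g h, smooth_pullback (fun k => tri g h k))
  (stri23 : forall g, smooth_pullback (fun h => tri g h h)).
Hypothesis triE : forall p (u w : tangent p), triple_form Om u w =
  Om (tmap q1 u) (tmap q1 w) + Om (tmap q2 u) (tmap q2 w)
  - Om (tmap q3 u) (tmap q3 w).
Hypothesis LE : forall p, L p <-> J (q1 p) = K (q2 p) /\ q3 p = mu (q1 p) (q2 p).
Hypotheses (Jmu : forall g h, J g = K h -> J (mu g h) = J h)
  (Je : forall x, J (e x) = x) (Ke : forall x, K (e x) = x)
  (mue_l : forall h, mu (e (K h)) h = h) (mue_r : forall g, mu g (e (J g)) = g).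
(** The multiplication is defined and smooth on composable pairs only. [Phi] is a global function on
    pairs that extends the composite of [f] with the product near the given pair. *)
Hypothesis smu : forall f, smooth_fun f -> forall p, L p ->
  exists2 Phi : G2 -> R, smooth_fun Phi &
    \forall y \near q12 p, forall p', L p' -> q12 p' = y -> Phi y = f (q3 p').

Let L_tri g h : J g = K h -> L (tri g h (mu g h)).
Proof. by move=> gh; apply/LE; rewrite tri1 tri2 tri3. Qed.

Let J23 p (w : tangent p) f : tangent_to L p w -> smooth_fun f ->
  tval w ((f \o J) \o q2) = tval w ((f \o J) \o q3).
Proof.
move=> Tw sf; apply: (tangent_to_eq hG3 Tw).
- exact: sq2 (sJ sf).
- exact: sq3 (sJ sf).
apply: filterE => y /LE[E1 E2] /=.
by rewrite E2 Jmu.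
Qed.

(** The vector with components 0, [v], [v] at the graph point over a unit and [g] pairs with a
    tangent vector [w] of the graph to [Om(v, w2 - w3)]. By [J23] the difference lies in the kernel
    of [tmap J], so this is 0 and the vector is tangent. The composability equation, differentiated
    along it, gives the claim. *)
Lemma orthogonal_kernel g (v : tangent g) :
  (forall w, tmap J w = 0 -> Om v w = 0) -> tmap K v = 0.
Proof.
move=> Jv; pose io h := tri (e (K g)) h h.
have sio : smooth_pullback io by exact: stri23.
have Lp : L (io g) by apply/LE; rewrite tri1 tri2 tri3 Je mue_l.
have Tu : tangent_to L (io g) (tmap io v).
  apply: maximal => // w Tw; rewrite triE.
  have -> : tmap q1 (tmap io v) = 0.
    apply: tval_ext => f sf; rewrite (tmapE hG sq1) // (tmapE hG3 sio); last exact: sq1.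
    rewrite (_ : (f \o q1) \o io = fun=> f (e (K g))) ?tval_cst //.
    by apply/funext => h /=; rewrite tri1.
  rewrite form_0l // add0r.
  have [w2 w2E] := tangent_transport (tmap q2 w) (tri2 (e (K g)) g g).
  have [w3 w3E] := tangent_transport (tmap q3 w) (tri3 (e (K g)) g g).
  have -> : Om (tmap q2 (tmap io v)) (tmap q2 w) = Om v w2.
    apply: form_transport => [|f sf|f sf]; [exact: tri2| |by rewrite w2E].
    rewrite (tmapE hG sq2) // (tmapE hG3 sio); last exact: sq2.
    by rewrite (_ : (f \o q2) \o io = f) //; apply/funext => h /=; rewrite tri2.
  have -> : Om (tmap q3 (tmap io v)) (tmap q3 w) = Om v w3.
    apply: form_transport => [|f sf|f sf]; [exact: tri3| |by rewrite w3E].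
    rewrite (tmapE hG sq3) // (tmapE hG3 sio); last exact: sq3.
    by rewrite (_ : (f \o q3) \o io = f) //; apply/funext => h /=; rewrite tri3.
  have := Jv (w2 - w3); rewrite form_Dr // -[- w3]scaleN1r form_Zr // mulN1r; apply.
  apply: tval_ext => f sf; rewrite (tmapE hM sJ) //.
  rewrite scaleN1r tvalDv tvalNv w2E w3E.
  rewrite (tmapE hG sq2) ?(tmapE hG sq3); try exact: sJ.
  by rewrite J23 // subrr.
apply: tval_ext => f sf; rewrite (tmapE hM sK) // tval0.
have := @tangent_to_eq _ _ hG3 L (io g) _ ((f \o J) \o q1) ((f \o K) \o q2) Tu
  (sq1 (sJ sf)) (sq2 (sK sf)).
rewrite !(tmapE hG3 sio); [|exact: sq2 (sK sf)|exact: sq1 (sJ sf)].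
have -> : ((f \o J) \o q1) \o io = fun=> f (K g).
  by apply/funext => h /=; rewrite tri1 Je.
have -> : ((f \o K) \o q2) \o io = f \o K by apply/funext => h /=; rewrite tri2.
rewrite tval_cst // => H; rewrite -H //.
by apply: filterE => y /LE[E _] /=; rewrite E.
Qed.

(* The covector field [y |-> d(phi y) y] is given by functions [phi y], so that
   no covector has to be transported along an equality of base points. *)
Section invariant_field.
Variables (X : vfield G) (phi : M -> M -> R).
Hypotheses (sphi : forall x, smooth_fun (phi x))
  (Xphi : forall g (w : tangent g), Om (X g) w = tval w (phi (J g) \o J)).

Lemma invariant_field_kernel g : tmap K (X g) = 0.
Proof.
apply: orthogonal_kernel => w Jw.
by rewrite Xphi -(tmapE hM sJ _ (sphi _)) Jw.
Qed.

(** Translation by [g] exists only on a fibre of [K], not on a neighbourhood of [h], so invariance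
    is expressed with the extension [Phi]. The third entry of [tri] stays frozen at [mu g h], as
    [q12] does not see it. *)
Lemma invariant_field_translate g h f Phi : J g = K h -> smooth_fun f ->
  smooth_fun Phi ->
  (\forall y \near q12 (tri g h (mu g h)),
     forall p', L p' -> q12 p' = y -> Phi y = f (q3 p')) ->
  tval (X h) (fun h' => Phi (q12 (tri g h' (mu g h)))) = tval (X (mu g h)) f.
Proof.
move=> gh sf sP PE; set k := mu g h; set p := tri g h k.
have Lp : L p by exact: L_tri.
pose i2 h' := tri g h' k; pose i3 k' := tri g h k'.
have si2 : smooth_pullback i2 by exact: stri2.
have si3 : smooth_pullback i3 by exact: stri3.
(* The vector with components 0, [X h], [X k], obtained by moving the second and the third entries
   separately. It pairs to 0 with the graph because [Om(X, .)] comes from [J], which takes the same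
   value at [h] and [k]. *)
pose u : tangent p := tmap i2 (X h) + tmap i3 (X k).
have uE F : smooth_fun F -> tval u F = tval (X h) (F \o i2) + tval (X k) (F \o i3).
  by move=> sF; rewrite tvalDv (tmapE hG3 si2) // (tmapE hG3 si3).
have u1 F : smooth_fun F -> tval u (F \o q1) = 0.
  move=> sF; rewrite uE; last exact: sq1.
  have -> : (F \o q1) \o i2 = fun=> F g by apply/funext => z /=; rewrite tri1.
  have -> : (F \o q1) \o i3 = fun=> F g by apply/funext => z /=; rewrite tri1.
  by rewrite !tval_cst // addr0.
have u2 F : smooth_fun F -> tval u (F \o q2) = tval (X h) F.
  move=> sF; rewrite uE; last exact: sq2.
  have -> : (F \o q2) \o i2 = F by apply/funext => z /=; rewrite tri2.
  have -> : (F \o q2) \o i3 = fun=> F h by apply/funext => z /=; rewrite tri2.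
  by rewrite tval_cst // addr0.
have u3 F : smooth_fun F -> tval u (F \o q3) = tval (X k) F.
  move=> sF; rewrite uE; last exact: sq3.
  have -> : (F \o q3) \o i2 = fun=> F k by apply/funext => z /=; rewrite tri3.
  have -> : (F \o q3) \o i3 = F by apply/funext => z /=; rewrite tri3.
  by rewrite tval_cst // add0r.
have Tu : tangent_to L p u.
  apply: maximal => // w Tw; rewrite triE.
  have -> : tmap q1 u = 0.
    by apply: tval_ext => F sF; rewrite (tmapE hG sq1) // u1.
  rewrite form_0l // add0r.
  have [w2 w2E] := tangent_transport (tmap q2 w) (tri2 g h k).
  have [w3 w3E] := tangent_transport (tmap q3 w) (tri3 g h k).
  have -> : Om (tmap q2 u) (tmap q2 w) = Om (X h) w2.
    apply: form_transport => [|F sF|F sF]; [exact: tri2| |by rewrite w2E].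
    by rewrite (tmapE hG sq2) // u2.
  have -> : Om (tmap q3 u) (tmap q3 w) = Om (X k) w3.
    apply: form_transport => [|F sF|F sF]; [exact: tri3| |by rewrite w3E].
    by rewrite (tmapE hG sq3) // u3.
  rewrite !Xphi w2E w3E (tmapE hG sq2); last exact: sJ.
  rewrite (tmapE hG sq3); last exact: sJ.
  by rewrite J23 // Jmu // subrr.
rewrite -u3 // -(@tangent_to_eq _ _ hG3 L p u (Phi \o q12) (f \o q3) Tu (sq12 sP) (sq3 sf)).
  rewrite uE; last exact: sq12.
  have -> : (Phi \o q12) \o i3 = fun=> Phi (q12 p).
    by apply/funext => z /=; rewrite (tri12 _ _ _ k).
  by rewrite tval_cst // addr0.
have c12 : {for p, continuous q12} := @smooth_pullback_continuous _ _ _ q12 hG3 hG2 sq12 p.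
by apply: filterS (near_comp c12 PE) => y H Ly /=; exact: H.
Qed.

(** The curve [gam] is translated by [g]. It stays in the fibre of [K] through its starting unit,
    because [X] is in the kernel of [tmap K]; hence all the products are defined. *)
Lemma invariant_field_lift g (eta : R) gam : gam 0 = e (J g) ->
  (forall t, `|t| < eta -> integral_curve X gam t) ->
  exists gam', gam' 0 = g /\ forall t, `|t| < eta -> integral_curve X gam' t.
Proof.
move=> g0 ig; exists (fun t => mu g (gam t)); split; first by rewrite g0 mue_r.
have Kg (t : R) : `|t| < eta -> J g = K (gam t).
  move=> te; apply: (smooth_separates hM) => f sf.
  rewrite (integral_curve_constant hM sK invariant_field_kernel ig te sf).
  by rewrite g0 Ke.
move=> t te; split => // f sf.
have [Phi sP PE] := smu sf (L_tri (Kg t te)).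
set h := gam t in PE *; set k := mu g h in PE *.
(* Along [gam], this smooth function on [G] is [f] of the translated curve, so the known velocity of
   [gam] gives the derivative. *)
pose Psi h' := Phi (q12 (tri g h' k)).
have sPsi : smooth_fun Psi by exact: (stri2 g k (sq12 sP)).
have cg : {for t, continuous gam} := velocity_continuous hG (ig t te).
have cq : {for h, continuous (fun h' => q12 (tri g h' k))}.
  exact: (@smooth_pullback_continuous _ _ _ (fun h' => q12 (tri g h' k)) hG hG2
    (smooth_pullback_comp (@stri2 g k) sq12) h).
have nP := near_comp cg (near_comp cq PE).
have ne : \forall s \near t, `|s| < eta.
  have := @near_ball_lt R t eta 0; rewrite subr0 => /(_ te).
  by apply: filterS => r; rewrite subr0.
have E : \forall s \near t, (Psi \o gam) s = (f \o (fun s => mu g (gam s))) s.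
  apply: filterS2 nP ne => s H se /=.
  have Ls := L_tri (Kg s se); rewrite /Psi (H _ Ls) ?tri3 //; exact: tri12.
apply: near_eq_is_derive E _.
rewrite -(invariant_field_translate (Kg t te) sf sP PE).
by have [_ dg] := ig t te; exact: (dg _ sPsi).
Qed.

End invariant_field.
End Translations.

(** * From tangent maps at a point to matrices *)

Section KernelRanks.
Context {R : realType} {G M : atlas_space R}.
Hypotheses (hG : premanifold G) (hM : premanifold M).
Variables (g : G) (c : chart R G (dim G)) (y : 'I_(dim G) -> G -> R)
  (E : 'I_(dim G) -> vfield G) (V : set G).
Hypotheses (H : local_frame g c y E V).
Let Vg : V g := lf_in H.

(** The matrix of the tangent map in two frames, acting on rows from the right: surjectivity becomes
    [row_full]. *)
Lemma tmap_matrix (J : G -> M) : smooth_pullback J ->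
  (forall w : tangent (J g), exists v : tangent g, tmap J v = w) ->
  exists2 A : 'M[R]_(dim G, dim M), row_full A &
    forall v : tangent g, (\row_i tval v (y i)) *m A = 0 <-> tmap J v = 0.
Proof.
move=> sJ surj; have [c' [y' [E' [V' H']]]] := frame_ex hM (J g).
have V'J := lf_in H'.
pose A := \matrix_(i < dim G, j < dim M) tval (E i g) (y' j \o J).
have AE (v : tangent g) :
    (\row_i tval v (y i)) *m A = \row_j tval (tmap J v) (y' j).
  apply/rowP => j; rewrite !mxE (tmapE hM sJ); last exact: lf_smooth H' j.
  rewrite {2}(lf_span H v Vg) tval_sumv; apply: eq_bigr => k _.
  by rewrite !mxE.
exists A.
  rewrite -sub1mx; apply/row_subP => j; rewrite row1.
  have [v vE] := surj (E' j (J g)); apply/submxP; exists (\row_i tval v (y i)).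
  rewrite AE vE; apply/rowP => k; rewrite !mxE (lf_dual hM _ _ H' V'J) eqxx /=.
  by rewrite eq_sym.
move=> v; rewrite AE; split=> [vE|->]; last by apply/rowP => j; rewrite !mxE.
apply: (lf_tangent_eq H' V'J) => j.
by have /rowP/(_ j) := vE; rewrite !mxE.
Qed.

Variable Om : form2 G.
Hypothesis hOm : is_form2 Om.
Hypothesis nd : forall (x : G) (v : tangent x), (forall w, Om v w = 0) -> v = 0.
Variables J K : G -> M.
Hypotheses (sJ : smooth_pullback J) (sK : smooth_pullback K).
Hypotheses (surjJ : forall w : tangent (J g), exists v : tangent g, tmap J v = w)
  (surjK : forall w : tangent (K g), exists v : tangent g, tmap K v = w).

Let coord (r : 'rV[R]_(dim G)) :
  \row_j tval (\sum_i r 0 i *: E i g : tangent g) (y j) = r.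
Proof. by apply/rowP => j; rewrite mxE (lf_comb hG _ _ H Vg). Qed.

Let form_mx (u v : 'rV[R]_(dim G)) : u *m gram Om E g *m v^T = 0 <->
  Om (\sum_i u 0 i *: E i g) (\sum_i v 0 i *: E i g) = 0.
Proof.
rewrite -(gram_form hOm _ _ H Vg) !coord; split=> [->|uv]; first by rewrite mxE.
by apply/matrixP => i j; rewrite !ord1 uv mxE.
Qed.

Lemma kernels_dim :
  (forall v w : tangent g, tmap J v = 0 -> tmap K w = 0 -> Om v w = 0) ->
  (dim G - dim M <= dim M)%N.
Proof.
move=> iso; have [A fA AE] := tmap_matrix sJ surjJ.
have [B fB BE] := tmap_matrix sK surjK.
apply: (isotropic_kernels_dim (gram_unit hG hOm nd H Vg) fA fB) => u v uA vB.
by apply/form_mx; apply: iso; [apply/AE|apply/BE]; rewrite coord.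
Qed.

Lemma kernels_orthogonal : (dim G - dim M <= dim M)%N ->
  (forall v : tangent g, (forall w : tangent g, tmap K w = 0 -> Om v w = 0) -> tmap J v = 0) ->
  forall v w : tangent g, tmap J v = 0 -> tmap K w = 0 -> Om v w = 0.
Proof.
move=> dGM coiso; have [A fA AE] := tmap_matrix sJ surjJ.
have [B fB BE] := tmap_matrix sK surjK.
move=> v w /AE vA /BE wB; rewrite -(gram_form hOm v w H Vg).
rewrite (coisotropic_kernels (gram_unit hG hOm nd H Vg) fA fB dGM _ vA wB) ?mxE //.
move=> u uO; rewrite -(coord u); apply/AE; apply: coiso => z /BE zB.
rewrite -(gram_form hOm _ z H Vg) coord.
by rewrite uO // mxE.
Qed.

End KernelRanks.

(** * Gauge transformations *)

Section SymplecticGroupoid.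
Context {R : realType} {G M : atlas_space R}.
Variables (a b : G -> M) (e : M -> G) (i : G -> G) (m : G -> G -> G).
Variables (Om : form2 G) (pi : bivector M).
Let s := GroupoidOps a b e i m.
Hypothesis sg : symplectic_groupoid s Om pi.

Let lie : lie_groupoid s. Proof. by case: sg. Qed.
Let hG : premanifold G. Proof. by apply: smooth_manifold_pre; case: lie => -[]. Qed.
Let hM : premanifold M. Proof. by apply: smooth_manifold_pre; case: lie => -[]. Qed.
Let sa : smooth_pullback a.
Proof. by apply: (smooth_map_pullback hG hM); case: lie => _ _ [[]]. Qed.
Let sb : smooth_pullback b.
Proof. by apply: (smooth_map_pullback hG hM); case: lie => _ _ [_ []]. Qed.
Let se : smooth_pullback e.
Proof. by apply: (smooth_map_pullback hM hG); case: lie => _ _ _ []. Qed.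
Let si : smooth_pullback i.
Proof. by apply: (smooth_map_pullback hG hG); case: lie => _ _ _ []. Qed.
Let cOm : closed_form2 Om. Proof. by case: sg => _ []. Qed.
Let hOm : is_form2 Om. Proof. by case: cOm. Qed.
Let nd : forall (x : G) (v : tangent x), (forall w, Om v w = 0) -> v = 0.
Proof. by case: sg => _ []. Qed.
Let hpi : is_bivector pi. Proof. by case: sg => _ _ _ []. Qed.
Let pa : poisson_map (form_bivector Om) pi a. Proof. by case: sg => _ _ _ _ []. Qed.
Let pb : poisson_map (form_bivector Om) (opp_bivector pi) b.
Proof. by case: sg => _ _ _ _ []. Qed.
Let suba (x : G) (w : tangent (a x)) : exists v : tangent x, tmap a v = w.
Proof. by case: lie => _ _ [[_ _ H] _] _ _; exact: H. Qed.
Let subb (x : G) (w : tangent (b x)) : exists v : tangent x, tmap b v = w.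
Proof. by case: lie => _ _ [_ [_ _ H]] _ _; exact: H. Qed.

Let ae x : a (e x) = x. Proof. by case: lie => _ [/(_ x)[]]. Qed.
Let be x : b (e x) = x. Proof. by case: lie => _ [/(_ x)[]]. Qed.
Let am g h : a g = b h -> a (m g h) = a h.
Proof. by case: lie => _ [_ H _ _ _] _ _ _ /H[]. Qed.
Let bm g h : a g = b h -> b (m g h) = b g.
Proof. by case: lie => _ [_ H _ _ _] _ _ _ /H[]. Qed.
Let mA g h k : a g = b h -> a h = b k -> m (m g h) k = m g (m h k).
Proof. by case: lie => _ [_ _ H _ _] _ _ _; exact: H. Qed.
Let me g : m g (e (a g)) = g. Proof. by case: lie => _ [_ _ _ /(_ g)[]]. Qed.
Let em g : m (e (b g)) g = g. Proof. by case: lie => _ [_ _ _ /(_ g)[]]. Qed.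
Let ai g : a (i g) = b g. Proof. by case: lie => _ [_ _ _ _ /(_ g)[]]. Qed.
Let bi g : b (i g) = a g. Proof. by case: lie => _ [_ _ _ _ /(_ g)[]]. Qed.
Let im g : m (i g) g = e (a g). Proof. by case: lie => _ [_ _ _ _ /(_ g)[]]. Qed.

Lemma ginvK : involutive i.
Proof.
move=> g; have := me (i (i g)); rewrite ai bi -im => <-.
by rewrite -mA ?ai ?bi // im ai em.
Qed.

(** The inversion is a continuous involution that exchanges the fibres of [a] and [b]; loops and
    their contractions are carried over by it. *)
Lemma tgt_simply_connected : simply_connected_fibers a -> simply_connected_fibers b.
Proof.
move=> sc y; have [conn contr] := sc y.
have ci : continuous i := @smooth_pullback_continuous _ _ _ i hG hG si.
split.
  rewrite (_ : b @^-1` [set y] = i @` (a @^-1` [set y])).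
    by apply: connected_continuous_connected conn _; exact: continuous_subspaceT.
  apply/seteqP; split=> [g /= bg|_ [g /= ag <-]]; last by rewrite bi.
  by exists (i g); [rewrite /= ai|exact: ginvK].
move=> c cc cA c01.
have [H [cH HA Ht Hs]] := contr (i \o c)
  (fun t => continuous_comp (cc t) (@ci _))
  (fun g '(ex_intro2 t It E) => etrans (congr1 a (esym E)) (etrans (ai (c t)) (cA _ (ex_intro2 _ _ t It erefl))))
  (congr1 i c01).
exists (i \o H); split.
- exact: (fun t => continuous_comp (cH t) (@ci _)).
- move=> _ [t It <-]; rewrite /= bi; apply: HA; exact: imageP.
- by move=> t It; have [/= -> ->] := Ht t It; rewrite /= !ginvK.
- by move=> t It; have [/= -> ->] := Hs t It; rewrite /= !ginvK.
Qed.

Let G2 := prod_manifold G G.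
Let G3 := triple_manifold G.
Let hG2 : premanifold G2. Proof. exact: prod_premanifold. Qed.
Let hG3 : premanifold G3. Proof. exact: prod_premanifold. Qed.
Let L : set G3 := mul_graph s.
Let p1 (p : G3) : G := p.1.
Let p2 (p : G3) : G := p.2.1.
Let p3 (p : G3) : G := p.2.2.
Let p12 (p : G3) : G2 := (p.1, p.2.1).

Let lagr p : L p ->
  tangent_to L p = symp_orth (triple_form Om) (tangent_to L p).
Proof. by case: sg => _ _ [_ H] _ _; exact: H. Qed.

Let maximal p : L p -> forall u,
  (forall w, tangent_to L p w -> triple_form Om u w = 0) -> tangent_to L p u.
Proof. by move=> Lp u H; rewrite (lagr Lp) => w; exact: H. Qed.

Let isotropic p (u w : tangent p) : L p -> tangent_to L p u -> tangent_to L p w ->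
  triple_form Om u w = 0.
Proof. by move=> Lp; rewrite {1}(lagr Lp) => H /H. Qed.

Let sp1 : smooth_pullback p1. Proof. exact: smooth_pullback_fst hG hG2. Qed.
Let sp2 : smooth_pullback p2.
Proof.
exact: (@smooth_pullback_comp _ G3 G2 G (fun p => p.2) (fun p => p.1)
  (smooth_pullback_snd hG hG2) (smooth_pullback_fst hG hG)).
Qed.
Let sp3 : smooth_pullback p3.
Proof.
exact: (@smooth_pullback_comp _ G3 G2 G (fun p => p.2) (fun p => p.2)
  (smooth_pullback_snd hG hG2) (smooth_pullback_snd hG hG)).
Qed.
Let sp12 : smooth_pullback p12.
Proof. exact: (smooth_pullback_pair hG hG hG3 sp1 sp2). Qed.

Let striple (j1 j2 j3 : G -> G) : smooth_pullback j1 -> smooth_pullback j2 ->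
  smooth_pullback j3 -> smooth_pullback (fun g => (j1 g, (j2 g, j3 g)) : G3).
Proof.
move=> s1 s2 s3; apply: (@smooth_pullback_pair _ G G2 hG hG2 G j1 (fun g => (j2 g, j3 g))) => //.
exact: smooth_pullback_pair.
Qed.
Let scst (g : G) : smooth_pullback (fun _ : G => g).
Proof. exact: smooth_pullback_cst. Qed.
Let sid : smooth_pullback (@id G). Proof. exact: smooth_pullback_id. Qed.

(** [smooth_map_rel] gives an extension [F] of the product near the pair; [f \o F] is smooth only
    near it, and [smooth_ext] replaces it by a global function. *)
Let smul f : smooth_fun f -> forall p, L p ->
  exists2 Phi : G2 -> R, smooth_fun Phi &
    \forall y \near p12 p, forall p', L p' -> p12 p' = y -> Phi y = f (p3 p').
Proof.
move=> sf p [ab _]; have [_ _ _ _ smm] := lie.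
have [U [F [oU Up sF FE]]] := smm (p12 p) ab.
have sfF := smooth_map_on_at hG2 hG oU Up sF ((smooth_funP hG f).1 sf (F (p12 p))).
have [Phi sP PE] := smooth_ext hG2 sfF.
exists Phi => //; apply: filterS2 (open_near oU Up) PE => y Uy Py p' [ab' E'] Ep.
rewrite Py /p3 E' -Ep /=; congr f; rewrite -FE //; by rewrite ?Ep.
Qed.

Lemma src_kernel g (v : tangent g) :
  (forall w, tmap b w = 0 -> Om v w = 0) -> tmap a v = 0.
Proof.
apply: (@orthogonal_kernel _ _ _ hG hM Om hOm L b a e (fun g h => m h g)
  (fun g h k => (h, (g, k))) p2 p1 p3 maximal sb sa sp2 sp1 sp3) => //.
- by move=> k; exact: (striple sid (scst k) sid).
- by move=> p u w; rewrite [in RHS](addrC (Om (tmap p2 u) _)).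
- by move=> p; split=> -[h1 h2].
- by move=> k h /esym/bm.
Qed.

Lemma tgt_kernel g (v : tangent g) :
  (forall w, tmap a w = 0 -> Om v w = 0) -> tmap b v = 0.
Proof.
apply: (@orthogonal_kernel _ _ _ hG hM Om hOm L a b e m
  (fun g h k => (g, (h, k))) p1 p2 p3 maximal sa sb sp1 sp2 sp3) => //.
by move=> k; exact: (striple (scst k) sid sid).
Qed.

Lemma src_lift (X : vfield G) (phi : M -> M -> R) : (forall x, smooth_fun (phi x)) ->
  (forall g (w : tangent g), Om (X g) w = tval w (phi (a g) \o a)) ->
  forall g (eta : R) gam, gam 0 = e (a g) ->
    (forall t, `|t| < eta -> integral_curve X gam t) ->
    exists gam', gam' 0 = g /\ forall t, `|t| < eta -> integral_curve X gam' t.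
Proof.
move=> sphi Xphi.
apply: (@invariant_field_lift _ _ _ hG hM Om hOm L a b e m
  (fun g h k => (g, (h, k))) p1 p2 p3 p12 maximal sa sb sp1 sp2 sp3 sp12
  _ _ _ _ _ _ _ _ _ _ _ _ _ _ smul X phi sphi Xphi) => //.
- by move=> g k; exact: (striple (scst g) sid (scst k)).
- by move=> g h; exact: (striple (scst g) (scst h) sid).
- by move=> g; exact: (striple (scst g) sid sid).
Qed.

Lemma tgt_lift (X : vfield G) (phi : M -> M -> R) : (forall x, smooth_fun (phi x)) ->
  (forall g (w : tangent g), Om (X g) w = tval w (phi (b g) \o b)) ->
  forall g (eta : R) gam, gam 0 = e (b g) ->
    (forall t, `|t| < eta -> integral_curve X gam t) ->
    exists gam', gam' 0 = g /\ forall t, `|t| < eta -> integral_curve X gam' t.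
Proof.
move=> sphi Xphi.
apply: (@invariant_field_lift _ _ _ hG hM Om hOm L b a e (fun g h => m h g)
  (fun g h k => (h, (g, k))) p2 p1 p3 p12 maximal sb sa sp2 sp1 sp3 sp12
  _ _ _ _ _ _ _ _ _ _ _ _ _ _ smul X phi sphi Xphi) => //.
- by move=> g k; exact: (striple sid (scst g) (scst k)).
- by move=> g h; exact: (striple (scst h) (scst g) sid).
- by move=> g; exact: (striple sid (scst g) sid).
- by move=> p u w; rewrite [in RHS](addrC (Om (tmap p2 u) _)).
- by move=> p; split=> -[h1 h2].
- by move=> g h /esym/bm.
Qed.

(** The velocities of the two curves are (v, 0, v) and (0, w, w), since [e \o a] is stationary along
    [v] and [e \o b] along [w]; the form of the triple product pairs them to [- Om v w]. *)
Lemma unit_isotropic x (v w : tangent (e x)) :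
  tmap a v = 0 -> tmap b w = 0 -> Om v w = 0.
Proof.
move=> av bw; pose j1 g : G3 := (g, (e (a g), g)); pose j2 g : G3 := (e (b g), (g, g)).
have sj1 : smooth_pullback j1.
  exact: (striple sid (smooth_pullback_comp sa se) sid).
have sj2 : smooth_pullback j2.
  exact: (striple (smooth_pullback_comp sb se) sid sid).
have L1 g : L (j1 g) by split; rewrite /= ?be ?me.
have L2 g : L (j2 g) by split; rewrite /= ?ae ?em.
(* The two graph points coincide only through the unit laws, so the second velocity has to be
   transported to the first point. *)
have E12 : j2 (e x) = j1 (e x) by rewrite /j1 /j2 ae be.
have T1 : tangent_to L (j1 (e x)) (tmap j1 v).
  have [gam vg] := velocity_ex hG v; exists (j1 \o gam); split; first by move=> t; exact: L1.
  exact: (velocity_tmap hG3 sj1 vg).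
have [u2 u2E] := tangent_transport (tmap j2 w) E12.
have T2 : tangent_to L (j1 (e x)) u2.
  have [gam vg] := velocity_ex hG w; exists (j2 \o gam); split; first by move=> t; exact: L2.
  have [h0 h1] := velocity_tmap hG3 sj2 vg; split; first by rewrite h0.
  by move=> f sf; rewrite u2E; exact: h1.
have := isotropic (L1 (e x)) T1 T2.
rewrite /triple_form /form_sub /form_add /pullback.
have -> : @tmap _ G3 G (fun p => p.2.1) (j1 (e x)) (tmap j1 v) = 0.
  apply: tval_ext => f sf; rewrite (tmapE hG sp2) // (tmapE hG3 sj1); last exact: sp2.
  rewrite -[(_ \o _)]/((f \o e) \o a) -(tmapE hM sa); last exact: se.
  by rewrite av.
have -> : @tmap _ G3 G (fun p => p.1) (j1 (e x)) u2 = 0.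
  apply: tval_ext => f sf; rewrite (tmapE hG sp1) // u2E (tmapE hG3 sj2); last exact: sp1.
  rewrite -[(_ \o _)]/((f \o e) \o b) -(tmapE hM sb); last exact: se.
  by rewrite bw.
have -> : @tmap _ G3 G (fun p => p.2.2) (j1 (e x)) (tmap j1 v) = v.
  by apply: tval_ext => f sf; rewrite (tmapE hG sp3) // (tmapE hG3 sj1) //; exact: sp3.
have -> : @tmap _ G3 G (fun p => p.2.2) (j1 (e x)) u2 = w.
  by apply: tval_ext => f sf; rewrite (tmapE hG sp3) // u2E (tmapE hG3 sj2) //; exact: sp3.
rewrite form_0l // form_0r // !add0r => H; apply: oppr_inj; by rewrite H oppr0.
Qed.

(** The bound [dGM] is obtained at the unit [e (a g)]. It involves dimensions of manifolds only, so
    it may be combined at [g] itself with the inclusion [src_kernel]. *)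
Lemma fibers_orthogonal g (v w : tangent g) :
  tmap a v = 0 -> tmap b w = 0 -> Om v w = 0.
Proof.
have dGM : (dim G - dim M <= dim M)%N.
  have [c [y [E [V H]]]] := frame_ex hG (e (a g)).
  exact: (kernels_dim hG hM H hOm nd sa sb (@suba _) (@subb _) (@unit_isotropic (a g))).
have [c [y [E [V H]]]] := frame_ex hG g.
exact: (kernels_orthogonal hG hM H hOm nd sa sb (@suba _) (@subb _) dGM (@src_kernel g)).
Qed.

(** * The bimodule of the gauged form *)

Section Gauge.
Variables (B : form2 M) (piB : bivector M).
Hypotheses (cB : closed_form2 B) (poB : poisson piB)
  (gB : forall x : M, gauge B pi x = bivector_graph piB x).
Let hB : is_form2 B. Proof. by case: cB. Qed.
Let hpiB : is_bivector piB. Proof. by case: poB. Qed.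
Let Ohat := form_sub Om (pullback b B).

Let OhatE g (v w : tangent g) : Ohat v w = Om v w - B (tmap b v) (tmap b w).
Proof. by []. Qed.

Let opp_pi : is_bivector (opp_bivector pi).
Proof.
have [h1 h2 h3] := hpi; split.
- by move=> x r xi eta nu H; rewrite /opp_bivector (h1 _ _ _ _ _ H) opprD scalerN.
- by move=> x eta; rewrite /opp_bivector linearN h2 oppr0.
- move=> f h sf sh; rewrite (_ : pbracket _ f h = fun x => -1 * pbracket pi f h x).
    by apply: smooth_funM => //; [exact: smooth_fun_cst|exact: h3].
  by apply/funext => x; rewrite /pbracket /opp_bivector linearN mulN1r.
Qed.

Let gauge_eq x (eta theta : cotangent x) :
  (forall w, theta w = eta w + B (pi eta) w) -> pi eta = piB theta.
Proof.
move=> H; have : gauge B pi x (pi eta, theta) by exists eta; split.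
by rewrite gB.
Qed.

(* A vector [v] with [Om v w = theta (Tb w) + B (Tb v) (Tb w)] satisfies
   [Tb v = - pi eta] for [eta = theta + B (Tb v)], and [tau_B] sends
   [(pi eta, eta)] to [(pi eta, theta)]. *)
Lemma gauge_push g (theta : cotangent (b g)) (v : tangent g) :
  (forall w, Ohat v w = theta (tmap b w)) -> tmap b v = - piB theta.
Proof.
move=> vE.
have [|eta etaE] := @cotangent_ex R M (b g) (fun w => theta w + B (tmap b v) w).
  move=> r u w; rewrite form_lin_r // linearD linearZ /=.
  rewrite -[r *: _]/(r * _); ring.
have E : tmap b v = - pi eta.
  apply: (poisson_push hG hM hOm nd sb opp_pi pb) => w.
  by rewrite etaE -vE OhatE subrK.
rewrite E; congr (- _); apply: gauge_eq => w.
by rewrite etaE E form_Nl // subrK.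
Qed.

Lemma gauge_nondegenerate g (v : tangent g) : (forall w, Ohat v w = 0) -> v = 0.
Proof.
move=> v0; have [|z zE] := @cotangent_ex R M (b g) (fun=> 0).
  by move=> *; rewrite mulr0 addr0.
have bv : tmap b v = 0.
  rewrite (@gauge_push g z); last by move=> w; rewrite v0 zE.
  have [lin _ _] := hpiB; have := lin (b g) (-1) z z z; rewrite scaleN1r addNr => ->.
    by rewrite oppr0.
  by move=> w; rewrite !zE mulr0 addr0.
by apply: nd => w; have := v0 w; rewrite OhatE bv form_0l // subr0.
Qed.

Lemma gauge_symplectic : symplectic Ohat.
Proof.
split; last exact: gauge_nondegenerate.
by apply: form_sub_closed => //; exact: pullback_closed.
Qed.

Let hOhat : is_form2 Ohat. Proof. by case: gauge_symplectic => -[]. Qed.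

(** The hamiltonian vector of [f \o a] for [Om] is orthogonal to the kernel of [tmap a], hence
    killed by [tmap b]; the correction by the pull back of [B] vanishes on it. *)
Let ham_src f g : smooth_fun f ->
  form_bivector Ohat (differential (f \o a) g) = form_bivector Om (differential (f \o a) g).
Proof.
move=> sf; set v := form_bivector Om _.
have vE w : Om v w = tval w (f \o a) by exact: (form_bivectorP hG hOm nd (differential (f \o a) g) w).
have bv : tmap b v = 0.
  by apply: tgt_kernel => w aw; rewrite vE -(tmapE hM sa) // aw.
apply: (form_bivector_unique hG hOhat gauge_nondegenerate) => w.
by rewrite OhatE bv form_0l // subr0 vE.
Qed.

Lemma gauge_src_poisson : poisson_map (form_bivector Ohat) pi a.
Proof.
have [h1 h2] := pa; split=> // f h sf sh g.
by rewrite -h2 // /pbracket ham_src.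
Qed.

Let ham_smooth (f : G -> R) : smooth_fun f -> smooth_vfield (ham_vfield (form_bivector Ohat) f).
Proof.
move=> sf; apply: (sharp_smooth hG hOhat gauge_nondegenerate) => Z sZ.
rewrite (_ : feval _ _ _ = vapply Z f); first exact: sZ.
by apply/funext => g; rewrite /feval (form_bivectorP hG hOhat gauge_nondegenerate).
Qed.

Lemma gauge_src_complete : complete_map (form_bivector Ohat) pi a.
Proof.
move=> f sf Yc; set X := ham_vfield _ _.
have XE g (w : tangent g) : Om (X g) w = tval w (f \o a).
  by rewrite /X /ham_vfield ham_src //; exact: (form_bivectorP hG hOm nd (differential (f \o a) g) w).
apply: (complete_lift hG hM (J := a) (e := e) (ham_smooth (sa sf)) (bivector_ham_smooth hpi sf) _ Yc).
- exact: (@smooth_pullback_continuous _ _ _ e hM hG se).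
- move=> gam t ig; have [h0 h1] := velocity_tmap hM sa ig; split=> // h sh.
  have -> : tval (ham_vfield pi f ((a \o gam) t)) h = tval (tmap a (X (gam t))) h.
    rewrite (poisson_push hG hM hOm nd sa hpi pa (eta := differential f (a (gam t)))) //.
    by move=> w; rewrite XE; exact: (esym (tmapE hM sa w sf)).
  exact: h1.
- exact: (@src_lift X (fun=> f)).
Qed.

Let ham_tgt f g : smooth_fun f ->
  tmap b (ham_vfield (form_bivector Ohat) (f \o b) g) = - piB (differential f (b g)).
Proof.
move=> sf; apply: gauge_push => w.
rewrite (form_bivectorP hG hOhat gauge_nondegenerate).
exact: (esym (tmapE hM sb w sf)).
Qed.

Lemma gauge_tgt_poisson : poisson_map (form_bivector Ohat) (opp_bivector piB) b.
Proof.
have [h1 _] := pb; split=> // f h sf sh g.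
rewrite /pbracket /opp_bivector -ham_tgt //.
exact: (esym (tmapE hM sb _ sf)).
Qed.

(** Since [X] projects to [Y], the covector of [X] for [Om] is the pull back of [df + B(Y, .)]. No
    single function has this differential in general, so at each [y] a function [phi y] with the
    right differential at [y] is chosen. *)
Lemma gauge_tgt_complete : complete_map (form_bivector Ohat) (opp_bivector piB) b.
Proof.
move=> f sf Yc; set X := ham_vfield (form_bivector Ohat) (f \o b).
pose Y := ham_vfield (opp_bivector piB) f.
have : forall y : M, exists phi : M -> R, smooth_fun phi /\
    forall w : tangent y, tval w phi = tval w f + B (Y y) w.
  move=> y; have [|eta etaE] := @cotangent_ex R M y (fun w => tval w f + B (Y y) w).
    by move=> r u w; rewrite form_lin_r // tval_lin; ring.
  have [phi sphi phiE] := cotangent_differential hM eta.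
  by exists phi; split => // w; rewrite -phiE etaE.
move=> /choice[phi phiE].
have XE g (w : tangent g) : Om (X g) w = tval w (phi (b g) \o b).
  have [sphi E] := phiE (b g); rewrite -(tmapE hM sb) // E (tmapE hM sb) //.
  have <- : Ohat (X g) w = tval w (f \o b).
    exact: (form_bivectorP hG hOhat gauge_nondegenerate).
  by rewrite OhatE ham_tgt // subrK.
have sY : smooth_vfield Y.
  move=> h sh; have := bivector_ham_smooth hpiB sf sh => sV.
  rewrite (_ : vapply Y h = fun x => -1 * vapply (ham_vfield piB f) h x).
    by apply: smooth_funM => //; exact: smooth_fun_cst.
  by apply/funext => x; rewrite mulN1r.
apply: (complete_lift hG hM (J := b) (e := e) (ham_smooth (sb sf)) sY _ Yc).
- exact: (@smooth_pullback_continuous _ _ _ e hM hG se).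
- move=> gam t ig; have := velocity_tmap hM sb ig.
  by rewrite -/X ham_tgt.
- by apply: (@tgt_lift X phi) => // x; case: (phiE x).
Qed.

Lemma gauge_bimodule : simply_connected_fibers a -> morita_bimodule pi piB Ohat a b.
Proof.
move=> sca; have [[smG _] _ [ssa ssb] _ _] := lie; split.
- by split; [|exact: gauge_symplectic].
- by split; [exact: gauge_src_poisson| | |exact: gauge_src_complete].
- split; [exact: gauge_tgt_poisson| | |exact: gauge_tgt_complete] => //.
  exact: tgt_simply_connected.
(* Against a vector killed by [tmap b] the pull back of [B] is 0, so the orthogonal may be taken for
   [Om]; the two inclusions are [fibers_orthogonal] and [src_kernel]. *)
- move=> g; apply/seteqP; split=> v.
    move=> av w bw; rewrite OhatE bw form_0r // subr0; exact: fibers_orthogonal.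
  move=> H; apply: src_kernel => w bw; have := H w bw.
  by rewrite OhatE bw form_0r // subr0.
Qed.

End Gauge.
End SymplecticGroupoid.

Theorem theorem5p1 (R : realType) (M G : atlas_space R)
    (pi : bivector M) (s : groupoid_ops G M) (Om : form2 G)
    (B : form2 M) (piB : bivector M) :
  symplectic_groupoid s Om pi ->
  simply_connected_fibers (gsrc s) ->
  closed_form2 B ->
  poisson piB ->
  (forall x : M, gauge B pi x = bivector_graph piB x) ->
  morita_equivalent pi piB /\
  morita_bimodule pi piB (form_sub Om (pullback (gtgt s) B)) (gsrc s) (gtgt s).
Proof.
case: s => a b e i m sg sca cB poB gB.
have H := gauge_bimodule sg cB poB gB sca.
by split => //; exists G, (form_sub Om (pullback b B)), a, b.
Qed.
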